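(* Let $\beta>0$. Almost surely, the infimum in the variational problem $$\tilde\Lambda_0:=\inf\bigl\{\langle\!\langle f,\mathcal{H}_\beta f\rangle\!\rangle:\ f\in L^*,\ f(0)=0,\ \|f\|_2=1\bigr\}$$ is attained at an eigenfunction $f_0$ of the stochastic Airy operator $\mathcal{H}_\beta$ with eigenvalue $\Lambda_0$, where $\Lambda_0$ is the smallest eigenvalue of $\mathcal{H}_\beta$.
   Context: Let $b$ be a standard Brownian motion with $b_0=0$, and $\bar b_x=\int_x^{x+1}b_y\,dy$, so $\bar b'_x=b_{x+1}-b_x$. $L^*$ is the Hilbert space of (locally absolutely continuous) $f:[0,\infty)\to\mathbb{R}$ with $f(0)=0$ and $\|f\|_*^2=\int_0^\infty (f')^2+(1+x)f^2\,dx<\infty$. The quadratic form of $\mathcal{H}_\beta=-\frac{d^2}{dx^2}+x+\frac{2}{\sqrt\beta}b'_x$ is, for $f\in L^*$, $$\langle\!\langle f,\mathcal{H}_\beta f\rangle\!\rangle=\int_0^\infty (f')^2+xf^2\,dx+\tfrac{2}{\sqrt\beta}\int_0^\infty f^2(x)\,\bar b'_x\,dx+\tfrac{4}{\sqrt\beta}\int_0^\infty f'(x)f(x)(\bar b_x-b_x)\,dx ,$$ which is a.s. finite for all $f\in L^*$. A pair $(f,\lambda)\in L^*\times\mathbb{R}$ is an eigenfunction/eigenvalue pair of $\mathcal{H}_\beta$ if $\|f\|_2=1$ and for all $x\ge0$ $$f'(x)-f'(0)=\tfrac{2}{\sqrt\beta}f(x)b_x-\int_0^x\tfrac{2}{\sqrt\beta}b_yf'(y)\,dy+\int_0^x(y-\lambda)f(y)\,dy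 .$$ *)

(* Defs.v *)
From HB Require Import structures.
From mathcomp Require Import all_boot all_order all_algebra.
From mathcomp Require Import all_classical all_reals all_analysis.

Set Implicit Arguments.
Unset Strict Implicit.
Unset Printing Implicit Defensive.

Import Order.TTheory GRing.Theory Num.Theory.
Import numFieldNormedType.Exports.

Local Open Scope classical_set_scope.
Local Open Scope ring_scope.

(* Functions on [0, +oo[ are total functions R -> R (or families indexed by R)
   of which nothing is required, and nothing used, at negative arguments. *)

(* The increments are jointly independent; choosing A i := setT for some of
   the indices gives the product rule for every subfamily of increments. *)
Definition independent_increments (R : realType) (d : measure_display)
    (T : measurableType d) (P : probability T R) (b : R -> {RV P >-> R}) : Prop :=
  forall (n : nat) (t : nat -> R) (A : nat -> set R),
    0 <= t 0%N -> (forall i : nat, (i < n)%N -> t i <= t i.+1) ->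
    (forall i : nat, measurable (A i)) ->
    P (\big[setI/setT]_(i < n) ((b (t i.+1) \- b (t i))%R @^-1` A i)) =
    (\prod_(i < n) P ((b (t i.+1) \- b (t i))%R @^-1` A i))%E.

Definition brownian_motion (R : realType) (d : measure_display)
    (T : measurableType d) (P : probability T R) (b : R -> {RV P >-> R}) : Prop :=
  [/\ {ae P, forall w, b 0 w = 0},
      {ae P, forall w, {within `[0, +oo[, continuous (fun t => b t w)}},
      independent_increments b
    & forall s t : R, 0 <= s -> s < t -> forall A : set R, measurable A ->
        (* the second parameter of normal_prob is the standard deviation *)
        pushforward P (b t \- b s) A = normal_prob 0 (Num.sqrt (t - s)) A].

Definition abs_continuous_on (R : realType) (a c : R) (f : R -> R) : Prop :=
  forall e : R, 0 < e -> exists2 r : R, 0 < r &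
    forall (n : nat) (u v : 'I_n -> R),
      (forall i, [/\ a <= u i, u i <= v i & v i <= c]) ->
      trivIset [set: 'I_n] (fun i => `]u i, v i[%classic) ->
      \sum_(i < n) (v i - u i) < r ->
      \sum_(i < n) `|f (v i) - f (u i)| < e.

Definition loc_abs_continuous (R : realType) (f : R -> R) : Prop :=
  forall a c : R, 0 <= a -> a <= c -> abs_continuous_on a c f.

(* Derivative of a function on [0, +oo[: one-sided at 0.  It has a default
   value where the limit does not exist, which for a locally absolutely
   continuous function is only on a set of measure zero. *)
Definition hderivable (R : realType) (f : R -> R) (x : R) : Prop :=
  if 0 < x then derivable f x 1
  else cvg ((fun h : R => h^-1 * (f h - f 0)) @ (0 : R)^'+).

Definition hderiv (R : realType) (f : R -> R) (x : R) : R :=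
  if 0 < x then derive1 f x
  else lim ((fun h : R => h^-1 * (f h - f 0)) @ (0 : R)^'+).

Definition Lstar (R : realType) (f : R -> R) : Prop :=
  [/\ loc_abs_continuous f, f 0 = 0
    & (\int[lebesgue_measure]_(x in `[0%R, +oo[)
         ((hderiv f x) ^+ 2 + (1 + x) * (f x) ^+ 2)%:E < +oo)%E].

Definition L2norm (R : realType) (f : R -> R) : \bar R :=
  ('N[lebesgue_measure]_(2%:E) [EFin \o (f \_ `[0%R, +oo[)])%E.

Definition bbar (R : realType) (w : R -> R) (x : R) : R :=
  \int[lebesgue_measure]_(y in `[x, x + 1]) w y.

Definition bbar' (R : realType) (w : R -> R) (x : R) : R := w (x + 1) - w x.

(* The real-valued integrals are junk when the integrand is not integrable;
   almost surely in the Brownian path w, this happens for no f in L^*. *)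
Definition airy_form (R : realType) (beta : R) (w f : R -> R) : R :=
  \int[lebesgue_measure]_(x in `[0, +oo[)
     ((hderiv f x) ^+ 2 + x * (f x) ^+ 2)
  + 2 / Num.sqrt beta *
    \int[lebesgue_measure]_(x in `[0, +oo[) ((f x) ^+ 2 * bbar' w x)
  + 4 / Num.sqrt beta *
    \int[lebesgue_measure]_(x in `[0, +oo[) (hderiv f x * f x * (bbar w x - w x)).

(* The equation at every x >= 0 presupposes that f'(x) exists there. *)
Definition airy_eigenpair (R : realType) (beta : R) (w f : R -> R) (l : R) :
    Prop :=
  [/\ Lstar f, L2norm f = 1%E
    & forall x : R, 0 <= x -> hderivable f x /\
        hderiv f x - hderiv f 0 =
          2 / Num.sqrt beta * f x * w x
          - \int[lebesgue_measure]_(y in `[0, x])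
              (2 / Num.sqrt beta * w y * hderiv f y)
          + \int[lebesgue_measure]_(y in `[0, x]) ((y - l) * f y)].

Definition airy_admissible (R : realType) : set (R -> R) :=
  [set f | [/\ Lstar f, f 0 = 0 & L2norm f = 1%E]].

Definition airy_inf (R : realType) (beta : R) (w : R -> R) : \bar R :=
  ereal_inf [set (airy_form beta w f)%:E | f in @airy_admissible R].

(* Main.v *)
Require Import Defs.
From HB Require Import structures.
From mathcomp Require Import all_boot all_order all_algebra.
From mathcomp Require Import all_classical all_reals all_analysis.
From mathcomp Require Import measurable_realfun ring lra.

Import Order.TTheory GRing.Theory Num.Theory.
Import numFieldNormedType.Exports.

Local Open Scope classical_set_scope.
Local Open Scope ring_scope.

(* Put [c = 2 / sqrt beta], [D = c (bbar - b)] and [E = c bbar'], so that the form has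
   density [q(f) = f'^2 + (x + E) f^2 + 2 f f' D], and the eigenvalue equation becomes, with
   [v = f' + D f], the linear system [f' = v - D f], [v' = D (v - D f) + (x - l + E) f]
   with continuous coefficients.  The sixth moments of the dyadic increments of [b] give,
   almost surely, [D^2, |E| <= e (1 + x) + C_e] for every [e > 0]; hence [q] is coercive
   up to a multiple of [f^2].

   Let [phi_l] solve the system with [phi_l(0) = 0], [v_l(0) = 1], and let [L0] be the
   supremum of the [l] for which [phi_l > 0] on [(0, oo)].  By continuity in [l],
   [phi_L0 > 0].  For [l] decreasing to [L0] the first zero [a] of [phi_l] tends to
   infinity, while integrating [q(phi_l) = l phi_l^2 + (phi_l v_l)'] over [[0, a]] bounds the
   energy of [phi_l] on [[0, a]] in terms of its mass near the origin; so [phi_L0] lies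
   in [L^*].

   With [rho = v / phi] for [phi = phi_L0], Jacobi's identity
   [q(f) - L0 f^2 - (f^2 rho)' = (f' - f (rho - D))^2] shows that the form is at least
   [L0 ||f||^2] on [L^*].  Finally [q(f) - l f^2 = (f v)'] along any eigenfunction, so that
   the value of the form at a normalised eigenfunction is its eigenvalue. *)

(** * Absolutely continuous functions *)

(** No minimising sequence and no compactness are used: the minimiser is found by shooting, and its
    minimality comes from an exact square. All that this asks of the path is that [D^2] and [E] be
    little-o of [x]. The bounds on dyadic increments need a weight of order [n^2] on [[n, n + 1]] to
    be summable over [n]; with sixth moments the squared increments are then of order [n^(2/3)],
    whereas fourth moments would give only order [n]. A function of [L^*] is merely absolutely
    continuous, so Jacobi's identity holds almost everywhere only, and integrating it takes the
    fundamental theorem of calculus for absolutely continuous functions, derived here from the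
    Radon-Nikodym theorem. The boundary term [f^2 rho] has to be controlled at both ends. At [0],
    [rho] has a pole, compensated by [f^2 = o(x)]. At infinity, the energy density of [f] is
    integrable, so [(1 + X) f(X)^2] is small at suitable arbitrarily large [X]; it is enough that
    [rho] is bounded below by a multiple of [-(1 + X)]. *)

Definition oc_abs_continuous {R : realType} (F : R -> R) : Prop :=
  forall e : R, 0 < e -> exists2 r : R, 0 < r &
    forall (n : nat) (u v : 'I_n -> R),
      (forall i, u i < v i) ->
      trivIset [set: 'I_n] (fun i => `]u i, v i]%classic) ->
      \sum_(i < n) (v i - u i) < r ->
      \sum_(i < n) (F (v i) - F (u i)) <= e.

Lemma ls_measure_oc {R : realType} (F : cumulative R R) (a b : R) : a <= b ->
  lebesgue_stieltjes_measure F `]a, b] = (F b - F a)%:E.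
Proof.
move=> ab; rewrite /lebesgue_stieltjes_measure/= /measure_extension/=.
rewrite measurable_mu_extE/=; last exact: is_ocitv.
by rewrite wlength_itv_bnd.
Qed.

(** The Stieltjes measure extends from the ring generated by half-open intervals. A member of that
    ring is a finite disjoint union of nonempty such intervals, and both measures of it are sums of
    increments over the same family. *)
Lemma ls_measure_ring_le {R : realType} (F : cumulative R R) (e r : R)
  (H : forall (n : nat) (u v : 'I_n -> R),
      (forall i, u i < v i) ->
      trivIset [set: 'I_n] (fun i => `]u i, v i]%classic) ->
      \sum_(i < n) (v i - u i) < r ->
      \sum_(i < n) (F (v i) - F (u i)) <= e)
  (U : set (SetRing.type (ocitv_type R))) : measurable U ->
  (@lebesgue_measure R (U : set R) < r%:E)%E ->
  (lebesgue_stieltjes_measure F (U : set R) <= e%:E)%E.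
Proof.
move=> mU lU.
have [B [finB B0 tB mB UB]] := @SetRing.ring_finite_set _ (ocitv_type R) U mU.
have /choice[p pP] : forall X : set (ocitv_type R), exists p : R * R,
    B X -> p.1 < p.2 /\ X = `]p.1, p.2]%classic.
  move=> X; have [BX|BX] := pselect (B X); last by exists (0, 0).
  have /ocitvP[X0|[x xlt XE]] := mB _ (mem_set BX); last by exists x.
  by have := B0 _ BX; rewrite X0 => -[].
have /finite_seqP[s0 Bs0] := finB.
(* Without repetitions, distinct indices give distinct, hence disjoint, intervals. *)
pose s := undup s0.
have sB X : (X \in s) = (X \in s0) by rewrite mem_undup.
pose n := size s.
pose X (i : 'I_n) : set (ocitv_type R) := nth set0 s i.
have XB i : B (X i) by rewrite Bs0/= -sB; exact: mem_nth.
have mX i : measurable (X i : set R).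
  by rewrite (pP _ (XB i)).2; exact: measurable_itv.
have tX : trivIset [set: 'I_n] X.
  apply/trivIsetP => i j _ _ ij.
  move/trivIsetP : tB => /(_ _ _ (XB i) (XB j)); apply.
  by rewrite /X nth_uniq// undup_uniq.
have UX : U = \big[setU/set0]_(i < n) X i.
  rewrite UB; apply/seteqP; split=> [x [Y BY Yx]|x].
    have Ys : Y \in s by move: BY; rewrite Bs0/= sB.
    have h : (index Y s < n)%N by rewrite index_mem.
    rewrite -bigcup_seq_cond/=.
    by exists (Ordinal h) => /=; [rewrite mem_index_enum|rewrite /X/= nth_index].
  by rewrite -bigcup_seq_cond => -[i /= _ Xx]; exists (X i).
have measX (mu : {measure set (measurableTypeR R) -> \bar R}) :
    mu U = (\sum_(i < n) mu (X i))%E.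
  by rewrite UX measure_bigsetU_ord//.
have lsX (G : cumulative R R) (i : 'I_n) :
    lebesgue_stieltjes_measure G (X i) = (G (p (X i)).2 - G (p (X i)).1)%:E.
  have [lt_p {1}->] := pP _ (XB i).
  by rewrite ls_measure_oc// ltW.
rewrite measX (eq_bigr _ (fun i _ => lsX F i)) sumEFin lee_fin.
apply: H.
- by move=> i; have [] := pP _ (XB i).
- rewrite (_ : (fun i => _) = X)//; apply/funext => i.
  by rewrite -(pP _ (XB i)).2.
- rewrite -lte_fin -sumEFin; apply: le_lt_trans lU.
  by rewrite measX (eq_bigr _ (fun i _ => lsX idfun i)).
Qed.

(** By the definition of the outer measure, a null set is covered by countably many half-open
    intervals of total length below [r]. Each finite part of the cover has Stieltjes measure at most
    [e], and continuity from below passes this to the whole cover. *)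
Lemma oc_abs_continuous_dominates {R : realType} (F : cumulative R R) :
  oc_abs_continuous F -> lebesgue_stieltjes_measure F `<< @lebesgue_measure R.
Proof.
move=> acF; apply/null_content_dominatesP => E mE lE0.
apply/eqP; rewrite eq_le measure_ge0 andbT.
apply/lee_addgt0Pr => e e0; rewrite add0e.
have [r r0 H] := acF e e0.
have lEr : (@lebesgue_measure R E < r%:E)%E by rewrite lE0 lte_fin.
rewrite /lebesgue_measure/= /lebesgue_stieltjes_measure/= /measure_extension/= /mu_ext in lEr.
move/ereal_inf_lt : lEr => [_ [A [mA EA] <-]] Ar.
pose U n : set R := \big[setU/set0]_(k < n) A k.
have mU n : measurable (U n).
  apply: bigsetU_measurable => k _.
  have /ocitvP[->|[x _ ->]] := mA k; first exact: measurable0.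
  exact: measurable_itv.
have Ule n : (lebesgue_stieltjes_measure F (U n) <= e%:E)%E.
  apply: (ls_measure_ring_le F e r H).
    apply: bigsetU_measurable => k _.
    by apply: SetRing.measurable_subring; exact: mA.
  apply: le_lt_trans Ar.
  apply: (@le_trans _ _ (\sum_(k < n) (wlength idfun (A k)))%E).
    apply: (@le_trans _ _ (\sum_(k < n) (@lebesgue_measure R (A k)))%E).
      apply: Boole_inequality => k _; have /ocitvP[->|[x _ ->]] := mA k; first exact: measurable0.
      exact: measurable_itv.
    apply: lee_sum => k _.
    by rewrite /lebesgue_measure/= /lebesgue_stieltjes_measure/= /measure_extension/= measurable_mu_extE.
  rewrite -(big_mkord xpredT (fun k => wlength idfun (A k))).
  apply: nneseries_lim_ge => k _.
  by move=> _; exact: (wlength_ge0 idfun).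
have cvgU : lebesgue_stieltjes_measure F \o U @ \oo --> lebesgue_stieltjes_measure F (\bigcup_n U n).
  apply: nondecreasing_cvg_mu => //.
    exact: bigcupT_measurable.
  by move=> m n mn; apply/subsetPset; exact: subset_bigsetU.
apply: (@le_trans _ _ (lebesgue_stieltjes_measure F (\bigcup_n U n))).
  apply: le_measure; rewrite ?inE//; first exact: bigcupT_measurable.
  move=> x /EA[k _ Akx]; exists k.+1 => //.
  by rewrite /U big_ord_recr/=; right.
rewrite -(cvg_lim _ cvgU)//; apply: lime_le; first by apply/cvg_ex; eexists; exact: cvgU.
by apply: nearW => n /=.
Qed.

(** General index types serve for pairs of an interval and a cell of a partition of it. *)
Lemma abs_continuous_on_fin {R : realType} (a c : R) (f : R -> R) :
  abs_continuous_on a c f ->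
  forall e : R, 0 < e -> exists2 r : R, 0 < r &
    forall (I : finType) (u v : I -> R),
      (forall i, [/\ a <= u i, u i <= v i & v i <= c]) ->
      trivIset [set: I] (fun i => `]u i, v i[%classic) ->
      \sum_i (v i - u i) < r ->
      \sum_i `|f (v i) - f (u i)| < e.
Proof.
move=> acf e e0; have [r r0 H] := acf e e0; exists r => // I u v uv tuv sr.
have := H #|I| (u \o enum_val) (v \o enum_val).
rewrite -(big_enum_val (fun i => v i - u i))/=.
rewrite -(big_enum_val (fun i => `|f (v i) - f (u i)|))/=.
apply => //; apply/trivIsetP => i j _ _ ij.
move/trivIsetP : tuv; apply => //.
by apply: contra ij => /eqP/enum_val_inj ->.
Qed.

Lemma itv_partition_nth_mono {R : realType} (a b : R) (s : seq R) (i j : nat) :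
  itv_partition a b s -> (i <= j <= size s)%N ->
  nth b (a :: s) i <= nth b (a :: s) j.
Proof.
move=> [ps _] /andP[ij js].
have ss : sorted <=%R (a :: s).
  by rewrite /=; apply: sub_path ps => x y /ltW.
apply: (sorted_leq_nth le_trans le_refl b ss) => //.
by rewrite inE /= ltnS; exact: leq_trans ij js.
Qed.

(** The cells of partitions of disjoint intervals are again disjoint intervals, of the same total
    length, so absolute continuity applies to all cells at once. *)
Lemma abs_continuous_on_variations {R : realType} (a c : R) (f : R -> R) :
  abs_continuous_on a c f ->
  forall e : R, 0 < e -> exists2 r : R, 0 < r &
    forall (n : nat) (u v x : 'I_n -> R),
      (forall i, [/\ a <= u i, u i <= v i & v i <= c]) ->
      trivIset [set: 'I_n] (fun i => `]u i, v i[%classic) ->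
      \sum_(i < n) (v i - u i) < r ->
      (forall i, variations (u i) (v i) f (x i)) ->
      \sum_(i < n) x i <= e.
Proof.
move=> acf e e0; have [r r0 H] := abs_continuous_on_fin a c f acf e e0.
exists r => // n u v x uv tuv sr xv.
have /choice[s sP] : forall i, exists s,
    itv_partition (u i) (v i) s /\ x i = variation (u i) (v i) f s.
  by move=> i; have [s ? ?] := xv i; exists s.
pose F i k := nth (v i) (u i :: s i) k.
pose I := {i : 'I_n & 'I_(size (s i))}.
pose U (p : I) := F (tag p) (tagged p).
pose V (p : I) := F (tag p) (tagged p).+1.
have F0 i : F i 0%N = u i by [].
have Fs i : F i (size (s i)) = v i.
  by rewrite /F (itv_partition_nth_size _ (sP i).1).
have Fm i j k : (j <= k <= size (s i))%N -> F i j <= F i k.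
  exact: itv_partition_nth_mono (sP i).1.
have Fge i k : (k <= size (s i))%N -> u i <= F i k.
  by move=> ks; rewrite -F0 Fm.
have Fle i k : (k <= size (s i))%N -> F i k <= v i.
  by move=> ks; rewrite -Fs Fm// ks leqnn.
have tri : trivIset [set: I] (fun p => `]U p, V p[%classic).
  apply/trivIsetP => -[i k] [j l] _ _ ijkl; apply/seteqP; split => // y [].
  rewrite /U /V /= !in_itv/= => /andP[y1 y2] /andP[y3 y4].
  have [ij|ij] := eqVneq i j.
    subst j.
    have : k != l by apply: contra ijkl => /eqP ->.
    rewrite -(inj_eq val_inj) neq_ltn => /orP[kl|lk].
      have : F i k.+1 <= F i l by apply: Fm; rewrite kl ltnW.
      by move: (lt_trans y3 y2) => /lt_le_trans h /h; rewrite ltxx.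
    have : F i l.+1 <= F i k by apply: Fm; rewrite lk ltnW.
    by move: (lt_trans y1 y4) => /lt_le_trans h /h; rewrite ltxx.
  move/trivIsetP : tuv => /(_ i j Logic.I Logic.I ij) /seteqP[+ _].
  apply; split; rewrite /= in_itv/=; apply/andP; split.
  - exact: le_lt_trans (Fge _ _ (ltnW (ltn_ord k))) y1.
  - exact: lt_le_trans y2 (Fle _ _ (ltn_ord k)).
  - exact: le_lt_trans (Fge _ _ (ltnW (ltn_ord l))) y3.
  - exact: lt_le_trans y4 (Fle _ _ (ltn_ord l)).
have sumE : \sum_p (V p - U p) = \sum_(i < n) (v i - u i).
  rewrite -(sig_big_dep xpredT (fun _ => xpredT) (fun i (k : 'I_(size (s i))) => F i k.+1 - F i k))/=.
  apply: eq_bigr => i _.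
  rewrite -(big_mkord xpredT (fun k => F i k.+1 - F i k)) telescope_sumr//.
  by rewrite Fs F0.
have := H I U V _ tri; rewrite sumE => /(_ _ sr) H1.
apply/ltW; apply: le_lt_trans (H1 _).
  rewrite -(sig_big_dep xpredT (fun _ => xpredT) (fun i (k : 'I_(size (s i))) => `|f (F i k.+1) - f (F i k)|))/=.
  apply: ler_sum => i _.
  rewrite (sP i).2 /variation.
  by rewrite -(big_mkord xpredT (fun k => `|f (F i k.+1) - f (F i k)|)).
move=> [i k]; rewrite /U /V/=; have [h1 h2 h3] := uv i; split.
- exact: le_trans h1 (Fge _ _ (ltnW (ltn_ord k))).
- by apply: Fm; rewrite leqnSn/=.
- exact: le_trans (Fle _ _ (ltn_ord k)) h3.
Qed.

(** The variation is at most [1] on an interval shorter than [r], and finitely many steps of length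
    [r / 2] lead from [a] to [x]. *)
Lemma abs_continuous_on_TV_fin {R : realType} (a c : R) (f : R -> R) :
  abs_continuous_on a c f -> forall x, a <= x -> x <= c ->
  total_variation a x f \is a fin_num.
Proof.
move=> acf.
have [r r0 H] := abs_continuous_on_variations a c f acf 1 ltr01.
have small x y : a <= x -> x <= y -> y <= c -> y - x < r ->
    total_variation x y f \is a fin_num.
  move=> ax xy yc yxr; apply/bounded_variationP => //.
  exists 1 => z zv.
  have := H 1%N (fun=> x) (fun=> y) (fun=> z).
  rewrite !big_ord1; apply => //.
  by apply/trivIsetP => i j _ _; rewrite (ord1 i) (ord1 j) eqxx.
have main k : forall x, a <= x -> x <= c -> x - a <= k%:R * (r / 2) ->
    total_variation a x f \is a fin_num.
  elim: k => [|k IH] x ax xc.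
    rewrite mul0r => xa; have -> : x = a by lra.
    by rewrite total_variationxx.
  rewrite -natr1 mulrDl mul1r => xk.
  have [xs|xs] := leP x (a + r / 2); first by apply: small => //; lra.
  rewrite (@total_variationD _ a x (x - r / 2) f); [|lra..].
  by rewrite fin_numD IH ?small//; lra.
move=> x ax xc.
have [k hk] : exists k : nat, x - a <= k%:R * (r / 2).
  exists (Num.truncn ((x - a) / (r / 2))).+1.
  rewrite -ler_pdivrMr; last by lra.
  by apply/ltW; rewrite truncnS_gt.
exact: main hk.
Qed.

(** The retraction onto [[a, c]]: it turns functions on this interval into functions on the line, on
    which Stieltjes measures are defined. *)
Definition clamp {R : realType} (a c x : R) : R := Num.max a (Num.min x c).

Lemma clamp_bound {R : realType} (a c x : R) : a <= c -> a <= clamp a c x <= c.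
Proof.
by move=> ac; rewrite /clamp le_max lexx/= ge_max ac/= ge_min lexx orbT.
Qed.

Lemma clamp_id {R : realType} (a c x : R) : a <= x -> x <= c -> clamp a c x = x.
Proof. by move=> ax xc; rewrite /clamp min_l// max_r. Qed.

Lemma clamp_mono {R : realType} (a c x y : R) : x <= y -> clamp a c x <= clamp a c y.
Proof.
move=> xy; rewrite /clamp ge_max le_max lexx/= le_max; apply/orP; right.
by rewrite le_min !ge_min xy lexx orbT.
Qed.

Lemma clampB {R : realType} (a c x y : R) : x <= y ->
  clamp a c y - clamp a c x <= y - x.
Proof.
move=> xy; rewrite /clamp /Num.max /Num.min.
by do ?case: ifPn; rewrite -?leNgt => *; lra.
Qed.

Lemma clamp_itv {R : realType} (a c u v : R) :
  `]clamp a c u, clamp a c v[ `<=` `]u, v[.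
Proof.
move=> y; rewrite /= !in_itv/= /clamp /Num.max /Num.min.
by do ?case: ifPn; rewrite -?leNgt => *; lra.
Qed.

Lemma abs_continuous_on_TV_oc {R : realType} (a c : R) (f : R -> R) : a <= c ->
  abs_continuous_on a c f ->
  oc_abs_continuous (fun x => fine (total_variation a (clamp a c x) f)).
Proof.
move=> ac acf e e0.
have [r r0 H] := abs_continuous_on_variations a c f acf e e0.
exists r => // n u v uv tuv sr.
have TVfin := abs_continuous_on_TV_fin a c f acf.
pose u' i := clamp a c (u i); pose v' i := clamp a c (v i).
have u'v' i : [/\ a <= u' i, u' i <= v' i & v' i <= c].
  have /andP[h1 h2] := clamp_bound a c (u i) ac.
  have /andP[h3 h4] := clamp_bound a c (v i) ac.
  by split => //; apply: clamp_mono; exact/ltW.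
have TVuv i : total_variation (u' i) (v' i) f \is a fin_num /\
   fine (total_variation a (v' i) f) - fine (total_variation a (u' i) f) =
   fine (total_variation (u' i) (v' i) f).
  have [h1 h2 h3] := u'v' i.
  have h := @total_variationD _ a (v' i) (u' i) f h1 h2.
  have fv := TVfin (v' i) (le_trans h1 h2) h3.
  have fu := TVfin (u' i) h1 (le_trans h2 h3).
  have fuv : total_variation (u' i) (v' i) f \is a fin_num.
    by move: fv; rewrite h fin_numD fu.
  split => //; rewrite h fineD//; lra.
under eq_bigr => i _ do rewrite (TVuv i).2.
apply/ler_addgt0Pr => eta eta0.
(* Each variation is approximated by that of a partition up to [d]; the [n] errors add up to at most
   [eta], and [n.+1] covers the case [n = 0]. *)
pose d := eta / n.+1%:R.
have d0 : 0 < d by rewrite divr_gt0.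
have /choice[x xP] : forall i, exists x, variations (u' i) (v' i) f x /\
    fine (total_variation (u' i) (v' i) f) - d < x.
  move=> i.
  have : (total_variation (u' i) (v' i) f - d%:E < total_variation (u' i) (v' i) f)%E.
    by rewrite lteBlDr// lteDl ?lte_fin//; have [] := TVuv i.
  rewrite {2}/total_variation => /ereal_sup_gt[_ [x vx <-]] hx.
  exists x; split => //.
  by rewrite -lte_fin EFinB fineK//; have [] := TVuv i.
apply: (@le_trans _ _ (\sum_(i < n) (x i + d))).
  by apply: ler_sum => i _; have [_] := xP i; lra.
rewrite big_split/= sumr_const card_ord; apply: lerD.
  apply: (H n u' v') => //; last by move=> i; have [] := xP i.
    apply/trivIsetP => i j _ _ ij; apply/seteqP; split => // y [].
    move=> /clamp_itv yi /clamp_itv yj.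
    move/trivIsetP : tuv => /(_ i j Logic.I Logic.I ij) /seteqP[+ _].
    by apply; split; exact: subset_itv_oo_oc.
  apply: le_lt_trans sr; apply: ler_sum => i _; apply: clampB; exact/ltW.
rewrite -mulr_natl /d mulrA ler_pdivrMr// mulrC ler_pM2l//.
by rewrite ler_nat.
Qed.

Lemma TV_dominates {R : realType} (a c : R) (f : R -> R) : a <= c ->
  abs_continuous_on a c f -> forall x y, x <= y ->
  `|f (clamp a c y) - f (clamp a c x)| <=
  fine (total_variation a (clamp a c y) f) - fine (total_variation a (clamp a c x) f).
Proof.
move=> ac acf x y xy.
have TVfin := abs_continuous_on_TV_fin a c f acf.
have /andP[h1 h2] := clamp_bound a c x ac.
have /andP[h3 h4] := clamp_bound a c y ac.
have h5 := clamp_mono a c x y xy.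
rewrite -lee_fin EFinB !fineK; [|exact: TVfin..].
rewrite (@total_variationD _ a _ (clamp a c x) f)// addeAC subee ?add0e; last exact: TVfin.
exact: total_variation_ge.
Qed.

(** The increments of [F + G] are at most twice those of [F]. *)
Lemma oc_abs_continuous_add {R : realType} (F G : R -> R) :
  oc_abs_continuous F -> (forall x y, x <= y -> `|G y - G x| <= F y - F x) ->
  oc_abs_continuous (fun x => F x + G x).
Proof.
move=> acF FG e e0.
have [r r0 H] := acF (e / 2) (divr_gt0 e0 (ltr0n _ 2)).
exists r => // n u v uv tuv sr.
apply: (@le_trans _ _ (\sum_(i < n) 2 * (F (v i) - F (u i)))).
  apply: ler_sum => i _.
  have := FG _ _ (ltW (uv i)); have := ler_norm (G (v i) - G (u i)); lra.
by rewrite -mulr_sumr; have := H n u v uv tuv sr; lra.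
Qed.

Lemma oc_abs_continuous_right_continuous {R : realType} (F : R -> R) :
  oc_abs_continuous F -> {homo F : x y / x <= y} -> right_continuous F.
Proof.
move=> acF ndF x; apply/cvgrPdist_le => e e0.
have [r r0 H] := acF e e0.
near=> y.
have xy : x < y by near: y; exact: nbhs_right_gt.
have yr : y - x < r by rewrite ltrBlDl; near: y; apply: nbhs_right_lt; rewrite ltrDl.
rewrite distrC ger0_norm ?subr_ge0 ?ndF ?(ltW xy)//.
have := H 1%N (fun=> x) (fun=> y); rewrite !big_ord1; apply => //.
by apply/trivIsetP => i j _ _; rewrite (ord1 i) (ord1 j) eqxx.
Unshelve. all: by end_near. Qed.

(** The bounds by [F a] and [F c] make the Stieltjes measure finite, so that its Radon-Nikodym
    density is integrable on the whole line. *)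
Lemma ls_density {R : realType} (a c : R) (F : R -> R) :
  {homo F : x y / x <= y} -> oc_abs_continuous F ->
  (forall x, F a <= F x <= F c) ->
  exists g : R -> R, (@lebesgue_measure R).-integrable setT (EFin \o g) /\
    forall x y, x <= y -> (\int[lebesgue_measure]_(t in `[x, y]) (g t)%:E = (F y - F x)%:E)%E.
Proof.
move=> ndF acF Fac.
pose cF : cumulative R R := HB.pack F (isCumulative.Build R _ R F ndF
  (oc_abs_continuous_right_continuous F acF ndF)).
pose nu := lebesgue_stieltjes_measure cF.
have nuT : (nu setT <= (F c - F a)%:E)%E.
  pose U n : set R := `]- n%:R, n%:R]%classic.
  have UT : \bigcup_n U n = setT.
    apply/seteqP; split => // x _.
    exists (Num.truncn `|x|).+1 => //=.
    have := truncnS_gt `|x|; rewrite /U/= in_itv/=.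
    by move=> h; move: (h); rewrite ltr_norml => /andP[-> /ltW].
  have mU n : measurable (U n) by exact: measurable_itv.
  have cvgU : nu \o U @ \oo --> nu (\bigcup_n U n).
    apply: nondecreasing_cvg_mu => //.
      exact: bigcupT_measurable.
    move=> m n mn; apply/subsetPset => x; rewrite /U/= !in_itv/= => /andP[h1 h2].
    have mn' : m%:R <= n%:R :> R by rewrite ler_nat.
    by apply/andP; split; lra.
  rewrite -UT -(cvg_lim _ cvgU)//; apply: lime_le; first by apply/cvg_ex; eexists; exact: cvgU.
  apply: nearW => n /=.
  rewrite /nu ls_measure_oc ?lee_fin; last by have := ler0n R n; lra.
  by have /andP[? ?] := Fac n%:R; have /andP[? ?] := Fac (- n%:R); rewrite /=; lra.
have nufin : fin_num_fun nu.
  move=> U mU; rewrite ge0_fin_numE//; apply: le_lt_trans (ltry (F c - F a)).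
  by apply: le_trans nuT; apply: le_measure; rewrite ?inE.
pose fnu : {finite_measure set (measurableTypeR R) -> \bar R} :=
  HB.pack nu (Measure_isFinite.Build _ _ _ nu nufin).
have dom : fnu `<< @lebesgue_measure R by exact: (oc_abs_continuous_dominates cF acF).
have [h [h0 hfin hint hE]] := radon_nikodym_sigma_finite dom.
have hEF : EFin \o (fine \o h) = h by apply/funext => x /=; rewrite fineK.
exists (fine \o h); rewrite hEF; split => // x y xy.
transitivity (\int[lebesgue_measure]_(t in `[x, y]) h t)%E.
  by apply: eq_integral => t _; rewrite /= fineK.
(* The endpoint [x] has Lebesgue measure zero. *)
transitivity (\int[lebesgue_measure]_(t in `]x, y]) h t)%E; last first.
  by rewrite -hE; [exact: ls_measure_oc|exact: measurable_itv].
rewrite integral_itv_obnd_cbnd//.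
by apply: measurable_funS (measurable_int _ hint).
Qed.

(* The Jordan decomposition [f = (V + f) - V], with [V] the variation of [f], reduces
   the claim to the Lebesgue-Stieltjes measures of two nondecreasing functions. *)
Lemma abs_continuous_on_FTC {R : realType} (a c : R) (f : R -> R) : a <= c ->
  abs_continuous_on a c f ->
  exists g : R -> R, [/\ (@lebesgue_measure R).-integrable setT (EFin \o g),
    (forall x y, a <= x -> x <= y -> y <= c ->
      (\int[lebesgue_measure]_(t in `[x, y]) (g t)%:E = (f y - f x)%:E)%E) &
    {ae lebesgue_measure, forall x, a < x < c -> is_derive x 1 f (g x)}].
Proof.
move=> ac acf.
pose V x := fine (total_variation a (clamp a c x) f).
pose W x := V x + f (clamp a c x).
have ca : clamp a c a = a by rewrite clamp_id.
have cc : clamp a c c = c by rewrite clamp_id.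
have clampcl x : clamp a c (clamp a c x) = clamp a c x.
  by have /andP[h1 h2] := clamp_bound a c x ac; rewrite clamp_id.
have VW x y : x <= y -> `|f (clamp a c y) - f (clamp a c x)| <= V y - V x.
  exact: TV_dominates.
have acV : oc_abs_continuous V by exact: abs_continuous_on_TV_oc.
have acW : oc_abs_continuous W.
  exact: (oc_abs_continuous_add V (fun x => f (clamp a c x))).
have ndV : {homo V : x y / x <= y}.
  by move=> x y /VW; have := normr_ge0 (f (clamp a c y) - f (clamp a c x)); lra.
have ndW : {homo W : x y / x <= y}.
  by move=> x y /VW; rewrite ler_norml /W => /andP[h1 h2]; lra.
have bd (F : R -> R) : {homo F : x y / x <= y} -> (forall x, F (clamp a c x) = F x) ->
    forall x, F a <= F x <= F c.
  by move=> ndF Fc x; rewrite -(Fc x); have /andP[h1 h2] := clamp_bound a c x ac; rewrite !ndF.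
have [g1 [g1i g1E]] : exists g : R -> R, (@lebesgue_measure R).-integrable setT (EFin \o g) /\
    forall x y, x <= y -> (\int[lebesgue_measure]_(t in `[x, y]) (g t)%:E = (W y - W x)%:E)%E.
  by apply: (ls_density a c) => //; apply: bd => // x; rewrite /W /V clampcl.
have [g2 [g2i g2E]] : exists g : R -> R, (@lebesgue_measure R).-integrable setT (EFin \o g) /\
    forall x y, x <= y -> (\int[lebesgue_measure]_(t in `[x, y]) (g t)%:E = (V y - V x)%:E)%E.
  by apply: (ls_density a c) => //; apply: bd => // x; rewrite /V clampcl.
pose g x := g1 x - g2 x.
have gi : (@lebesgue_measure R).-integrable setT (EFin \o g).
  rewrite (_ : _ \o _ = (EFin \o g1) \- (EFin \o g2))%E; last exact/funext.
  exact: integrableB.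
have giS (A : set R) : measurable A -> (@lebesgue_measure R).-integrable A (EFin \o g).
  by move=> mA; exact: integrableS gi.
have gE x y : a <= x -> x <= y -> y <= c ->
    (\int[lebesgue_measure]_(t in `[x, y]) (g t)%:E = (f y - f x)%:E)%E.
  move=> ax xy yc; under eq_integral do rewrite EFinB.
  rewrite integralB//=; [|exact: integrableS g1i|exact: integrableS g2i].
  rewrite g1E// g2E// -EFinB /W.
  by rewrite !clamp_id//; [congr EFin; ring|lra..].
exists g; split => //.
(* Lebesgue differentiation of the integral of [g] from [a], which is [f y - f a] for [y] in
   [[a, c]]. *)
have := @FTC1 R g (BLeft a).
move=> /(_ (fun y => giS _ (measurable_itv _))).
have lg : locally_integrable setT g.
  apply: open_integrable_locally => //; exact: openT.
move=> /(_ lg) H0; apply: (@filterS _ _ (ae_filter_ringOfSetsType (@lebesgue_measure R)) _ _ _ H0)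
  => x H /andP[ax xc].
have ax' : (a%:E < x%:E)%E by rewrite lte_fin.
have [dF FE] := H ax'.
have fF : \forall y \near x, \int[lebesgue_measure]_(t in `[a, y]) g t = f y - f a.
  have : x \in `]a, c[ by rewrite in_itv/= ax xc.
  move=> /near_in_itvoo; apply: filterS => y; rewrite in_itv/= => /andP[ay yc].
  by rewrite /Rintegral gE// ltW.
have FD : is_derive x 1 (fun y => \int[lebesgue_measure]_(t in `[a, y]) g t + cst (f a) y) (g x).
  rewrite -[g x]addr0; apply: is_deriveD.
  by split; [exact: dF|rewrite -derive1E; exact: FE].
apply: near_eq_is_derive FD.
by apply: filterS fF => y ->; rewrite subrK.
Qed.

Lemma ae_eq_integrable {d} {T : measurableType d} {R : realType}
  (mu : {measure set T -> \bar R}) (D : set T) (f g : T -> \bar R) :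
  measurable D -> measurable_fun D g -> ae_eq mu D f g ->
  mu.-integrable D f -> mu.-integrable D g.
Proof.
move=> mD mg fg /integrableP[mf fi]; apply/integrableP; split => //.
apply: le_lt_trans fi; rewrite le_eqVlt; apply/orP; left; apply/eqP.
apply: ge0_ae_eq_integral => //; [exact: measurableT_comp|exact: measurableT_comp|].
by apply: filterS (ae_eq_sym fg) => x /= h /h ->.
Qed.

Section integral_off_null.
Context {d : measure_display} {T : measurableType d} {R : realType}
  (mu : {measure set T -> \bar R}).

Import HBNNSimple.

Let nnintegral (f : T -> \bar R) : \bar R :=
  ereal_sup [set sintegral mu h |
    h in [set h : {nnsfun T >-> R} | forall x, (h x)%:E <= f x]]%E.

(** Cutting a simple function to zero on [N] keeps its integral and brings it below [g], which is
    [f] off [N] and nonnegative on [N]. *)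
Let nnintegral_le_off_null (N : set T) (f g : T -> \bar R) :
  measurable N -> mu N = 0%E -> (forall x, 0 <= g x)%E ->
  (forall x, ~ N x -> f x = g x) ->
  (nnintegral f <= nnintegral g)%E.
Proof.
move=> mN N0 g0 fg; apply: ub_ereal_sup => _ [h hf <-].
have mNc : measurable (~` N) by exact: measurableC.
have -> : sintegral mu h = sintegral mu (proj_nnsfun h mNc).
  rewrite -!integralT_nnsfun; apply: ge0_ae_eq_integral => //.
  - exact/measurable_EFinP.
  - exact/measurable_EFinP.
  - by move=> x _; rewrite lee_fin.
  - by move=> x _; rewrite lee_fin.
  exists N; split => // x /=; apply: contra_notP => Nx _ /=.
  by rewrite mindicE mem_set//= mulr1.
apply: ereal_sup_ubound; exists (proj_nnsfun h mNc) => // x /=.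
rewrite mindicE; case: (pselect (N x)) => Nx.
  by rewrite memNset ?mulr0//; exact: g0.
by rewrite mem_set//= mulr1 -fg.
Qed.

(* No measurability is assumed: [integral] is then a difference of lower integrals. *)
Lemma integral_off_null (N D : set T) (f g : T -> \bar R) :
  measurable N -> mu N = 0%E -> (forall x, D x -> ~ N x -> f x = g x) ->
  (\int[mu]_(x in D) f x = \int[mu]_(x in D) g x)%E.
Proof.
move=> mN N0 fg.
have fgD x : ~ N x -> (f \_ D) x = (g \_ D) x.
  rewrite /patch; case: ifPn => // /set_mem Dx Nx; exact: fg.
rewrite /integral; congr (_ - _)%E; apply/eqP; rewrite eq_le; apply/andP; split;
  by apply: (@nnintegral_le_off_null N) => // x; rewrite ?funeposE ?funenegE// => /fgD ->.
Qed.

End integral_off_null.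

Lemma loc_abs_continuous_continuous {R : realType} (f : R -> R) :
  loc_abs_continuous f -> forall x, 0 <= x ->
  forall e, 0 < e -> exists2 r, 0 < r & forall y, 0 <= y -> `|y - x| < r -> `|f y - f x| < e.
Proof.
move=> acf x x0 e e0.
have [r r0 H] := acf 0 (x + 1) (lexx 0) (ler_wpDr ler01 x0) e e0.
exists (Num.min r 1); first by rewrite lt_min r0 ltr01.
move=> y y0; rewrite lt_min => /andP[yr y1].
have tri (p q : R) : trivIset [set: 'I_1] (fun=> `]p, q[%classic).
  by apply/trivIsetP => i j _ _; rewrite (ord1 i) (ord1 j) eqxx.
have [xy|yx] := leP x y.
  have := H 1%N (fun=> x) (fun=> y); rewrite !big_ord1; apply => //.
    by move=> _; split => //; move: y1; rewrite ger0_norm; lra.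
  by move: yr; rewrite ger0_norm; lra.
rewrite distrC.
have := H 1%N (fun=> y) (fun=> x); rewrite !big_ord1; apply => //.
  by move=> _; split => //; lra.
by move: yr; rewrite distrC ger0_norm; lra.
Qed.

(* An everywhere defined Borel function which equals [f'] wherever [f'] exists. *)
Definition limsup_slope {R : realType} (f : R -> R) (x : R) : R :=
  fine (limn_esup (fun n => (n.+1%:R * (f (x + n.+1%:R^-1) - f x))%:E)).

Lemma limsup_slopeE {R : realType} (f : R -> R) (x l : R) :
  is_derive x 1 f l -> limsup_slope f x = l.
Proof.
move=> fl.
have h : (n.+1%:R * (f (x + n.+1%:R^-1) - f x)) @[n --> \oo] --> l.
  have dl : h^-1 *: (f (h + x) - f x) @[h --> 0^'] --> l.
    have [dfx <-] := fl.
    by move: dfx; rewrite /derivable /derive => /cvgP; under eq_fun do rewrite scaler1.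
  have hn : n.+1%:R^-1 @[n --> \oo] --> (0 : R)^'.
    move=> A [e e0 eA].
    have := @cvg_harmonic R; move=> /cvgrPdist_lt /(_ e e0); apply: filterS => n /= hn.
    by apply: eA => //; rewrite invr_eq0 pnatr_eq0.
  have := cvg_comp _ _ hn dl; apply: cvg_trans; apply: near_eq_cvg.
  by apply: nearW => n /=; rewrite /= invrK (addrC x).
rewrite /limsup_slope.
by have [_ ->] := cvg_limn_einf_sup (cvg_comp _ _ h (@cvg_id _ (nbhs l%:E))).
Qed.

Lemma limsup_slope_measurable {R : realType} (f : R -> R) :
  continuous f -> measurable_fun setT (limsup_slope f).
Proof.
move=> cf.
rewrite (_ : limsup_slope f = fine \o
    (fun x => limn_esup (fun n => (n.+1%:R * (f (x + n.+1%:R^-1) - f x))%:E)))//.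
apply: measurableT_comp; first exact: fine_measurable.
apply: measurable_fun_limn_esup => n; apply/measurable_EFinP.
apply: measurable_funM => //; apply: measurable_funB.
  apply: measurableT_comp; first exact: continuous_measurable_fun.
  exact: measurable_funD.
exact: continuous_measurable_fun.
Qed.

Lemma max0_continuous_eps {R : realType} (f : R -> R) :
  (forall x : R, 0 <= x -> forall e, 0 < e -> exists2 r, 0 < r &
    forall y, 0 <= y -> `|y - x| < r -> `|f y - f x| < e) ->
  continuous (fun x : R => f (Num.max 0 x)).
Proof.
move=> fE x; apply/cvgrPdist_lt => e e0.
have h0 : 0 <= Num.max 0 x by rewrite le_max lexx.
have [r r0 H] := fE (Num.max 0 x) h0 e e0.
near=> y; rewrite distrC; apply: H; first by rewrite le_max lexx.
have : `|y - x| < r by rewrite distrC; near: y; exact: (@nbhsx_ballx _ R^o x r r0).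
apply: le_lt_trans.
rewrite /Num.max; do 2 case: ifPn; rewrite -?leNgt => h1 h2.
- by [].
- by rewrite subr0 !ger0_norm; lra.
- by rewrite sub0r normrN distrC !ger0_norm; lra.
- by rewrite subrr normr0.
Unshelve. all: by end_near. Qed.

Lemma loc_abs_continuous_max0 {R : realType} (f : R -> R) :
  loc_abs_continuous f -> continuous (fun x : R => f (Num.max 0 x)).
Proof. by move=> acf; apply: max0_continuous_eps; exact: loc_abs_continuous_continuous. Qed.

(** The densities on the intervals [[0, n]] are chosen separately and need not agree. Off a single
    null set each of them equals the limsup slope, which therefore serves on all intervals. *)
Lemma loc_abs_continuous_FTC {R : realType} (f : R -> R) :
  loc_abs_continuous f ->
  exists g : R -> R, [/\ measurable_fun setT g,
    exists N : set R, [/\ measurable N, @lebesgue_measure R N = 0%E &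
      forall x : R, 0 < x -> ~ N x -> is_derive x 1 f (g x)] &
    forall x y : R, 0 <= x -> x <= y -> (@lebesgue_measure R).-integrable `[x, y] (EFin \o g) /\
      (\int[lebesgue_measure]_(t in `[x, y]) (g t)%:E = (f y - f x)%:E)%E].
Proof.
move=> acf.
pose F (x : R) := f (Num.max 0 x).
pose g := limsup_slope F.
have mg : measurable_fun setT g.
  by apply: limsup_slope_measurable; exact: loc_abs_continuous_max0.
have Fg (x l : R) : 0 < x -> is_derive x 1 f l -> g x = l.
  move=> x0 fl; apply: limsup_slopeE; apply: near_eq_is_derive fl.
  near=> y; rewrite /F max_r//; apply: ltW; near: y; exact: lt_nbhsr.
have /choice[gn gnP] : forall n : nat, exists g : R -> R, [/\ (@lebesgue_measure R).-integrable setT (EFin \o g),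
    (forall x y : R, 0 <= x -> x <= y -> y <= n%:R ->
      (\int[lebesgue_measure]_(t in `[x, y]) (g t)%:E = (f y - f x)%:E)%E) &
    {ae lebesgue_measure, forall x : R, 0 < x < n%:R -> is_derive x 1 f (g x)}].
  by move=> n; apply: abs_continuous_on_FTC => //; exact: acf.
have aeN : {ae (@lebesgue_measure R), forall (x : R) (n : nat), 0 < x < n%:R -> is_derive x 1 f (gn n x)}.
  by apply: ae_foralln => n; have [_ _ ?] := gnP n.
have [N [mN N0 NP]] := aeN.
have dfg (x : R) (n : nat) : 0 < x < n%:R -> ~ N x -> is_derive x 1 f (gn n x) /\ g x = gn n x.
  move=> xn Nx.
  have d : is_derive x 1 f (gn n x).
    by apply: contrapT => h; apply: Nx; apply: NP => /= H; apply: h; exact: H.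
  by split => //; apply: Fg d; case/andP : xn.
exists g; split => //.
  exists N; split => // x x0 Nx.
  have xn : 0 < x < (Num.truncn x).+1%:R by rewrite x0 truncnS_gt.
  by have [d ->] := dfg _ _ xn Nx.
move=> x y x0 xy; pose n := (Num.truncn y).+1.
have yn : y < n%:R by exact: truncnS_gt.
have [gi gE _] := gnP n.
have aeE : ae_eq (@lebesgue_measure R) `[x, y]%classic (EFin \o gn n) (EFin \o g).
  exists (N `|` [set 0]); split.
  - by apply: measurableU => //; exact: measurable_set1.
  - by rewrite measureU0 ?N0//; exact: lebesgue_measure_set1.
  move=> z /= /not_implyP[]; rewrite in_itv/= => /andP[xz zy] gz.
  have [->|z0] := eqVneq z 0; [by right|left].
  apply: contrapT => Nz; apply: gz; congr EFin.
  have [|_ ->//] := dfg z n _ Nz.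
  by rewrite lt_neqAle eq_sym z0 (le_trans x0 xz)/= (le_lt_trans zy yn).
have gix : (@lebesgue_measure R).-integrable `[x, y] (EFin \o gn n) by exact: integrableS gi.
have mgx : measurable_fun (`[x, y] : set R) (EFin \o g).
  by apply/measurable_EFinP; exact: measurable_funTS.
split.
  exact: (@ae_eq_integrable _ _ R (@lebesgue_measure R) _ (EFin \o gn n) _ (measurable_itv _)
    mgx aeE gix).
rewrite -(gE x y)// ?(ltW yn)//; apply: ae_eq_integral => //.
  exact: measurable_int gix.
exact: ae_eq_sym.
Unshelve. all: by end_near. Qed.

(** * Dyadic increments of Brownian motion *)

(** With [y = x^2 / s^2], split the exponent [-y/2] into [-y/8], which belongs to the standard
    deviation [2 * s], and [-3y/8]. As [y/8 <= expR (y/8)], the product of [y^3] and [expR (-3y/8)]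
    is at most [8^3]. The factor [2] is the ratio of the peaks. *)
Lemma pow6_normal_pdf_le {R : realType} (s x : R) : 0 < s ->
  x ^+ 6 * normal_pdf 0 s x <= 2 * 8 ^+ 3 * s ^+ 6 * normal_pdf 0 (2 * s) x.
Proof.
move=> s0.
have s20 : 2 * s != 0 by rewrite mulf_neq0// gt_eqF.
rewrite !normal_pdfE ?(gt_eqF s0)//.
have peakE : normal_peak s = 2 * normal_peak (2 * s).
  rewrite /normal_peak (_ : (2 * s) ^+ 2 * pi *+ 2 = 2 ^+ 2 * (s ^+ 2 * pi *+ 2)); last first.
    by ring.
  by rewrite sqrtrM ?exprn_ge0// sqrtr_sqr ger0_norm// invfM mulrA divff// mul1r.
have funE : x ^+ 6 * normal_fun 0 s x <= 8 ^+ 3 * s ^+ 6 * normal_fun 0 (2 * s) x.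
  rewrite /normal_fun subr0.
  pose y := x ^+ 2 / s ^+ 2.
  have y0 : 0 <= y by rewrite divr_ge0// ?sqr_ge0// exprn_ge0// ltW.
  have -> : - x ^+ 2 / (s ^+ 2 *+ 2) = - y / 8 - 3 * (y / 8).
    by rewrite /y; field; rewrite gt_eqF.
  have -> : - x ^+ 2 / ((2 * s) ^+ 2 *+ 2) = - y / 8.
    by rewrite /y; field; rewrite gt_eqF.
  have -> : x ^+ 6 = s ^+ 6 * y ^+ 3 by rewrite /y; field; rewrite gt_eqF.
  rewrite expRD; set E1 := expR (- y / 8); set E2 := expR _.
  have E10 : 0 < E1 by exact: expR_gt0.
  rewrite (_ : _ * (E1 * E2) = s ^+ 6 * E1 * (y ^+ 3 * E2)); last by ring.
  rewrite [leRHS](_ : _ = s ^+ 6 * E1 * 8 ^+ 3); last by ring.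
  rewrite ler_pM2l ?mulr_gt0 ?exprn_gt0// /E2.
  rewrite expRN ler_pdivrMr ?expR_gt0// expRM_natl.
  have h : 1 + y / 8 <= expR (y / 8) by exact: expR_ge1Dx.
  have : (y / 8) ^+ 3 <= expR (y / 8) ^+ 3.
    rewrite ler_pXn2r ?nnegrE ?expR_ge0//; first lra.
    by rewrite divr_ge0.
  rewrite exprMn exprVn ler_pdivrMr ?exprn_gt0// => H.
  by rewrite mulrC.
rewrite peakE; set p := normal_peak (2 * s).
rewrite [leLHS](_ : _ = 2 * p * (x ^+ 6 * normal_fun 0 s x)); last by ring.
rewrite [leRHS](_ : _ = 2 * p * (8 ^+ 3 * s ^+ 6 * normal_fun 0 (2 * s) x)); last by ring.
by rewrite ler_pM2l// mulr_gt0// normal_peak_gt0.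
Qed.

(** Markov's inequality for the sixth power, the moment being bounded through the total mass of a
    Gaussian of standard deviation [2 * s]. *)
Lemma normal_prob_pow6_tail {R : realType} : exists2 C : R, 0 < C & forall s t : R, 0 < s -> 0 < t ->
  (normal_prob 0 s [set x : R | (t < x ^+ 6)%R] <= (C * s ^+ 6 / t)%:E)%E.
Proof.
exists (2 * 8 ^+ 3); first by rewrite mulr_gt0// exprn_gt0.
have := mulr_gt0 (ltr0n R 2) (exprn_gt0 3 (ltr0n R 8)).
have := @pow6_normal_pdf_le R.
move: (2 * 8 ^+ 3) => C HC C0 s t s0 t0; rewrite /normal_prob.
set A := [set x | _].
have mA : measurable A.
  rewrite -[A]setTI; apply: measurable_fun_ltr => //.
pose h (x : R) : \bar R := ( (C * s ^+ 6 / t)%:E * (normal_pdf 0 (2 * s) x)%:E)%E.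
apply: (@le_trans _ _ (\int[lebesgue_measure]_(x in A) (h x)))%E.
  apply: ge0_le_integral => //=.
  - by move=> x _; rewrite lee_fin normal_pdf_ge0.
  - by apply/measurable_EFinP/measurable_funTS; exact: measurable_normal_pdf.
  - apply/measurable_EFinP/measurable_funTS/measurable_funM => //; exact: measurable_normal_pdf.
  move=> x /= Ax; rewrite /h -EFinM lee_fin mulrAC ler_pdivlMr//.
  apply: le_trans (HC s x s0).
  by rewrite mulrC ler_wpM2r ?normal_pdf_ge0// ltW.
apply: (@le_trans _ _ (\int[lebesgue_measure]_x (h x)))%E.
  apply: ge0_subset_integral => //=.
  - apply/measurable_EFinP/measurable_funM => //; exact: measurable_normal_pdf.
  - by move=> x _; rewrite lee_fin mulr_ge0 ?normal_pdf_ge0// divr_ge0 ?mulr_ge0 ?exprn_ge0 ?ltW.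
rewrite /h ge0_integralZl//=.
- by rewrite integral_normal_pdf mule1.
- by apply/measurable_EFinP; exact: measurable_normal_pdf.
- by move=> x _; rewrite lee_fin normal_pdf_ge0.
- by rewrite lee_fin divr_ge0 ?mulr_ge0 ?exprn_ge0 ?ltW.
Qed.

Definition dyadic {R : realType} (n k j : nat) : R := n%:R + j%:R / 2 ^+ k.

(* The factor [n.+1 * n.+2] makes the expected sixth powers summable over the unit intervals. *)
Definition dyadic_bound {R : realType} (S : R) (w : R -> R) : Prop :=
  forall n k j : nat, (j < 2 ^ k)%N ->
    (w (dyadic n k j.+1) - w (dyadic n k j)) ^+ 6 <=
    S * (n.+1%:R * n.+2%:R) / 2 ^+ k.

Lemma nneseries_le {R : realType} (u : nat -> \bar R) (l : \bar R) :
  (forall n, (0 <= u n)%E) -> (forall N, \sum_(i < N) u i <= l)%E ->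
  (\sum_(i <oo) u i <= l)%E.
Proof.
move=> u0 ul; apply: lime_le; first exact: is_cvg_nneseries.
by apply: nearW => N; rewrite big_mkord.
Qed.

Lemma sum_inv_succ_le {R : realType} (N : nat) :
  \sum_(n < N) (n.+1%:R * n.+2%:R : R)^-1 <= 1.
Proof.
suff -> : \sum_(n < N) (n.+1%:R * n.+2%:R : R)^-1 = 1 - N.+1%:R^-1.
  by rewrite gerBl invr_ge0.
elim: N => [|N IH]; first by rewrite big_ord0 invr1 subrr.
rewrite big_ord_recr/= IH.
have h1 : N.+1%:R != 0 :> R by rewrite pnatr_eq0.
have h2 : N.+2%:R != 0 :> R by rewrite pnatr_eq0.
have h3 : N.+2%:R = N.+1%:R + 1 :> R by rewrite -natr1.
by move: h1 h2; rewrite h3; move: (N.+1%:R : R) => p h1 h2; field; rewrite h1 h2.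
Qed.

Lemma sum_geometric_half_le {R : realType} (N : nat) :
  \sum_(k < N) (2 ^+ k : R)^-1 <= 2.
Proof.
suff -> : \sum_(k < N) (2 ^+ k : R)^-1 = 2 - 2 / 2 ^+ N.
  by rewrite gerBl divr_ge0// exprn_ge0.
elim: N => [|N IH]; first by rewrite big_ord0 expr0 divr1 subrr.
have h1 : 2 ^+ N != 0 :> R by rewrite expf_neq0.
by rewrite big_ord_recr/= IH exprS; field.
Qed.

Section brownian_dyadic.
Context {R : realType} {d : measure_display} {T : measurableType d}
  {P : probability T R} (b : R -> {RV P >-> R}) (hb : brownian_motion b)
  (C : R) (C0 : 0 < C)
  (HC : forall s t : R, 0 < s -> 0 < t ->
    (normal_prob 0 s [set x : R | (t < x ^+ 6)%R] <= (C * s ^+ 6 / t)%:E)%E).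

Let Bad (M : nat) (n k j : nat) : set T :=
  [set w | M.+1%:R * (n.+1%:R * n.+2%:R) / 2 ^+ k <
           (b (dyadic n k j.+1) w - b (dyadic n k j) w) ^+ 6].

Let mBad M n k j : measurable (Bad M n k j).
Proof.
rewrite -[Bad _ _ _ _]setTI; apply: measurable_fun_ltr => //.
by apply: measurable_funX; apply: measurable_funB.
Qed.

(** The increment has standard deviation [2^(-k/2)]. Its sixth power [2^(-3k)], divided by the
    threshold of order [2^(-k)], leaves [2^(-2k)]: one factor [2^(-k)] pays for the [2^k] values of
    [j], the other makes the sum over [k] converge. *)
Let PBad M n k j :
  (P (Bad M n k j) <= (C / M.+1%:R / (n.+1%:R * n.+2%:R) / 2 ^+ k / 2 ^+ k)%:E)%E.
Proof.
have [_ _ _ H] := hb.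
have k0 : 0 < 2 ^+ k :> R by rewrite exprn_gt0.
pose s : R := dyadic n k j; pose t : R := dyadic n k j.+1.
have ts : t - s = (2 ^+ k)^-1.
  by rewrite /t /s /dyadic -natr1; field; rewrite gt_eqF.
have s0 : 0 <= s by rewrite addr_ge0// divr_ge0// ltW.
have st : s < t by rewrite -subr_gt0 ts invr_gt0.
pose u : R := M.+1%:R * (n.+1%:R * n.+2%:R) / 2 ^+ k.
have u0 : 0 < u by rewrite !mulr_gt0// invr_gt0.
have mA : measurable [set x : R | u < x ^+ 6].
  by rewrite -[X in measurable X]setTI; apply: measurable_fun_ltr.
have := H s t s0 st _ mA; rewrite /pushforward => E.
rewrite (_ : Bad M n k j = (b t \- b s) @^-1` [set x : R | u < x ^+ 6])// E.
have sq : 0 < Num.sqrt (t - s) by rewrite sqrtr_gt0 subr_gt0.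
apply: le_trans (HC _ _ sq u0) _.
rewrite lee_fin (_ : 6%N = (2 * 3)%N)// exprM sqr_sqrtr ?ts; last by rewrite invr_ge0 ltW.
rewrite le_eqVlt; apply/orP; left; apply/eqP; rewrite /u.
have h1 : M.+1%:R != 0 :> R by rewrite pnatr_eq0.
have h2 : n.+1%:R != 0 :> R by rewrite pnatr_eq0.
have h3 : n.+2%:R != 0 :> R by rewrite pnatr_eq0.
move: h1 h2 h3 (lt0r_neq0 k0); rewrite /=.
move: (M.+1%:R : R) (n.+1%:R : R) (n.+2%:R : R) (2 ^+ k : R) => x1 x2 x3 x4 h1 h2 h3 h4.
by field; rewrite h1 h2 h3 h4.
Qed.

Let BadU (M : nat) : set T :=
  \bigcup_n \bigcup_k \big[setU/set0]_(j < 2 ^ k) Bad M n k j.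

Let mBadk M n k : measurable (\big[setU/set0]_(j < 2 ^ k) Bad M n k j).
Proof. exact: bigsetU_measurable. Qed.

Let mBadn M n : measurable (\bigcup_k \big[setU/set0]_(j < 2 ^ k) Bad M n k j).
Proof. exact: bigcupT_measurable. Qed.

Let PBadU M : (P (BadU M) <= (2 * C / M.+1%:R)%:E)%E.
Proof.
have hk n k : (P (\big[setU/set0]_(j < 2 ^ k) Bad M n k j) <=
    (C / M.+1%:R / (n.+1%:R * n.+2%:R) / 2 ^+ k)%:E)%E.
  apply: le_trans (Boole_inequality _ _) _; first by [].
  apply: (@le_trans _ _ (\sum_(j < 2 ^ k) (C / M.+1%:R / (n.+1%:R * n.+2%:R) / 2 ^+ k / 2 ^+ k)%:E)%E).
    by apply: lee_sum => j _; exact: PBad.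
  rewrite sumEFin sumr_const card_ord lee_fin -[_ *+ (2 ^ k)]mulr_natr natrX.
  by rewrite divfK// expf_neq0.
have hn n : (P (\bigcup_k \big[setU/set0]_(j < 2 ^ k) Bad M n k j) <=
    (2 * C / M.+1%:R / (n.+1%:R * n.+2%:R))%:E)%E.
  apply: le_trans (generalized_Boole_inequality _ _ _) _ => //.
  apply: nneseries_le => // N.
  apply: (@le_trans _ _ (\sum_(k < N) (C / M.+1%:R / (n.+1%:R * n.+2%:R) / 2 ^+ k)%:E)%E).
    by apply: lee_sum => k _; exact: hk.
  rewrite sumEFin lee_fin -mulr_sumr.
  apply: le_trans (ler_wpM2l _ (sum_geometric_half_le N)) _; first by rewrite !mulr_ge0 ?invr_ge0 ?mulr_ge0 // ltW.
  by rewrite le_eqVlt; apply/orP; left; apply/eqP; ring.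
apply: le_trans (generalized_Boole_inequality _ _ _) _ => //.
  exact: bigcupT_measurable.
apply: nneseries_le => // N.
apply: (@le_trans _ _ (\sum_(n < N) (2 * C / M.+1%:R / (n.+1%:R * n.+2%:R))%:E)%E).
  by apply: lee_sum => n _; exact: hn.
rewrite sumEFin lee_fin -mulr_sumr.
apply: le_trans (ler_wpM2l _ (sum_inv_succ_le N)) _; first by rewrite !mulr_ge0 ?invr_ge0 ?mulr_ge0 // ltW.
by rewrite mulr1.
Qed.

(** A path that admits no [S] lies in [BadU M] for every [M], and the probability of [BadU M] tends
    to zero. *)
Lemma brownian_dyadic_bound_aux :
  {ae P, forall w, exists2 S : R, 0 < S & dyadic_bound S (fun t => b t w)}.
Proof.
have mU M : measurable (BadU M) by exact: bigcupT_measurable.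
exists (\bigcap_M BadU M); split.
- exact: bigcapT_measurable.
- apply/eqP; rewrite eq_le measure_ge0 andbT.
  apply/lee_addgt0Pr => e e0; rewrite add0e.
  pose M := Num.truncn (2 * C / e).
  apply: (@le_trans _ _ (P (BadU M))).
    by apply: le_measure; rewrite ?inE//; [exact: bigcapT_measurable|exact: bigcap_inf].
  apply: le_trans (PBadU M) _.
  rewrite lee_fin ler_pdivrMr// [leRHS]mulrC -ler_pdivrMr//.
  by apply/ltW; rewrite truncnS_gt.
move=> w /= nS M _; apply: contrapT => nB; apply: nS.
exists M.+1%:R => // n k j jk; rewrite leNgt; apply/negP => lt.
apply: nB; exists n => //; exists k => //.
by rewrite -bigcup_mkord; exists j.
Qed.

End brownian_dyadic.

Lemma brownian_dyadic_bound {R : realType} {d : measure_display} {T : measurableType d}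
  {P : probability T R} (b : R -> {RV P >-> R}) : brownian_motion b ->
  {ae P, forall w, exists2 S : R, 0 < S & dyadic_bound S (fun t => b t w)}.
Proof.
move=> hb; have [C C0 HC] := @normal_prob_pow6_tail R.
exact: brownian_dyadic_bound_aux hb C C0 HC.
Qed.

(** * Oscillation of the path by dyadic chaining *)

Lemma within_itvcy_eps {R : realType} (w : R -> R) :
  {within `[0, +oo[, continuous w} -> forall x : R, 0 <= x ->
  forall e : R, 0 < e -> exists2 r : R, 0 < r &
    forall y : R, 0 <= y -> `|y - x| < r -> `|w y - w x| < e.
Proof.
move=> /continuous_within_itvcyP[cw cw0] x x0 e e0.
have [->|xn0] := eqVneq x 0.
  move/cvgrPdist_lt : cw0 => /(_ e e0)[r /= r0 H]; exists r => // y y0.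
  move: y0; rewrite le_eqVlt => /predU1P[<- _|y0 yr]; first by rewrite subrr normr0.
  by rewrite distrC; apply: H => //; rewrite /= distrC.
have xp : 0 < x by rewrite lt_neqAle eq_sym xn0.
have := cw x; rewrite in_itv/= xp => /(_ erefl) /cvgrPdist_lt /(_ e e0)[r /= r0 H].
exists r => // y _ yr; rewrite distrC; apply: H.
by rewrite /= distrC.
Qed.

Lemma dyadic_even {R : realType} (n k i : nat) :
  dyadic n k.+1 (i * 2) = dyadic n k i :> R.
Proof.
rewrite /dyadic natrM exprS.
have h : 2 ^+ k != 0 :> R by rewrite expf_neq0.
by field.
Qed.

(** Chaining: a point of level [k + 1] is a point of level [k] or one step to the right of one. So
    each level costs a single increment, and the right-hand side is the partial sum of the geometric
    series of ratio [9 / 10]. *)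
Lemma dyadic_chain {R : realType} (w : R -> R) (n : nat) (a : R) :
  (forall k j : nat, (j < 2 ^ k)%N ->
    `|w (dyadic n k j.+1) - w (dyadic n k j)| <= a * (9 / 10) ^+ k) ->
  forall k j : nat, (j <= 2 ^ k)%N ->
    `|w (dyadic n k j) - w n%:R| <= 10 * a * (1 - (9 / 10) ^+ k.+1).
Proof.
move=> H.
have d0 k : dyadic n k 0 = n%:R :> R by rewrite /dyadic mul0r addr0.
have a0 : 0 <= a.
  by have := H 0%N 0%N isT; rewrite expr0 mulr1; apply: le_trans.
elim=> [|k IH] j jk.
  case: j jk => [_|[_|//]].
    by rewrite d0 subrr normr0 expr1; lra.
  by have := H 0%N 0%N isT; rewrite d0 expr0 expr1; lra.
have q0 : 0 <= (9 / 10 : R) ^+ k.+1 by apply: exprn_ge0; lra.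
have aq : 0 <= a * (9 / 10 : R) ^+ k.+1 by exact: mulr_ge0.
rewrite (exprS _ k.+1).
have qS : 1 - 9 / 10 * (9 / 10 : R) ^+ k.+1 = 1 - (9 / 10 : R) ^+ k.+1 + (9 / 10 : R) ^+ k.+1 / 10 by field.
have mono : 10 * a * (1 - (9 / 10) ^+ k.+1) + a * (9 / 10) ^+ k.+1 =
    10 * a * (1 - 9 / 10 * (9 / 10) ^+ k.+1).
  by rewrite qS; field.
have ev i : (i <= 2 ^ k)%N ->
    `|w (dyadic n k.+1 (i * 2)) - w n%:R| <= 10 * a * (1 - (9 / 10) ^+ k.+1).
  by move=> ik; rewrite dyadic_even; exact: IH.
rewrite -mono.
have jE := odd_double_half j.
have jk2 : (j./2 <= 2 ^ k)%N.
  by rewrite -(@leq_pmul2r 2)// -expnSr (leq_trans _ jk)// muln2 -[leqRHS]jE leq_addl.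
case: (boolP (odd j)) => oj; last first.
  move: jE; rewrite (negbTE oj) add0n -muln2 => <-.
  by apply: le_trans (ev _ jk2) _; rewrite lerDl.
move: jE; rewrite oj add1n -muln2 => jE.
rewrite -jE.
apply: le_trans (ler_distD (w (dyadic n k.+1 (j./2 * 2))) _ _) _.
rewrite addrC lerD ?ev//.
by apply: H; rewrite jE.
Qed.

(** With continuity, this is all that the deterministic part of the proof uses of a path: squared
    increments over windows of length at most [1] are little-o of [x]. *)
Definition subdiffusive {R : realType} (w : R -> R) : Prop :=
  forall e : R, 0 < e -> exists2 C : R, 0 <= C & forall x y : R, 0 <= x -> 0 <= y -> y <= 1 ->
    (w (x + y) - w x) ^+ 2 <= e * (1 + x) + C.

Lemma dyadic_bound_unit {R : realType} (S : R) (w : R -> R) (n : nat) : 0 < S ->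
  {within `[0, +oo[, continuous w} -> dyadic_bound S w ->
  exists a : R, [/\ 0 <= a, a ^+ 6 = S * (n.+1%:R * n.+2%:R) &
    forall t : R, n%:R <= t -> t <= n.+1%:R -> `|w t - w n%:R| <= 10 * a].
Proof.
move=> S0 cw Hw.
pose p : R := S * (n.+1%:R * n.+2%:R).
have p0 : 0 < p by rewrite !mulr_gt0.
pose a := p `^ 6^-1.
have a0 : 0 < a by exact: powR_gt0.
have a6 : a ^+ 6 = p.
  by rewrite -powR_mulrn ?(ltW a0)// -powRrM mulVf// powRr1// ltW.
exists a; split => //; first exact: ltW.
(* The ratio [9 / 10] is admissible because its sixth power exceeds [1 / 2]. *)
have H k j : (j < 2 ^ k)%N ->
    `|w (dyadic n k j.+1) - w (dyadic n k j)| <= a * (9 / 10) ^+ k.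
  move=> jk.
  have q0 : 0 <= (9 / 10 : R) ^+ k by apply: exprn_ge0; lra.
  rewrite -(@ler_pXn2r _ 6)// ?nnegrE ?normr_ge0 ?mulr_ge0 ?(ltW a0)//.
  rewrite -normrX ger0_norm ?exprn_even_ge0//.
  apply: le_trans (Hw n k j jk) _.
  rewrite exprMn a6 ler_pM2l// -exprM mulnC exprM -exprVn.
  by apply: lerXn2r; rewrite ?nnegrE ?exprn_ge0 ?invr_ge0//; lra.
move=> t nt tn1; apply/ler_addgt0Pr => e e0.
have t0 : 0 <= t by apply: le_trans nt.
have [r r0 Hr] := within_itvcy_eps w cw t t0 e e0.
have [k kr] : exists k : nat, (2 ^+ k)^-1 < r.
  exists (Num.truncn r^-1).+1.
  rewrite -ltf_pV2 ?posrE ?invr_gt0 ?exprn_gt0// invrK.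
  apply: lt_trans (truncnS_gt _) _.
  by rewrite -natrX ltr_nat ltn_expl.
have k0 : 0 < 2 ^+ k :> R by exact: exprn_gt0.
pose j := Num.truncn ((t - n%:R) * 2 ^+ k).
have tn0 : 0 <= (t - n%:R) * 2 ^+ k by rewrite mulr_ge0 ?subr_ge0// ltW.
have /andP[j1 j2] := truncn_itv tn0; rewrite -/j in j1 j2.
have tn1' : t - n%:R <= 1 by rewrite lerBlDl natr1.
have jk : (j <= 2 ^ k)%N.
  rewrite -(ler_nat R) natrX; apply: le_trans j1 _.
  by rewrite -[leRHS]mul1r ler_pM2r.
have dt : dyadic n k j <= t.
  by rewrite /dyadic -lerBrDl ler_pdivrMr.
have td : t - dyadic n k j < r.
  apply: le_lt_trans kr; rewrite /dyadic opprD addrA lerBlDl.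
  rewrite [leRHS](_ : _ = j.+1%:R / 2 ^+ k); last by rewrite -[j.+1%:R]natr1 mulrDl mul1r.
  by rewrite ler_pdivlMr// ltW.
have d0 : 0 <= dyadic n k j :> R by rewrite /dyadic addr_ge0// divr_ge0// ltW.
have h1 : `|w (dyadic n k j) - w t| < e.
  by apply: Hr => //; rewrite distrC ger0_norm// subr_ge0.
have h2 := dyadic_chain w n a H k j jk.
have q0 : 0 <= (9 / 10 : R) ^+ k.+1 by apply: exprn_ge0; lra.
apply: le_trans (ler_distD (w (dyadic n k j)) _ _) _.
rewrite addrC lerD//; last by rewrite distrC ltW.
by apply: le_trans h2 _; rewrite ler_piMr// ?mulr_ge0// ?(ltW a0)//; lra.
Qed.

(** Otherwise [t >= e * x] and [t > K / e ^ 2], and multiplying the square of the first with the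
    second would give [t ^ 3 > K * x ^ 2]. *)
Lemma cube_bound {R : realType} (t x e K : R) : 0 <= t -> 0 <= x -> 0 < e -> 0 <= K ->
  t ^+ 3 <= K * x ^+ 2 -> t <= e * x + K / e ^+ 2.
Proof.
move=> t0 x0 e0 K0 tK; rewrite leNgt; apply/negP => lt_t.
have e20 : 0 < e ^+ 2 by exact: exprn_gt0.
have K' : 0 <= K / e ^+ 2 by rewrite divr_ge0// ltW.
have ex0 : 0 <= e * x by rewrite mulr_ge0// ltW.
have h1 : K / e ^+ 2 < t by lra.
have h2 : e * x <= t by lra.
have h3 : (e * x) ^+ 2 <= t ^+ 2 by rewrite lerXn2r ?nnegrE.
have tp : 0 < t by lra.
have h4 : K * x ^+ 2 = (e * x) ^+ 2 * (K / e ^+ 2) by field; rewrite gt_eqF.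
have h5 : t ^+ 3 = t ^+ 2 * t by rewrite exprSr.
have : t ^+ 3 <= t ^+ 2 * (K / e ^+ 2).
  by apply: le_trans tK _; rewrite h4 ler_wpM2r.
by rewrite h5 ler_pM2l ?exprn_gt0// leNgt h1.
Qed.

Lemma dyadic_bound_subdiffusive {R : realType} (S : R) (w : R -> R) : 0 < S ->
  {within `[0, +oo[, continuous w} -> dyadic_bound S w -> subdiffusive w.
Proof.
move=> S0 cw Hw e e0.
(* From [x] to [x + y] there are at most three chained pieces, through [n] and [n + 1], each of size
   at most [10 * A]; and [(n + 2) * (n + 3) <= 6 * (1 + x) ^ 2]. *)
pose K : R := 30 ^+ 6 * (S * 6).
have K0 : 0 <= K by rewrite mulr_ge0 ?exprn_ge0// mulr_ge0// ltW.
exists (K / e ^+ 2) => [|x y x0 y0 y1]; first by rewrite divr_ge0// exprn_ge0// ltW.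
apply: cube_bound => //; first exact: sqr_ge0; first lra.
pose n := Num.truncn x.
have /andP[n1 n2] := truncn_itv x0; rewrite -/n in n1 n2.
have [a [a0 a6 Ha]] := dyadic_bound_unit S w n S0 cw Hw.
have [A [A0 A6 HA]] := dyadic_bound_unit S w n.+1 S0 cw Hw.
have aA : a <= A.
  rewrite -(@ler_pXn2r _ 6)// a6 A6 ler_pM2l// ler_pM// ler_nat//.
have hx : `|w x - w n%:R| <= 10 * a by apply: Ha => //; exact: ltW.
have hxy : `|w (x + y) - w n%:R| <= 20 * A.
  have [xy|xy] := leP (x + y) n.+1%:R.
    by apply: le_trans (Ha _ _ xy) _; lra.
  have h1 : `|w (x + y) - w n.+1%:R| <= 10 * A.
    apply: HA; first exact: ltW.
    by rewrite -natr1; lra.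
  have h2 : `|w n.+1%:R - w n%:R| <= 10 * a by apply: Ha => //; rewrite ler_nat.
  apply: le_trans (ler_distD (w n.+1%:R) _ _) _; lra.
have hD : `|w (x + y) - w x| <= 30 * A.
  apply: le_trans (ler_distD (w n%:R) _ _) _; rewrite (distrC (w n%:R)); lra.
rewrite -exprM (_ : (2 * 3)%N = 6%N)//.
rewrite -[leLHS](@ger0_norm) ?exprn_even_ge0// normrX.
apply: (@le_trans _ _ ((30 * A) ^+ 6)).
  by rewrite lerXn2r ?nnegrE ?normr_ge0// mulr_ge0.
rewrite exprMn A6 /K -(mulrA (30 ^+ 6)) -(mulrA S) ler_pM2l ?exprn_gt0// ler_pM2l//.
have E1 : n.+1%:R = n%:R + 1 :> R by rewrite natr1.
have E2 : n.+2%:R = n%:R + 2 :> R by rewrite -natr1 E1; ring.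
have E3 : n.+3%:R = n%:R + 3 :> R by rewrite -natr1 E2; ring.
rewrite E2 E3; have n0 : 0 <= n%:R :> R by [].
by move: n1 n0; move: (n%:R : R) => z n1 n0; nra.
Qed.

(** * Linear systems of differential equations *)

Section derive_rules.
Context {R : realType}.
Implicit Types (f g : R -> R) (x a b : R).

Lemma derE f x a b : is_derive x 1 f a -> a = b -> is_derive x 1 f b.
Proof. by move=> fa <-. Qed.

Lemma derD f g x a b : is_derive x 1 f a -> is_derive x 1 g b ->
  is_derive x 1 (fun y => f y + g y) (a + b).
Proof. by move=> fa gb; exact: is_deriveD. Qed.

Lemma derB f g x a b : is_derive x 1 f a -> is_derive x 1 g b ->
  is_derive x 1 (fun y => f y - g y) (a - b).
Proof. by move=> fa gb; exact: is_deriveB. Qed.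

Lemma derM f g x a b : is_derive x 1 f a -> is_derive x 1 g b ->
  is_derive x 1 (fun y => f y * g y) (a * g x + f x * b).
Proof.
move=> fa gb; apply: derE (is_deriveM fa gb) _.
by rewrite /GRing.scale/= addrC mulrC.
Qed.

Lemma derC (c x : R) : is_derive x 1 (fun=> c) 0.
Proof. exact: is_derive_cst. Qed.

Lemma derI x : is_derive x 1 (fun y => y) 1.
Proof. exact: is_derive_id. Qed.

Lemma derV f x a : f x != 0 -> is_derive x 1 f a ->
  is_derive x 1 (fun y => (f y)^-1) (- a / f x ^+ 2).
Proof.
move=> fx fa; apply: (derE _ _ (- (f x) ^- 2 *: a)).
by rewrite /GRing.scale/= mulNr mulrC mulNr.
Qed.

Lemma derX2 f x a : is_derive x 1 f a ->
  is_derive x 1 (fun y => f y ^+ 2) (2 * f x * a).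
Proof.
by move=> fa; apply: derE (derM f f x a a fa fa) _; ring.
Qed.

Lemma derexp f x a : is_derive x 1 f a ->
  is_derive x 1 (fun y => expR (f y)) (a * expR (f x)).
Proof.
move=> fa; apply: derE (is_derive1_comp (is_derive_expR (f x)) fa) _; rewrite mulrC.
by [].
Qed.

Lemma der_cont f x a : is_derive x 1 f a -> {for x, continuous f}.
Proof.
by move=> fa; apply/differentiable_continuous; rewrite -derivable1_diffP.
Qed.

End derive_rules.

Lemma derive_within_continuous {R : realType} (F f : R -> R) (a b : R) :
  (forall x, a <= x <= b -> is_derive x 1 F (f x)) -> {within `[a, b], continuous F}.
Proof.
move=> dF; apply: derivable_within_continuous => x; rewrite in_itv/= => /dF ?.
exact: ex_derive.
Qed.

Lemma le_increment {R : realType} (F G f g : R -> R) (a b : R) : a <= b ->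
  (forall x, a <= x <= b -> is_derive x 1 F (f x)) ->
  (forall x, a <= x <= b -> is_derive x 1 G (g x)) ->
  (forall x, a <= x <= b -> f x <= g x) ->
  F b - F a <= G b - G a.
Proof.
move=> ab dF dG fg.
have dH x : a <= x <= b -> is_derive x 1 (fun y => G y - F y) (g x - f x).
  by move=> xab; apply: derB; [exact: dG|exact: dF].
have [x||c cab] := @MVT_segment R (fun y => G y - F y) (fun y => g y - f y) a b ab.
- by rewrite in_itv/= => /andP[h1 h2]; apply: dH; rewrite !ltW.
- exact: derive_within_continuous dH.
rewrite in_itv/= in cab.
have := fg c cab; rewrite -subr_ge0 => h1 h2.
have : 0 <= (g c - f c) * (b - a) by rewrite mulr_ge0// subr_ge0.
by rewrite -h2; lra.
Qed.

Lemma integral_derive {R : realType} (F f : R -> R) (a b : R) : a <= b ->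
  (forall x, a <= x <= b -> is_derive x 1 F (f x)) ->
  {within `[a, b], continuous f} ->
  (\int[lebesgue_measure]_(x in `[a, b]) (f x)%:E = (F b - F a)%:E)%E.
Proof.
rewrite le_eqVlt => /predU1P[<- _ _|ab dF cf].
  by rewrite set_itv1 integral_set1 subrr.
rewrite EFinB; apply: continuous_FTC2 => //.
  have /(continuous_within_itvP _ ab)[h1 h2 h3] := derive_within_continuous F f a b dF.
  split => // x; rewrite in_itv/= => /andP[h4 h5].
  have := dF x; rewrite !ltW// => /(_ isT) ?; exact: ex_derive.
move=> x; rewrite in_itv/= => /andP[h4 h5].
have := dF x; rewrite !ltW// => /(_ isT) ?.
by rewrite derive1E derive_val.
Qed.

Lemma continuous_norm_bounded {R : realType} (k : R -> R) (X : R) : continuous k ->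
  exists2 K : R, 1 <= K & forall x, 0 <= x <= X -> `|k x| <= K.
Proof.
move=> ck.
have [X0|X0] := ltP X 0.
  by exists 1 => // x /andP[h1 h2]; have := le_trans h1 h2; rewrite leNgt X0.
have [|c _ cP] := @EVT_max R (fun x => `|k x|) 0 X X0; last first.
  exists (Num.max 1 `|k c|); first by rewrite le_max lexx.
  by move=> x xX; rewrite le_max cP ?orbT// in_itv.
by apply: continuous_subspaceT => x; apply: continuous_comp; [exact: ck|exact: norm_continuous].
Qed.

Section primitive.
Context {R : realType} (k : R -> R) (ck : continuous k).

(* Starting the integral at [-1] makes [primitive k] differentiable at [0] on both sides. *)
Definition primitive (x : R) : R :=
  \int[lebesgue_measure]_(y in `[-1, x]) k y - \int[lebesgue_measure]_(y in `[-1, 0]) k y.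

Lemma primitive0 : primitive 0 = 0.
Proof. by rewrite /primitive subrr. Qed.

Lemma derive_primitive (x : R) : 0 <= x -> is_derive x 1 primitive (k x).
Proof.
move=> x0; rewrite /primitive -[k x]subr0.
have xx : x < x + 1 by lra.
have ik : (@lebesgue_measure R).-integrable `[-1, x + 1] (EFin \o k).
  apply: continuous_compact_integrable; first exact: segment_compact.
  exact: continuous_subspaceT.
have x1 : -1 < x by lra.
have [d1 d2] := continuous_FTC1_closed xx ik x1 (ck x).
apply: (derB _ (fun=> \int[lebesgue_measure]_(y in `[-1, 0]) k y)).
by split; [exact: d1|rewrite -derive1E; exact: d2].
Qed.

End primitive.

Lemma max0_continuous {R : realType} (f : R -> R) :
  (forall x, 0 <= x -> {for x, continuous f}) ->
  continuous (fun x : R => f (Num.max 0 x)).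
Proof.
move=> cf x; apply: (@continuous_comp _ _ _ (fun y : R => Num.max 0 y) f x); last first.
  by apply: cf; rewrite le_max lexx.
by apply: continuous_max; [exact: cvg_cst|exact: cvg_id].
Qed.

(** The intervals of centre [u n] and radius [2 * C / 2 ^ n] are nested, and the supremum of their
    left ends lies in all of them. *)
Lemma geometric_limit {R : realType} (u : nat -> R) (C : R) :
  (forall n, `|u n.+1 - u n| <= C / 2 ^+ n) ->
  forall n, `|limn u - u n| <= 2 * C / 2 ^+ n.
Proof.
move=> uC.
pose d n : R := 2 * C / 2 ^+ n.
have dS n : d n = d n.+1 + C / 2 ^+ n.
  by rewrite /d exprS; field; rewrite expf_neq0.
have d0 n : 0 <= d n.
  rewrite /d divr_ge0 ?exprn_ge0// mulr_ge0//.
  by have := uC 0%N; rewrite expr0 divr1; apply: le_trans.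
have step n : u n - d n <= u n.+1 - d n.+1 /\ u n.+1 + d n.+1 <= u n + d n.
  by have := uC n; rewrite ler_norml (dS n) => /andP[h1 h2]; split; lra.
have a_nd : {homo (fun n => u n - d n) : m n / (m <= n)%N >-> m <= n}.
  by apply: homo_leq => [//|x y z|n]; [exact: le_trans|have [] := step n].
have b_ni m n : (m <= n)%N -> u n + d n <= u m + d m.
  elim: n => [|n IH]; first by rewrite leqn0 => /eqP ->.
  rewrite leq_eqVlt => /predU1P[->//|]; rewrite ltnS => /IH.
  by have [_] := step n; exact: le_trans.
have ab m n : u m - d m <= u n + d n.
  have [mn|nm] := leqP m n.
    by apply: le_trans (a_nd _ _ mn) _; have := d0 n; lra.
  by apply: le_trans (b_ni _ _ (ltnW nm)); have := d0 m; lra.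
pose A := range (fun n => u n - d n).
have Asup : has_sup A.
  by split; [exists (u 0%N - d 0%N), 0%N|exists (u 0%N + d 0%N) => _ [n _ <-]; exact: ab].
have lub n : `|sup A - u n| <= d n.
  have h1 : u n - d n <= sup A by apply: ub_le_sup; [have [] := Asup|exists n].
  have h2 : sup A <= u n + d n by apply: ge_sup; [have [] := Asup|move=> _ [m _ <-]; exact: ab].
  by rewrite ler_norml; apply/andP; split; lra.
suff -> : limn u = sup A by [].
apply/cvg_lim => //; apply/cvgrPdist_le => e e0.
have dc : d n @[n --> \oo] --> (0 : R).
  rewrite (_ : d = geometric (2 * C) 2^-1); last first.
    by apply/funext => n; rewrite /geometric/= /d exprVn.
  by apply: cvg_geometric; rewrite ger0_norm ?invr_ge0//; lra.
move/cvgrPdist_le : dc => /(_ e e0); apply: filterS => n.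
rewrite sub0r normrN ger0_norm// => dn.
exact: le_trans (lub n) dn.
Qed.

Lemma geometric_small {R : realType} (C e : R) : 0 < e -> exists n : nat, C / 2 ^+ n < e.
Proof.
move=> e0; have C1 : 0 < `|C| + 1 by have := normr_ge0 C; lra.
exists (Num.truncn ((`|C| + 1) / e)).+1.
rewrite ltr_pdivrMr ?exprn_gt0//.
apply: (@lt_le_trans _ _ (`|C| + 1)); first by have := ler_norm C; lra.
rewrite mulrC -ler_pdivrMr//; apply/ltW; apply: lt_trans (truncnS_gt _) _.
by rewrite -natrX ltr_nat ltn_expl.
Qed.

(** Uniformity on left half-lines is available because the Picard iterates are constant on negative
    arguments. *)
Lemma uniform_limit_continuous_left {R : realType} (u : nat -> R -> R) (f : R -> R) :
  (forall n, continuous (u n)) ->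
  (forall X : R, exists C : R, forall n x, x <= X -> `|f x - u n x| <= C / 2 ^+ n) ->
  continuous f.
Proof.
move=> cu uf x; apply/cvgrPdist_lt => e e0.
have [C HC] := uf (x + 1).
have [n hn] := geometric_small C (e / 3) (divr_gt0 e0 (ltr0n _ 3)).
have e3 : 0 < e / 3 by lra.
have /cvgrPdist_lt /(_ _ e3) := cu n x; apply: filter_app.
near=> y => h.
have yx : y <= x + 1 by apply: ltW; near: y; apply: lt_nbhsl; rewrite ltrDl.
have h1 := HC n y yx.
have h2 : `|f x - u n x| <= C / 2 ^+ n by apply: HC; lra.
apply: le_lt_trans (ler_distD (u n x) _ _) _.
apply: (@le_lt_trans _ _ (C / 2 ^+ n + (`|u n x - u n y| + `|u n y - f y|))).
  by rewrite lerD// ler_distD.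
by rewrite (distrC (u n y)); lra.
Unshelve. all: by end_near. Qed.

(** Bielecki's weighted norm: against the weight [expR (L * y)], integration gains a factor [L], so
    that Picard iteration contracts on the whole interval at once. *)
Lemma norm_le_expR {R : realType} (F f : R -> R) (A L x : R) : 0 < L -> 0 <= x -> F 0 = 0 ->
  (forall y, 0 <= y <= x -> is_derive y 1 F (f y)) ->
  (forall y, 0 <= y <= x -> `|f y| <= A * expR (L * y)) ->
  `|F x| <= A / L * expR (L * x).
Proof.
move=> L0 x0 F0 dF fA.
have A0 : 0 <= A.
  have := fA 0; rewrite lexx x0 mulr0 expR0 mulr1 => /(_ isT); exact: le_trans.
pose G (y : R) := A / L * expR (L * y).
have dG (y : R) : is_derive y 1 G (A * expR (L * y)).
  have h : is_derive y 1 (fun z => L * z) L.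
    by apply: derE (derM _ _ _ _ _ (derC L y) (derI y)) _; ring.
  apply: derE (derM _ _ _ _ _ (derC (A / L) y) (derexp _ _ _ h)) _.
  by field; rewrite gt_eqF.
have G0 : 0 <= G 0 by rewrite /G mulr0 expR0 mulr1 divr_ge0// ltW.
have nG (y : R) : is_derive y 1 (fun z => - G z) (- (A * expR (L * y))).
  exact: is_deriveN.
have h1 := @le_increment R _ _ _ _ 0 x x0 dF (fun y _ => dG y)
  (fun y h => le_trans (ler_norm _) (fA y h)).
have h2 := @le_increment R _ _ _ _ 0 x x0 (fun y _ => nG y) dF.
rewrite -/(G x) ler_norml; apply/andP; split; last by move: h1; rewrite F0; lra.
suff : - G x - - G 0 <= F x - F 0 by rewrite F0; lra.
by apply: h2 => y /fA; rewrite ler_norml => /andP[].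
Qed.

Section linear_ode.
Context {R : realType} (D P : R -> R) (cD : continuous D) (cP : continuous P).

Let m0 (x : R) : R := Num.max 0 x.

Let J (k : R -> R) (x : R) : R := primitive k (m0 x).

Let cJ k : continuous k -> continuous (J k).
Proof.
move=> ck; apply: max0_continuous => x x0.
exact: der_cont (derive_primitive k ck x x0).
Qed.

(* Picard iteration for [phi' = v - D phi], [v' = D v + P phi] *)
Let step (p : (R -> R) * (R -> R)) : (R -> R) * (R -> R) :=
  (J (fun x => p.2 x - D x * p.1 x), fun x => 1 + J (fun x => D x * p.2 x + P x * p.1 x) x).

Let it (n : nat) := iter n step (cst 0, cst 1).

Let c_it n : continuous (it n).1 /\ continuous (it n).2.
Proof.
elim: n => [|n [IH1 IH2]]; first by split => x; exact: cvg_cst.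
split => /=.
  apply: cJ => x; apply: (@cvgB _ R^o) ; first exact: IH2.
  by apply: cvgM; [exact: cD|exact: IH1].
move=> x; apply: (@cvgD _ R^o); first exact: cvg_cst.
apply: cJ => y; apply: (@cvgD _ R^o).
  by apply: cvgM; [exact: cD|exact: IH2].
by apply: cvgM; [exact: cP|exact: IH1].
Qed.

Let c_k1 n : continuous (fun x => (it n).2 x - D x * (it n).1 x).
Proof.
have [h1 h2] := c_it n; move=> x; apply: (@cvgB _ R^o); first exact: h2.
by apply: cvgM; [exact: cD|exact: h1].
Qed.

Let c_k2 n : continuous (fun x => D x * (it n).2 x + P x * (it n).1 x).
Proof.
have [h1 h2] := c_it n; move=> x; apply: (@cvgD _ R^o).
  by apply: cvgM; [exact: cD|exact: h2].
by apply: cvgM; [exact: cP|exact: h1].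
Qed.

Let m0_id x : 0 <= x -> m0 x = x.
Proof. by move=> x0; rewrite /m0 max_r. Qed.

Let it_m0 n x : (it n).1 (m0 x) = (it n).1 x /\ (it n).2 (m0 x) = (it n).2 x.
Proof.
have mm : m0 (m0 x) = m0 x by rewrite m0_id// /m0 le_max lexx.
by case: n => [|n] //; rewrite /= /J mm.
Qed.

Let it_diff X : 0 <= X -> exists2 L : R, 0 < L & forall n x, 0 <= x <= X ->
  `|(it n.+1).1 x - (it n).1 x| <= (2 ^+ n)^-1 * expR (L * x) /\
  `|(it n.+1).2 x - (it n).2 x| <= (2 ^+ n)^-1 * expR (L * x).
Proof.
move=> X0; have [K1 K11 DK] := continuous_norm_bounded D X cD.
have [K2 K21 PK] := continuous_norm_bounded P X cP.
pose K := K1 + K2; have K1' : 1 <= K by rewrite /K; lra.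
(* The integrands of one Picard step lose a factor [2 * K], the integration gains [4 * K]:
   consecutive differences are halved. *)
exists (4 * K) => [|n x /andP[x0 xX]]; first lra.
have L0 : 0 < 4 * K by lra.
have AL n' : 2 * K / 2 ^+ n' / (4 * K) = (2 ^+ n'.+1)^-1.
  by rewrite exprS; field; rewrite expf_neq0//=; lra.
have bd (d1 d2 A y : R) : 0 <= y <= X -> `|d1| <= A -> `|d2| <= A ->
    `|d2 - D y * d1| <= 2 * K * A /\ `|D y * d2 + P y * d1| <= 2 * K * A.
  move=> yX h1 h2; have A0 : 0 <= A by exact: le_trans h1.
  have hD := DK y yX; have hP := PK y yX.
  have p1 : `|D y * d1| <= K * A.
    by rewrite normrM ler_pM// (le_trans hD)// /K; lra.
  have p2 : `|D y * d2| <= K * A.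
    by rewrite normrM ler_pM// (le_trans hD)// /K; lra.
  have p3 : `|P y * d1| <= K * A.
    by rewrite normrM ler_pM// (le_trans hP)// /K; lra.
  have p4 : A <= K * A by rewrite ler_peMl.
  split.
    by apply: le_trans (ler_normB _ _) _; lra.
  by apply: le_trans (ler_normD _ _) _; lra.
elim: n x x0 xX => [|n IH] x x0 xX.
  have E y : 1 <= expR (4 * K * y) \/ y < 0.
    have [y0|] := leP 0 y; [left|by right].
    by apply: le_trans (expR_ge1Dx _); rewrite lerDl mulr_ge0// ltW.
  have E2 y : 0 <= y <= x -> 2 * K * 1 <= 2 * K / 2 ^+ 0 * expR (4 * K * y).
    move=> /andP[y0 _]; rewrite expr0 divr1 ler_pM2l; last lra.
    by have [//|] := E y; lra.
  have b0 y : 0 <= y <= x -> `|0 - 0 : R| <= 1 by rewrite subrr normr0.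
  have le1 : (2 ^+ 1)^-1 * expR (4 * K * x) <= (2 ^+ 0)^-1 * expR (4 * K * x).
    by rewrite ler_pM2r ?expR_gt0// expr1 expr0; lra.
  split; apply: le_trans le1; rewrite -AL.
    rewrite /= /J subr0 m0_id//; apply: (norm_le_expR _ _ _ _ _ L0 x0 (primitive0 _)).
      by move=> y /andP[y0 _]; apply: derive_primitive => //; exact: (c_k1 0).
    move=> y yx; apply: le_trans (E2 y yx).
    have yX : 0 <= y <= X by case/andP: yx => -> /= yx; exact: le_trans xX.
    by have [] := bd 0 1 1 y yX _ _; rewrite ?normr0 ?normr1.
  rewrite /= /J addrAC subrr add0r m0_id//; apply: (norm_le_expR _ _ _ _ _ L0 x0 (primitive0 _)).
    by move=> y /andP[y0 _]; apply: derive_primitive => //; exact: (c_k2 0).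
  move=> y yx; apply: le_trans (E2 y yx).
  have yX : 0 <= y <= X by case/andP: yx => -> /= yx; exact: le_trans xX.
  by have [] := bd 0 1 1 y yX _ _; rewrite ?normr0 ?normr1.
have key y : 0 <= y <= x ->
    `|((it n.+1).2 y - D y * (it n.+1).1 y) - ((it n).2 y - D y * (it n).1 y)| <=
      2 * K / 2 ^+ n * expR (4 * K * y) /\
    `|(D y * (it n.+1).2 y + P y * (it n.+1).1 y) - (D y * (it n).2 y + P y * (it n).1 y)| <=
      2 * K / 2 ^+ n * expR (4 * K * y).
  move=> /andP[y0 yx]; have yX := le_trans yx xX.
  have [h1 h2] := IH y y0 yX.
  have yX' : 0 <= y <= X by rewrite y0.
  have [b1 b2] := bd _ _ _ y yX' h1 h2.
  rewrite -[2 * K / 2 ^+ n * _]mulrA; split.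
    by move: b1; congr (`| _ | <= _); ring.
  by move: b2; congr (`| _ | <= _); ring.
split; rewrite -AL.
  rewrite [in X in `|X|]/= /J m0_id//.
  apply: (norm_le_expR (fun y => primitive _ y - primitive _ y) _ _ _ _ L0 x0).
  - by rewrite !primitive0 subrr.
  - by move=> y /andP[y0 _]; exact: (derB _ _ _ _ _ (derive_primitive _ (c_k1 n.+1) y y0)
      (derive_primitive _ (c_k1 n) y y0)).
  - by move=> y yx; have [] := key y yx.
rewrite [in X in `|X|]/= /J m0_id// opprD addrACA subrr add0r.
apply: (norm_le_expR (fun y => primitive _ y - primitive _ y) _ _ _ _ L0 x0).
- by rewrite !primitive0 subrr.
- by move=> y /andP[y0 _]; exact: (derB _ _ _ _ _ (derive_primitive _ (c_k2 n.+1) y y0)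
      (derive_primitive _ (c_k2 n) y y0)).
- by move=> y yx; have [] := key y yx.
Qed.

Let Phi x := limn (fun n => (it n).1 x).
Let V x := limn (fun n => (it n).2 x).

Let it_lim X : exists C : R, forall n x, x <= X ->
  `|Phi x - (it n).1 x| <= C / 2 ^+ n /\ `|V x - (it n).2 x| <= C / 2 ^+ n.
Proof.
have X0 : 0 <= m0 X by rewrite /m0 le_max lexx.
have [L L0 HL] := it_diff (m0 X) X0.
exists (2 * expR (L * m0 X)) => n x xX.
have mx : 0 <= m0 x <= m0 X by rewrite /m0 le_max lexx/= ge_max !le_max lexx xX orbT.
have E : expR (L * m0 x) <= expR (L * m0 X).
  by rewrite ler_expR ler_pM2l//; case/andP: mx.
have st k : `|(it k.+1).1 x - (it k).1 x| <= expR (L * m0 X) / 2 ^+ k /\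
            `|(it k.+1).2 x - (it k).2 x| <= expR (L * m0 X) / 2 ^+ k.
  have [<- <-] := it_m0 k.+1 x; have [<- <-] := it_m0 k x.
  have [h1 h2] := HL k _ mx; split; [apply: le_trans h1 _|apply: le_trans h2 _];
    by rewrite mulrC ler_pM2r// invr_gt0 exprn_gt0.
split; apply: geometric_limit => k; by have [] := st k.
Qed.

Let cPhi : continuous Phi.
Proof.
apply: (uniform_limit_continuous_left (fun n => (it n).1)); first by move=> n; have [] := c_it n.
by move=> X; have [C H] := it_lim X; exists C => n x /(H n)[].
Qed.

Let cV : continuous V.
Proof.
apply: (uniform_limit_continuous_left (fun n => (it n).2)); first by move=> n; have [] := c_it n.
by move=> X; have [C H] := it_lim X; exists C => n x /(H n)[].
Qed.

Let k1 x := V x - D x * Phi x.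
Let k2 x := D x * V x + P x * Phi x.

Let ck1 : continuous k1.
Proof.
move=> x; apply: (@cvgB _ R^o); first exact: cV.
by apply: cvgM; [exact: cD|exact: cPhi].
Qed.

Let ck2 : continuous k2.
Proof.
move=> x; apply: (@cvgD _ R^o).
  by apply: cvgM; [exact: cD|exact: cV].
by apply: cvgM; [exact: cP|exact: cPhi].
Qed.

Let fixpoint x : 0 <= x -> Phi x = primitive k1 x /\ V x = 1 + primitive k2 x.
Proof.
move=> x0; have [C HC] := it_lim x.
have [K1 K11 DK] := continuous_norm_bounded D x cD.
have [K2 K21 PK] := continuous_norm_bounded P x cP.
pose K := K1 + K2; have K1' : 1 <= K by rewrite /K; lra.
have C0 n : 0 <= C / 2 ^+ n by have [h _] := HC n x (lexx x); exact: le_trans h.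
have bd n y : 0 <= y <= x ->
    `|((it n).2 y - D y * (it n).1 y) - k1 y| <= 2 * K * (C / 2 ^+ n) * expR (1 * y) /\
    `|(D y * (it n).2 y + P y * (it n).1 y) - k2 y| <= 2 * K * (C / 2 ^+ n) * expR (1 * y).
  move=> yx; have yx' : y <= x by case/andP: yx.
  have [h1 h2] := HC n y yx'.
  have hD := DK y yx; have hP := PK y yx.
  set A := C / 2 ^+ n in h1 h2 *.
  have A0 : 0 <= A by exact: C0.
  set d1 := Phi y - _ in h1; set d2 := V y - _ in h2.
  have p1 : `|D y * d1| <= K * A.
    by rewrite normrM ler_pM// (le_trans hD)// /K; lra.
  have p2 : `|D y * d2| <= K * A.
    by rewrite normrM ler_pM// (le_trans hD)// /K; lra.
  have p3 : `|P y * d1| <= K * A.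
    by rewrite normrM ler_pM// (le_trans hP)// /K; lra.
  have p4 : A <= K * A by rewrite ler_peMl.
  have E : 2 * K * A <= 2 * K * A * expR (1 * y).
    have B0 : 0 <= 2 * K * A by apply: mulr_ge0 => //; lra.
    have E1 : 1 <= expR (1 * y).
      by rewrite mul1r; apply: le_trans (expR_ge1Dx _); rewrite lerDl; case/andP: yx.
    by rewrite ler_peMr.
  split; apply: le_trans E.
    rewrite (_ : _ - k1 y = D y * d1 - d2); last by rewrite /k1 /d1 /d2; ring.
    by apply: le_trans (ler_normB _ _) _; lra.
  rewrite (_ : _ - k2 y = - (D y * d2) - P y * d1); last by rewrite /k2 /d1 /d2; ring.
  by apply: le_trans (ler_normB _ _) _; rewrite normrN; lra.
pose M := C + 2 * K * C * expR x.
have M1 n : C / 2 ^+ n.+1 + 2 * K * (C / 2 ^+ n) / 1 * expR (1 * x) <= M / 2 ^+ n.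
  have : C / 2 ^+ n.+1 <= C / 2 ^+ n.
    have := C0 n.+1; have -> : C / 2 ^+ n = 2 * (C / 2 ^+ n.+1) by rewrite exprS; field; rewrite expf_neq0.
    lra.
  rewrite (_ : M / 2 ^+ n = C / 2 ^+ n + 2 * K * (C / 2 ^+ n) * expR x); last by rewrite /M; ring.
  rewrite divr1 mul1r; lra.
have zero (z : R) : (forall n, `|z| <= M / 2 ^+ n) -> z = 0.
  move=> zM; apply/eqP; rewrite -normr_le0 leNgt; apply/negP => z0.
  by have [n] := geometric_small M _ z0; rewrite ltNge zM.
split; apply/eqP; rewrite -subr_eq0; apply/eqP; apply: zero => n; apply: le_trans (M1 n).
  apply: le_trans (ler_distD ((it n.+1).1 x) _ _) _.
  apply: lerD; first by have [] := HC n.+1 x (lexx x).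
  rewrite [in X in `|X|]/= /J m0_id//.
  apply: (norm_le_expR (fun y => primitive _ y - primitive _ y) _ _ _ _ ltr01 x0).
  - by rewrite !primitive0 subrr.
  - by move=> y /andP[y0 _]; exact: (derB _ _ _ _ _ (derive_primitive _ (c_k1 n) y y0)
      (derive_primitive _ ck1 y y0)).
  - by move=> y yx; have [] := bd n y yx.
apply: le_trans (ler_distD ((it n.+1).2 x) _ _) _.
apply: lerD; first by have [] := HC n.+1 x (lexx x).
rewrite [in X in `|X|]/= /J m0_id// opprD addrACA subrr add0r.
apply: (norm_le_expR (fun y => primitive _ y - primitive _ y) _ _ _ _ ltr01 x0).
- by rewrite !primitive0 subrr.
- by move=> y /andP[y0 _]; exact: (derB _ _ _ _ _ (derive_primitive _ (c_k2 n) y y0)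
      (derive_primitive _ ck2 y y0)).
- by move=> y yx; have [] := bd n y yx.
Qed.

Lemma linear_ode_solution : exists phi v : R -> R, [/\ phi 0 = 0, v 0 = 1 &
  forall x : R, 0 <= x -> is_derive x 1 phi (v x - D x * phi x) /\
                      is_derive x 1 v (D x * v x + P x * phi x)].
Proof.
(* The limit [Phi] is constant to the left of [0] and has slope [1] to the right. The primitives
   agree with the limits on [[0, oo)] and have two-sided derivatives at [0]. *)
exists (primitive k1), (fun x => 1 + primitive k2 x); split.
- exact: primitive0.
- by rewrite primitive0 addr0.
move=> x x0; have [h1 h2] := fixpoint x x0.
rewrite -h1 -h2; split; first exact: derive_primitive.
rewrite -[X in is_derive _ _ _ X]add0r.
exact: (derD _ _ _ _ _ (derC 1 x) (derive_primitive _ ck2 x x0)).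
Qed.

End linear_ode.

(** * The Schrödinger system and its dependence on the spectral parameter *)

Section schroedinger.
Context {R : realType} (D E : R -> R) (cD : continuous D) (cE : continuous E)
  (D_small : forall e : R, 0 < e -> exists2 C : R, 0 <= C & forall x : R, 0 <= x -> D x ^+ 2 <= e * (1 + x) + C)
  (E_small : forall e : R, 0 < e -> exists2 C : R, 0 <= C & forall x : R, 0 <= x -> `|E x| <= e * (1 + x) + C).

Definition form_density (x f g : R) : R := g ^+ 2 + (x + E x) * f ^+ 2 + 2 * (g * f * D x).

Lemma form_density_coercive : exists2 C : R, 0 <= C & forall x f g : R, 0 <= x ->
  g ^+ 2 / 2 + (1 + x) * f ^+ 2 / 2 - C * f ^+ 2 <= form_density x f g.
Proof.
(* Completing the square [(g + 2 f D)^2 / 2] costs [g^2 / 2] and [2 f^2 D^2]; the latter takes a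
   quarter of [(1 + x) f^2], and [E] takes another quarter. The [1] in the constant turns [x] into
   [1 + x]. *)
have e8 : 0 < 8^-1 :> R by rewrite invr_gt0.
have e4 : 0 < 4^-1 :> R by rewrite invr_gt0.
have [C1 C10 HD] := D_small 8^-1 e8; have [C2 C20 HE] := E_small 4^-1 e4.
exists (1 + C2 + 2 * C1) => [|x f g x0]; first lra.
have h1 := HD x x0; have := HE x x0; rewrite ler_norml => /andP[h2 _].
have f0 := sqr_ge0 f.
have s0 := sqr_ge0 (g + 2 * (f * D x)).
have h3 : 0 <= (8^-1 * (1 + x) + C1 - D x ^+ 2) * f ^+ 2 by rewrite mulr_ge0 ?subr_ge0.
have h4 : 0 <= (E x + (4^-1 * (1 + x) + C2)) * f ^+ 2 by apply: mulr_ge0 => //; lra.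
rewrite /form_density -subr_ge0.
have -> : g ^+ 2 + (x + E x) * f ^+ 2 + 2 * (g * f * D x) -
   (g ^+ 2 / 2 + (1 + x) * f ^+ 2 / 2 - (1 + C2 + 2 * C1) * f ^+ 2) =
   (g + 2 * (f * D x)) ^+ 2 / 2 + 2 * ((8^-1 * (1 + x) + C1 - D x ^+ 2) * f ^+ 2) +
   ((E x + (4^-1 * (1 + x) + C2)) * f ^+ 2) by field.
lra.
Qed.

(* [v] stands for [phi' + D phi], so that no derivative of the noise occurs. *)
Definition schroedinger_solution (l : R) (phi v : R -> R) : Prop :=
  [/\ phi 0 = 0, v 0 = 1 & forall x : R, 0 <= x ->
    is_derive x 1 phi (v x - D x * phi x) /\
    is_derive x 1 v (D x * (v x - D x * phi x) + (x - l + E x) * phi x)].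

Lemma schroedinger_solution_exists (l : R) : exists phi v, schroedinger_solution l phi v.
Proof.
have cP : continuous (fun x => x - l + E x - D x ^+ 2).
  move=> x; apply: (@cvgB _ R^o); last exact: (cvgM (cD x) (cD x)).
  apply: (@cvgD _ R^o); last exact: cE.
  by apply: (@cvgB _ R^o); [exact: cvg_id|exact: cvg_cst].
have [phi [v [phi0 v0 H]]] := linear_ode_solution D _ cD cP.
exists phi, v; split => // x x0; have [h1 h2] := H x x0; split => //.
by apply: derE h2 _; ring.
Qed.

(* [e = phi ^ 2 + v ^ 2] satisfies [|e'| <= C e]. *)
Lemma schroedinger_solution_neq0 (l : R) phi v : schroedinger_solution l phi v ->
  forall x : R, 0 <= x -> 0 < phi x ^+ 2 + v x ^+ 2.
Proof.
move=> [phi0 v0 H] X X0.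
have [K K1 DK] := continuous_norm_bounded D X cD.
have cP : continuous (fun x => 1 + (x - l + E x - D x ^+ 2)).
  move=> x; apply: (@cvgD _ R^o); first exact: cvg_cst.
  apply: (@cvgB _ R^o); last exact: (cvgM (cD x) (cD x)).
  apply: (@cvgD _ R^o); last exact: cE.
  by apply: (@cvgB _ R^o); [exact: cvg_id|exact: cvg_cst].
have [M M1 PM] := continuous_norm_bounded _ X cP.
(* The two terms of the derivative of [phi^2 + v^2] are at most [2 * K] and [M] times this sum, so
   the weight [expR (C * x)] makes it nondecreasing. *)
pose C := 2 * K + M.
pose W x := expR (C * x) * (phi x ^+ 2 + v x ^+ 2).
have dW x : 0 <= x <= X -> is_derive x 1 W (expR (C * x) *
    (C * (phi x ^+ 2 + v x ^+ 2) + 2 * D x * (v x ^+ 2 - phi x ^+ 2) +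
     2 * (1 + (x - l + E x - D x ^+ 2)) * (phi x * v x))).
  move=> /andP[x0 _]; have [h1 h2] := H x x0.
  have h : is_derive x 1 (fun z => C * z) C.
    by apply: derE (derM _ _ _ _ _ (derC C x) (derI x)) _; ring.
  have h3 := derD _ _ _ _ _ (derX2 _ _ _ h1) (derX2 _ _ _ h2).
  by apply: derE (derM _ _ _ _ _ (derexp _ _ _ h) h3) _; ring.
have := @le_increment R _ _ _ _ 0 X X0 (fun x _ => derC 0 x) dW.
rewrite subrr {1}/W {1}/W mulr0 expR0 phi0 v0 expr0n/= add0r expr1n mul1r.
have nonneg x : 0 <= x <= X -> 0 <= expR (C * x) *
    (C * (phi x ^+ 2 + v x ^+ 2) + 2 * D x * (v x ^+ 2 - phi x ^+ 2) +
     2 * (1 + (x - l + E x - D x ^+ 2)) * (phi x * v x)).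
  move=> xX; rewrite mulr_ge0 ?expR_ge0//.
  have := DK x xX; have := PM x xX; move: (1 + (x - l + E x - D x ^+ 2)) => Q.
  rewrite !ler_norml => /andP[q1 q2] /andP[d1 d2].
  have a0 := sqr_ge0 (phi x); have b0 := sqr_ge0 (v x).
  have s1 := sqr_ge0 (phi x + v x); have s2 := sqr_ge0 (phi x - v x).
  have t1 : 0 <= (M - Q) * (phi x - v x) ^+ 2 by rewrite mulr_ge0 ?subr_ge0.
  have t2 : 0 <= (M + Q) * (phi x + v x) ^+ 2 by apply: mulr_ge0 => //; lra.
  have t3 : 0 <= (K - D x) * phi x ^+ 2 by rewrite mulr_ge0 ?subr_ge0.
  have t4 : 0 <= (K + D x) * v x ^+ 2 by apply: mulr_ge0 => //; lra.
  have -> : C * (phi x ^+ 2 + v x ^+ 2) + 2 * D x * (v x ^+ 2 - phi x ^+ 2) +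
    2 * Q * (phi x * v x) = 2 * ((K - D x) * phi x ^+ 2) + 2 * ((K + D x) * v x ^+ 2) +
    ((M - Q) * (phi x - v x) ^+ 2 + (M + Q) * (phi x + v x) ^+ 2) / 2.
    by rewrite /C; field.
  lra.
move=> /(_ nonneg) h.
have e0 := expR_gt0 (C * X).
by rewrite -(pmulr_rgt0 _ e0); move: h; rewrite /W; lra.
Qed.

(** Gronwall's argument for the difference of two solutions, which is driven by [(l - l0) * phi0].
    Adding the constant [t ^ 2 * N ^ 2], with [N] a bound of [phi0], to the squared distance absorbs
    this forcing: the weighted sum [W] is nonincreasing. *)
Lemma schroedinger_solution_continuous (l0 X e : R) phi0 v0 : schroedinger_solution l0 phi0 v0 ->
  0 <= X -> 0 < e -> exists2 d : R, 0 < d & forall l phi v, schroedinger_solution l phi v ->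
    `|l - l0| < d -> forall x : R, 0 <= x <= X ->
    `|phi x - phi0 x| <= e /\ `|v x - v0 x| <= e.
Proof.
move=> sol0 X0 e0.
have [p00 v00 H0] := sol0.
have [K K1 DK] := continuous_norm_bounded D X cD.
have cP : continuous (fun x => 1 + (x - l0 + E x - D x ^+ 2)).
  move=> x; apply: (@cvgD _ R^o); first exact: cvg_cst.
  apply: (@cvgB _ R^o); last exact: (cvgM (cD x) (cD x)).
  apply: (@cvgD _ R^o); last exact: cE.
  by apply: (@cvgB _ R^o); [exact: cvg_id|exact: cvg_cst].
have [M M1 PM] := continuous_norm_bounded _ X cP.
have cphi : continuous (fun x : R => phi0 (Num.max 0 x)).
  by apply: max0_continuous => x x0; have [h _] := H0 x x0; exact: der_cont h.
have [N N1 phiN] := continuous_norm_bounded _ X cphi.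
pose C := 2 * K + M + 2.
pose B := N * expR (C * X).
have B1 : 0 < B by rewrite mulr_gt0 ?expR_gt0//; lra.
have C0 : 0 < C by rewrite /C; lra.
have N0 : 0 <= N by lra.
have E1 : 1 <= expR (C * X).
  by apply: le_trans (expR_ge1Dx _); rewrite lerDl mulr_ge0// ltW.
(* The bound [1] on [|l - l0|] lets [C] be chosen independently of [l]; on [[0, X]] the solutions
   then differ by at most [|l - l0| * B]. *)
exists (Num.min 1 (e / B)) => [|l phi v sol]; first by rewrite lt_min ltr01 divr_gt0.
rewrite lt_min => /andP[ll1 llB] Y /andP[Y0 YX].
have [p0 vv0 H] := sol.
pose t := l - l0.
have tB : `|t| * B <= e by rewrite -ler_pdivlMr// ltW.
pose a x := phi x - phi0 x; pose b x := v x - v0 x.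
pose W x := expR (- C * x) * (a x ^+ 2 + b x ^+ 2 + t ^+ 2 * N ^+ 2).
pose Q x := 1 + (x - l0 + E x - D x ^+ 2).
have dW x : 0 <= x <= Y -> is_derive x 1 W (expR (- C * x) *
    (- C * (a x ^+ 2 + b x ^+ 2 + t ^+ 2 * N ^+ 2) + 2 * D x * (b x ^+ 2 - a x ^+ 2) +
     2 * (Q x - t) * (a x * b x) - 2 * t * b x * phi0 x)).
  move=> /andP[x0 _]; have [h1 h2] := H x x0; have [h3 h4] := H0 x x0.
  have h : is_derive x 1 (fun z => - C * z) (- C).
    by apply: derE (derM _ _ _ _ _ (derC (- C) x) (derI x)) _; ring.
  have ha : is_derive x 1 a (b x - D x * a x).
    by apply: derE (derB _ _ _ _ _ h1 h3) _; rewrite /a /b; ring.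
  have hb : is_derive x 1 b (D x * b x + (Q x - 1 - t) * a x - t * phi0 x).
    by apply: derE (derB _ _ _ _ _ h2 h4) _; rewrite /a /b /Q /t; ring.
  have h5 := derD _ _ _ _ _ (derD _ _ _ _ _ (derX2 _ _ _ ha) (derX2 _ _ _ hb)) (derC (t ^+ 2 * N ^+ 2) x).
  by apply: derE (derM _ _ _ _ _ (derexp _ _ _ h) h5) _; rewrite /Q; ring.
have nonpos x : 0 <= x <= Y -> expR (- C * x) *
    (- C * (a x ^+ 2 + b x ^+ 2 + t ^+ 2 * N ^+ 2) + 2 * D x * (b x ^+ 2 - a x ^+ 2) +
     2 * (Q x - t) * (a x * b x) - 2 * t * b x * phi0 x) <= 0.
  move=> xY; rewrite pmulr_rle0 ?expR_gt0//.
  have xX : 0 <= x <= X by case/andP: xY => -> /= xY; exact: le_trans YX.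
  have := DK x xX; have := PM x xX; rewrite -/(Q x).
  have := phiN x xX; rewrite (_ : Num.max 0 x = x); last by rewrite max_r//; case/andP: xX.
  move: ll1; rewrite -/t ltr_norml => /andP[t1 t2].
  move: (Q x) (a x) (b x) (phi0 x) (D x) => q aa bb p dd hp.
  rewrite !ler_norml => /andP[q1 q2] /andP[d1 d2].
  have p2 : p ^+ 2 <= N ^+ 2.
    by rewrite -[leLHS]ger0_norm ?sqr_ge0// normrX lerXn2r ?nnegrE.
  have a0 := sqr_ge0 aa; have b0 := sqr_ge0 bb.
  have s1 := sqr_ge0 (aa + bb); have s2 := sqr_ge0 (aa - bb).
  have u1 : 0 <= (M + 1 - (q - t)) * (aa + bb) ^+ 2 by apply: mulr_ge0 => //; lra.
  have u2 : 0 <= (M + 1 + (q - t)) * (aa - bb) ^+ 2 by apply: mulr_ge0 => //; lra.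
  have u3 : 0 <= (K + dd) * aa ^+ 2 by apply: mulr_ge0 => //; lra.
  have u4 : 0 <= (K - dd) * bb ^+ 2 by apply: mulr_ge0 => //; lra.
  have u5 := sqr_ge0 (bb + t * p).
  have u6 : 0 <= t ^+ 2 * (N ^+ 2 - p ^+ 2) by rewrite mulr_ge0 ?sqr_ge0 ?subr_ge0.
  have u7 : 0 <= (C - 1) * (t ^+ 2 * N ^+ 2).
    by apply: mulr_ge0; [rewrite /C; lra|rewrite mulr_ge0 ?sqr_ge0].
  rewrite -oppr_ge0.
  have -> : - (- C * (aa ^+ 2 + bb ^+ 2 + t ^+ 2 * N ^+ 2) + 2 * dd * (bb ^+ 2 - aa ^+ 2) +
    2 * (q - t) * (aa * bb) - 2 * t * bb * p) =
    2 * ((K + dd) * aa ^+ 2) + 2 * ((K - dd) * bb ^+ 2) +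
    ((M + 1 - (q - t)) * (aa + bb) ^+ 2 + (M + 1 + (q - t)) * (aa - bb) ^+ 2) / 2 +
    (bb + t * p) ^+ 2 + t ^+ 2 * (N ^+ 2 - p ^+ 2) + (C - 1) * (t ^+ 2 * N ^+ 2) + aa ^+ 2.
    by rewrite /C; field.
  lra.
have := @le_increment R _ _ _ _ 0 Y Y0 dW (fun x _ => derC 0 x) nonpos.
have W0 : W 0 = t ^+ 2 * N ^+ 2.
  by rewrite /W /a /b mulr0 expR0 p00 vv0 p0 v00 !subrr expr0n/= !add0r mul1r.
rewrite subrr W0 => WY.
have bound : a Y ^+ 2 + b Y ^+ 2 <= (`|t| * B) ^+ 2.
  have W2 : expR (- C * Y) * (a Y ^+ 2 + b Y ^+ 2) <= t ^+ 2 * N ^+ 2.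
    have : 0 <= expR (- C * Y) * (t ^+ 2 * N ^+ 2) by rewrite mulr_ge0 ?expR_ge0// mulr_ge0// sqr_ge0.
    by move: WY; rewrite /W; lra.
  have W3 : a Y ^+ 2 + b Y ^+ 2 <= expR (C * Y) * (t ^+ 2 * N ^+ 2).
    by move: W2; rewrite mulNr expRN ler_pdivrMl ?expR_gt0.
  apply: le_trans W3 _.
  rewrite [leRHS](_ : _ = expR (C * X) ^+ 2 * (t ^+ 2 * N ^+ 2)); last first.
    by rewrite exprMn real_normK ?num_real// /B; ring.
  apply: ler_wpM2r; first by apply: mulr_ge0; exact: sqr_ge0.
  apply: (@le_trans _ _ (expR (C * X))); first by rewrite ler_expR ler_pM2l.
  by rewrite expr2 ler_peMr// ltW// expR_gt0.
have e2 : (`|t| * B) ^+ 2 <= e ^+ 2.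
  by rewrite lerXn2r ?nnegrE ?mulr_ge0// ltW.
have a2 := sqr_ge0 (a Y); have b2 := sqr_ge0 (b Y).
have fin z : z ^+ 2 <= e ^+ 2 -> `|z| <= e.
  by move=> h; rewrite -(@ler_pXn2r _ 2)// ?nnegrE// ?(ltW e0)// -normrX ger0_norm// sqr_ge0.
by split; apply: fin; rewrite -/(a Y) -/(b Y); lra.
Qed.

End schroedinger.

(** * The positive solution of finite energy *)

Section ground_state.
Context {R : realType} (D E : R -> R) (cD : continuous D) (cE : continuous E)
  (D_small : forall e : R, 0 < e -> exists2 C : R, 0 <= C & forall x : R, 0 <= x -> D x ^+ 2 <= e * (1 + x) + C)
  (E_small : forall e : R, 0 < e -> exists2 C : R, 0 <= C & forall x : R, 0 <= x -> `|E x| <= e * (1 + x) + C).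

Notation sol := (schroedinger_solution D E).

Lemma solution_cont l phi v : sol l phi v ->
  forall x : R, 0 <= x -> {for x, continuous phi} /\ {for x, continuous v}.
Proof.
by move=> [_ _ H] x x0; have [h1 h2] := H x x0; split; [exact: der_cont h1|exact: der_cont h2].
Qed.

Lemma solution_max0_cont l phi v : sol l phi v ->
  continuous (fun x : R => phi (Num.max 0 x)) /\ continuous (fun x : R => v (Num.max 0 x)).
Proof. by move=> s; split; apply: max0_continuous => x x0; have [] := solution_cont l phi v s x x0. Qed.

Lemma max0_id (x : R) : 0 <= x -> Num.max 0 x = x.
Proof. by move=> x0; rewrite max_r. Qed.

(** Closeness of solutions says nothing about signs near [0], where all of them vanish. Their
    derivatives, equal to [1] at [0], stay above [1 / 2] on an interval common to all [l] near
    [l0]. *)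
Lemma solution_pos_near0 (l0 : R) : exists x1 d : R, [/\ 0 < x1, 0 < d &
  forall l phi v, sol l phi v -> `|l - l0| < d ->
  forall x : R, 0 <= x <= x1 -> x / 2 <= phi x].
Proof.
have [phi0 [v0 s0]] := schroedinger_solution_exists D E cD cE l0.
have [cphi0 cv0] := solution_max0_cont _ _ _ s0.
have [p00 v00 H0] := s0.
have cg : continuous (fun x : R => v0 (Num.max 0 x) - D x * phi0 (Num.max 0 x)).
  by move=> x; apply: (@cvgB _ R^o); [exact: cv0|apply: cvgM; [exact: cD|exact: cphi0]].
have q0 : 0 < 4^-1 :> R by rewrite invr_gt0.
have /cvgrPdist_lt /(_ _ q0)[r /= r0 Hr] := cg 0.
rewrite max0_id// v00 p00 mulr0 subr0 in Hr.
have [K K1 DK] := continuous_norm_bounded D r cD.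
(* The derivative [v - D phi] then moves by at most [1 / 4] as [l] varies; on [[0, r)] that of
   [phi0] is within [1 / 4] of [1]. *)
have e0 : 0 < (4 * (1 + K))^-1 by rewrite invr_gt0; lra.
have [d d0 Hd] := schroedinger_solution_continuous D E cD cE l0 r _ phi0 v0 s0 (ltW r0) e0.
exists (r / 2), d; split => //; first lra.
move=> l phi v s ld X /andP[X0 Xr]; have [p0 vv0 H] := s.
have dphi y : 0 <= y <= X -> is_derive y 1 phi (v y - D y * phi y).
  by move=> /andP[y0 _]; have [] := H y y0.
have dlin y : 0 <= y <= X -> is_derive y 1 (fun z : R => z / 2) 2^-1.
  by move=> _; apply: derE (derM _ _ _ _ _ (derI y) (derC 2^-1 y)) _; ring.
have := @le_increment R _ _ _ _ 0 X X0 dlin dphi.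
rewrite p0 mul0r !subr0; apply => y /andP[y0 yX].
have yr : 0 <= y <= r by rewrite y0; lra.
have [h1 h2] := Hd l phi v s ld y yr.
have := Hr y; rewrite /= sub0r normrN ger0_norm// max0_id// => /(_ _).
have yr' : y < r by lra.
move=> /(_ yr'); have := DK y yr => hD.
have h3 : `|D y * (phi y - phi0 y)| <= K * (4 * (1 + K))^-1 by rewrite normrM ler_pM.
have K4 : (4 * (1 + K))^-1 + K * (4 * (1 + K))^-1 = 4^-1.
  by field; rewrite ?mulf_neq0//; apply: lt0r_neq0; lra.
move: h2 h3; rewrite ltr_norml !ler_norml => /andP[a1 a2] /andP[b1 b2] /andP[c1 c2].
have -> : v y - D y * phi y = (v0 y - D y * phi0 y) + (v y - v0 y) - D y * (phi y - phi0 y) by ring.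
lra.
Qed.

(** On [[x1, Y]] the function [phi0] has a positive minimum; on [[0, x1]] the uniform lower bound
    [x / 2] takes over. *)
Lemma solution_pos_stable (l0 Y : R) phi0 v0 : sol l0 phi0 v0 -> 0 < Y ->
  (forall x : R, 0 < x <= Y -> 0 < phi0 x) ->
  exists2 d : R, 0 < d & forall l phi v, sol l phi v -> `|l - l0| < d ->
    forall x : R, 0 < x <= Y -> 0 < phi x.
Proof.
move=> s0 Y0 pos0.
have [x1 [d1 [x10 d10 H1]]] := solution_pos_near0 l0.
have [x1Y|Yx1] := ltP x1 Y; last first.
  exists d1 => // l phi v s ld x /andP[x0 xY].
  have xx : 0 <= x <= x1 by rewrite ltW//; lra.
  by have := H1 l phi v s ld x xx; lra.
have [|c cin cmin] := @EVT_min R phi0 x1 Y (ltW x1Y).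
  apply/continuous_in_subspaceT => x; rewrite inE/= in_itv/= => /andP[xx _].
  by have [] := solution_cont _ _ _ s0 x (le_trans (ltW x10) xx).
rewrite in_itv/= in cin; have /andP[c1 c2] := cin.
have m0 : 0 < phi0 c by apply: pos0; rewrite c2; lra.
have e0 : 0 < phi0 c / 2 by lra.
have [d2 d20 H2] := schroedinger_solution_continuous D E cD cE l0 Y _ phi0 v0 s0 (ltW Y0) e0.
exists (Num.min d1 d2) => [|l phi v s]; first by rewrite lt_min d10.
rewrite lt_min => /andP[ld1 ld2] x /andP[x0 xY].
have [xx|xx] := leP x x1.
  have xx' : 0 <= x <= x1 by rewrite ltW.
  by have := H1 l phi v s ld1 x xx'; lra.
have xY' : 0 <= x <= Y by rewrite ltW.
have [h _] := H2 l phi v s ld2 x xY'.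
have := cmin x; rewrite in_itv/= xY ltW// => /(_ isT) hc.
by move: h; rewrite ler_norml => /andP[]; lra.
Qed.

(** The limit is nonnegative, so a zero inside would be a minimum; then [phi0] and [v0] would vanish
    together, which a nontrivial solution excludes. *)
Lemma solution_pos_limit (l0 : R) phi0 v0 : sol l0 phi0 v0 ->
  (forall d : R, 0 < d -> exists l phi v, [/\ sol l phi v, `|l - l0| < d & forall x : R, 0 < x -> 0 < phi x]) ->
  forall x : R, 0 < x -> 0 < phi0 x.
Proof.
move=> s0 Hlim.
have nonneg x : 0 < x -> 0 <= phi0 x.
  move=> x0; rewrite leNgt; apply/negP => neg.
  have e0 : 0 < - phi0 x / 2 by lra.
  have [d d0 Hd] := schroedinger_solution_continuous D E cD cE l0 x _ phi0 v0 s0 (ltW x0) e0.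
  have [l [phi [v [s ld pos]]]] := Hlim d d0.
  have xx : 0 <= x <= x by rewrite lexx ltW.
  have [h _] := Hd l phi v s ld x xx.
  by have := pos x x0; move: h; rewrite ler_norml => /andP[]; lra.
move=> x x0; rewrite lt_neqAle nonneg// andbT; apply/negP => /eqP z.
have [p0 v00 H] := s0; have [h1 h2] := H x (ltW x0).
have h3 : is_derive x 1 phi0 0.
  apply: (@derive1_at_min R phi0 0 (x + 1) x).
  - lra.
  - by move=> t; rewrite in_itv/= => /andP[/ltW t0 _]; have [? _] := H t t0; exact: ex_derive.
  - by rewrite in_itv/= x0; lra.
  - by move=> t; rewrite in_itv/= => /andP[t0 _]; rewrite -z nonneg.
have v0x : v0 x = 0.
  have : v0 x - D x * phi0 x = 0.
    by rewrite -(@derive_val _ _ _ _ _ _ _ h1) (@derive_val _ _ _ _ _ _ _ h3).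
  by rewrite -z mulr0 subr0.
have := schroedinger_solution_neq0 D E cD cE l0 phi0 v0 s0 x (ltW x0).
by rewrite v0x -z expr0n/= addr0 ltxx.
Qed.

Definition mass (phi : R -> R) : R -> R := primitive (fun x : R => phi (Num.max 0 x) ^+ 2).

Definition energy (phi v : R -> R) : R -> R := primitive (fun x : R =>
  (v (Num.max 0 x) - D x * phi (Num.max 0 x)) ^+ 2 + (1 + x) * phi (Num.max 0 x) ^+ 2).

Lemma derive_mass l phi v : sol l phi v -> forall x : R, 0 <= x ->
  is_derive x 1 (mass phi) (phi x ^+ 2).
Proof.
move=> s x x0; have [c1 c2] := solution_max0_cont _ _ _ s.
have c3 : continuous (fun x : R => phi (Num.max 0 x) ^+ 2).
  by move=> y; apply: (cvgM (c1 y) (c1 y)).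
by apply: derE (derive_primitive _ c3 x x0) _; rewrite max0_id.
Qed.

Lemma derive_energy l phi v : sol l phi v -> forall x : R, 0 <= x ->
  is_derive x 1 (energy phi v) ((v x - D x * phi x) ^+ 2 + (1 + x) * phi x ^+ 2).
Proof.
move=> s x x0; have [c1 c2] := solution_max0_cont _ _ _ s.
have c4 : continuous (fun x : R => v (Num.max 0 x) - D x * phi (Num.max 0 x)).
  by move=> y; apply: (@cvgB _ R^o); [exact: c2|exact: (cvgM (cD y) (c1 y))].
have c3 : continuous (fun x : R => (v (Num.max 0 x) - D x * phi (Num.max 0 x)) ^+ 2 +
    (1 + x) * phi (Num.max 0 x) ^+ 2).
  move=> y; apply: (@cvgD _ R^o); first exact: (cvgM (c4 y) (c4 y)).
  apply: cvgM; last exact: (cvgM (c1 y) (c1 y)).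
  by apply: (@cvgD _ R^o); [exact: cvg_cst|exact: cvg_id].
by apply: derE (derive_primitive _ c3 x x0) _; rewrite max0_id.
Qed.

Lemma mass_mono l phi v : sol l phi v -> forall x y : R, 0 <= x -> x <= y -> mass phi x <= mass phi y.
Proof.
move=> s x y x0 xy.
have d z : x <= z <= y -> is_derive z 1 (mass phi) (phi z ^+ 2).
  by move=> /andP[xz _]; exact: derive_mass s z (le_trans x0 xz).
have := @le_increment R _ _ _ _ x y xy (fun z _ => derC 0 z) d.
by rewrite subrr subr_ge0; apply => z _; exact: sqr_ge0.
Qed.

Lemma energy_mono l phi v : sol l phi v -> forall x y : R, 0 <= x -> x <= y -> energy phi v x <= energy phi v y.
Proof.
move=> s x y x0 xy.
have d z : x <= z <= y -> is_derive z 1 (energy phi v) ((v z - D z * phi z) ^+ 2 + (1 + z) * phi z ^+ 2).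
  by move=> /andP[xz _]; exact: derive_energy s z (le_trans x0 xz).
have := @le_increment R _ _ _ _ x y xy (fun z _ => derC 0 z) d.
rewrite subrr subr_ge0; apply => z /andP[xz _].
by rewrite addr_ge0 ?sqr_ge0// mulr_ge0 ?sqr_ge0//; lra.
Qed.

Lemma mass_gt0 l phi v : sol l phi v -> forall x : R, 0 < x -> 0 < mass phi x.
Proof.
move=> s x x0; have [x1 [d [x10 d0 H]]] := solution_pos_near0 l.
pose y := Num.min x x1.
have y0 : 0 < y by rewrite lt_min x0.
have yx : y <= x by rewrite ge_min lexx.
apply: lt_le_trans (mass_mono _ _ _ s y x (ltW y0) yx).
have d1 z : 0 <= z <= y -> is_derive z 1 (mass phi) (phi z ^+ 2).
  by move=> /andP[z0 _]; exact: derive_mass s z z0.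
have d2 z : 0 <= z <= y -> is_derive z 1 (fun t : R => 12^-1 * (t * t ^+ 2)) ((z / 2) ^+ 2).
  move=> _; apply: derE (derM _ _ _ _ _ (derC 12^-1 z) (derM _ _ _ _ _ (derI z) (derX2 _ _ _ (derI z)))) _.
  by field.
have := @le_increment R _ _ _ _ 0 y (ltW y0) d2 d1.
have m0 : mass phi 0 = 0 by exact: primitive0.
rewrite mul0r mulr0 subr0 m0 subr0 => h.
apply: lt_le_trans (h _); first by rewrite !mulr_gt0 ?invr_gt0 ?exprn_gt0.
move=> z /andP[z0 zy]; rewrite lerXn2r ?nnegrE ?divr_ge0//.
  have zz : 0 <= z <= x1 by rewrite z0 (le_trans zy)// ge_min lexx orbT.
  by apply: le_trans (H l phi v s _ z zz); rewrite ?divr_ge0// subrr normr0.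
by apply: (H l phi v s); rewrite ?subrr ?normr0// z0 (le_trans zy)// ge_min lexx orbT.
Qed.

Lemma zero_energy_le (C l a : R) phi v : sol l phi v -> 0 < a -> phi a = 0 ->
  (forall x f g : R, 0 <= x -> g ^+ 2 / 2 + (1 + x) * f ^+ 2 / 2 - C * f ^+ 2 <= form_density D E x f g) ->
  energy phi v a / 2 <= (l + C) * mass phi a.
Proof.
move=> s a0 pa coer; have [p0 v0 H] := s.
have d1 x : 0 <= x <= a -> is_derive x 1 (fun y => energy phi v y / 2)
    (((v x - D x * phi x) ^+ 2 + (1 + x) * phi x ^+ 2) / 2).
  move=> /andP[x0 _]; apply: derE (derM _ _ _ _ _ (derive_energy _ _ _ s x x0) (derC 2^-1 x)) _.
  by rewrite mulr0 addr0.
have d2 x : 0 <= x <= a -> is_derive x 1 (fun y => phi y * v y + (l + C) * mass phi y)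
    (form_density D E x (phi x) (v x - D x * phi x) + C * phi x ^+ 2).
  move=> /andP[x0 _]; have [h1 h2] := H x x0.
  apply: derE (derD _ _ _ _ _ (derM _ _ _ _ _ h1 h2)
    (derM _ _ _ _ _ (derC (l + C) x) (derive_mass _ _ _ s x x0))) _.
  by rewrite /form_density; ring.
have := @le_increment R _ _ _ _ 0 a (ltW a0) d1 d2.
rewrite p0 pa !mul0r !add0r {2}/energy primitive0 mul0r subr0 {2}/mass primitive0 mulr0 subr0; apply.
move=> x /andP[x0 _]; have := coer x (phi x) (v x - D x * phi x) x0; lra.
Qed.

(** The Riccati equation. The quotient is the logarithmic derivative of [phi] plus [D], and it is
    differentiable although [phi'] need not be. *)
Lemma derive_quotient l phi v : sol l phi v -> forall x : R, 0 <= x -> 0 < phi x ->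
  is_derive x 1 (fun y => v y / phi y) (x - l + E x - (v x / phi x - D x) ^+ 2).
Proof.
move=> [_ _ H] x x0 px; have [h1 h2] := H x x0.
have pn : phi x != 0 by rewrite gt_eqF.
apply: derE (derM _ _ _ _ _ h2 (derV _ _ _ pn h1)) _.
by field.
Qed.

(* Integrate the derivative of [(X + 1 - x)^2 rho] over [[X, X + 1]]. *)
Lemma quotient_bound (l : R) : exists2 K : R, 0 <= K & forall phi v, sol l phi v ->
  (forall x : R, 0 < x -> 0 < phi x) ->
  forall X : R, 0 < X -> - (K * (1 + X)) <= v X / phi X.
Proof.
have [C1 C10 HD] := D_small 1 ltr01; have [C2 C20 HE] := E_small 1 ltr01.
exists (C1 + C2 + `|l| + 8); first by have := normr_ge0 l; lra.
move=> phi v s pos X X0; pose rho y := v y / phi y.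
have XX : X <= X + 1 by lra.
have d1 x : X <= x <= X + 1 -> is_derive x 1 (fun y => (X + 1 - y) ^+ 2 * rho y)
   (- 2 * (X + 1 - x) * rho x + (X + 1 - x) ^+ 2 * (x - l + E x - (rho x - D x) ^+ 2)).
  move=> /andP[Xx _]; have x0 : 0 < x by lra.
  have h := derX2 _ _ _ (derB _ _ _ _ _ (derC (X + 1) x) (derI x)).
  apply: derE (derM _ _ _ _ _ h (derive_quotient _ _ _ s x (ltW x0) (pos x x0))) _.
  by rewrite /rho; ring.
pose K := (C1 + C2 + `|l| + 8) * (1 + X).
have d2 x : X <= x <= X + 1 -> is_derive x 1 (fun y => K * y) K.
  by move=> _; apply: derE (derM _ _ _ _ _ (derC K x) (derI x)) _; ring.
have := @le_increment R _ _ _ _ X (X + 1) XX d1 d2.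
rewrite subrr expr0n mul0r sub0r addrAC subrr add0r expr1n mul1r => h.
suff h' : - rho X <= K by rewrite lerNl.
rewrite [leRHS](_ : K = K * (X + 1) - K * X); last by ring.
apply: h => x /andP[Xx xX].
have x0 : 0 <= x by lra.
have := HD x x0; have := HE x x0; rewrite ler_norml => /andP[e1 e2] dd.
have := ler_norm l; have := ler_norm (- l); rewrite normrN => l1 l2.
set h1 := X + 1 - x; set r := rho x - D x.
have h10 : 0 <= h1 by rewrite /h1; lra.
have h11 : h1 <= 1 by rewrite /h1; lra.
(* The square of [h1 * r + 1] absorbs the term linear in [rho], on which no bound is available. *)
have s1 := sqr_ge0 (h1 * r + 1); have s2 := sqr_ge0 (1 - h1 * - D x); have s3 := sqr_ge0 (D x).
have hh : h1 ^+ 2 <= 1 by rewrite expr_le1.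
have hh0 := sqr_ge0 h1.
have t1 : h1 ^+ 2 * (x - l + E x) <= 2 * x + 1 + `|l| + C2.
  apply: (@le_trans _ _ (h1 ^+ 2 * (2 * x + 1 + `|l| + C2))).
    by rewrite ler_wpM2l//; lra.
  by rewrite ler_piMl//; lra.
have t2 : h1 ^+ 2 * D x ^+ 2 <= 1 + x + C1.
  by apply: (@le_trans _ _ (D x ^+ 2)); [rewrite ler_piMl|lra].
have t3 : (1 - h1 * - D x) ^+ 2 = 1 + 2 * (h1 * D x) + h1 ^+ 2 * D x ^+ 2 by ring.
have t4 : - 2 * h1 * rho x + h1 ^+ 2 * (x - l + E x - r ^+ 2) =
    - (h1 * r + 1) ^+ 2 + 1 - 2 * (h1 * D x) + h1 ^+ 2 * (x - l + E x) by rewrite /r; ring.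
have Kge : C1 + C2 + `|l| + 8 * (1 + X) <= K.
  have : 0 <= (C1 + C2 + `|l|) * X by rewrite mulr_ge0//; have := normr_ge0 l; lra.
  by rewrite /K; lra.
rewrite t4; lra.
Qed.

(** The Riccati equation is tested against [h ^ 2], where [h] vanishes at both ends of [[1, 2]]:
    this bounds [l] by the Rayleigh quotient of [h]. The integral of [h ^ 2] is [1 / 30]. *)
Lemma positive_solution_bound : exists K : R, forall l phi v, sol l phi v ->
  (forall x : R, 0 < x -> 0 < phi x) -> l <= K.
Proof.
have [K1 K11 DK] := continuous_norm_bounded D 2 cD.
have [K2 K21 EK] := continuous_norm_bounded E 2 cE.
exists (30 * (3 + 2 * K1 + K2)) => l phi v s pos.
pose rho y := v y / phi y; pose h (y : R) := (y - 1) * (2 - y).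
pose K := 3 + 2 * K1 + K2.
(* The polynomial multiplied by [l] is the primitive of [h ^ 2], in powers of [y - 1]. *)
have d1 (x : R) : 1 <= x <= 2 -> is_derive x 1 (fun y => h y ^+ 2 * rho y +
    l * (3^-1 * ((y - 1) * (y - 1) ^+ 2) - 2^-1 * ((y - 1) ^+ 2 * (y - 1) ^+ 2) +
         5^-1 * ((y - 1) * ((y - 1) ^+ 2 * (y - 1) ^+ 2))))
   (2 * h x * (3 - 2 * x) * rho x + h x ^+ 2 * (x + E x - (rho x - D x) ^+ 2)).
  move=> /andP[x1 _]; have x0 : 0 < x by lra.
  have t : is_derive x 1 (fun y : R => y - 1) 1.
    by apply: derE (derB _ _ _ _ _ (derI x) (derC 1 x)) _; rewrite subr0.
  have t2 : is_derive x 1 (fun y : R => (y - 1) ^+ 2) (2 * (x - 1)).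
    by apply: derE (derX2 _ _ _ t) _; ring.
  have dh : is_derive x 1 h (3 - 2 * x).
    by apply: derE (derM _ _ _ _ _ t (derB _ _ _ _ _ (derC 2 x) (derI x))) _; ring.
  have p1 := derM _ _ _ _ _ (derC 3^-1 x) (derM _ _ _ _ _ t t2).
  have p2 := derM _ _ _ _ _ (derC 2^-1 x) (derM _ _ _ _ _ t2 t2).
  have p3 := derM _ _ _ _ _ (derC 5^-1 x) (derM _ _ _ _ _ t (derM _ _ _ _ _ t2 t2)).
  have p4 := derM _ _ _ _ _ (derC l x) (derD _ _ _ _ _ (derB _ _ _ _ _ p1 p2) p3).
  apply: derE (derD _ _ _ _ _ (derM _ _ _ _ _ (derX2 _ _ _ dh)
    (derive_quotient _ _ _ s x (ltW x0) (pos x x0))) p4) _.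
  by rewrite -/(rho x) /h; move: (rho x) => r; field.
have d2 (x : R) : 1 <= x <= 2 -> is_derive x 1 (fun y => K * y) K.
  by move=> _; apply: derE (derM _ _ _ _ _ (derC K x) (derI x)) _; ring.
have := @le_increment R _ _ _ _ 1 2 (ler1n R 2) d1 d2.
have -> : h 1 = 0 by rewrite /h; ring.
have -> : h 2 = 0 by rewrite /h; ring.
have -> : K * 2 - K * 1 = K by ring.
have -> : 0 ^+ 2 * rho 2 + l * (3^-1 * ((2 - 1) * (2 - 1) ^+ 2) - 2^-1 * ((2 - 1) ^+ 2 * (2 - 1) ^+ 2) +
         5^-1 * ((2 - 1) * ((2 - 1) ^+ 2 * (2 - 1) ^+ 2))) -
  (0 ^+ 2 * rho 1 + l * (3^-1 * ((1 - 1) * (1 - 1) ^+ 2) - 2^-1 * ((1 - 1) ^+ 2 * (1 - 1) ^+ 2) +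
         5^-1 * ((1 - 1) * ((1 - 1) ^+ 2 * (1 - 1) ^+ 2)))) = l / 30 by field.
move=> H; suff : l / 30 <= K by rewrite ler_pdivrMr// mulrC.
apply: H => x /andP[x1 x2].
have x02 : 0 <= x <= 2 by rewrite x2; lra.
have := DK x x02; have := EK x x02; rewrite !ler_norml => /andP[e1 e2] /andP[q1 q2].
set r := rho x - D x; set h' := 3 - 2 * x.
have hx0 : 0 <= h x by rewrite /h mulr_ge0//; lra.
have hx1 : h x <= 1.
  have := sqr_ge0 (x - 3 / 2); have -> : (x - 3 / 2) ^+ 2 = 4^-1 - h x by rewrite /h; field.
  lra.
have s1 := sqr_ge0 (h' - h x * r).
have h2 : h x ^+ 2 <= 1 by rewrite expr_le1.
have h20 := sqr_ge0 (h x).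
have a1 : h' ^+ 2 <= 1 by rewrite /h'; nra.
have a2 : h x * h' * D x <= K1.
  apply: (@le_trans _ _ `|h x * h' * D x|); first exact: ler_norm.
  rewrite normrM -[leRHS]mul1r ler_pM//; last by rewrite ler_norml q1.
  by rewrite normrM mulr_ile1//; rewrite ler_norml /h'; apply/andP; split; lra.
have a3 : h x ^+ 2 * (x + E x) <= 2 + K2.
  apply: (@le_trans _ _ (h x ^+ 2 * (2 + K2))); first by rewrite ler_wpM2l//; lra.
  by rewrite ler_piMl//; lra.
have -> : 2 * h x * h' * rho x + h x ^+ 2 * (x + E x - r ^+ 2) =
   - (h' - h x * r) ^+ 2 + h' ^+ 2 + 2 * (h x * h' * D x) + h x ^+ 2 * (x + E x).
  by rewrite /r; ring.
rewrite /K; lra.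
Qed.

Lemma energy_mass_continuous (l0 X e : R) phi0 v0 : sol l0 phi0 v0 -> 0 <= X -> 0 < e ->
  exists2 d : R, 0 < d & forall l phi v, sol l phi v -> `|l - l0| < d ->
    `|energy phi v X - energy phi0 v0 X| <= e /\ `|mass phi X - mass phi0 X| <= e.
Proof.
move=> s0 X0 e0.
have [c1 c2] := solution_max0_cont _ _ _ s0.
have c3 : continuous (fun x : R => v0 (Num.max 0 x) - D x * phi0 (Num.max 0 x)).
  by move=> y; apply: (@cvgB _ R^o); [exact: c2|exact: (cvgM (cD y) (c1 y))].
have [B1 B11 HB1] := continuous_norm_bounded _ X c1.
have [B2 B21 HB2] := continuous_norm_bounded _ X c3.
have [K K1 DK] := continuous_norm_bounded D X cD.
pose B := B1 + B2; pose k := 1 + K; pose Z := (2 * B + 1) * (k + 1 + X) * (X + 1).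
have k0 : 0 < k by rewrite /k; lra.
have Z0 : 0 < Z by rewrite !mulr_gt0// /B /k; lra.
(* The first bound keeps all differences below [1], so that squares differ by at most [2 * B + 1]
   times the difference; the second makes the integrated error at most [e]. *)
pose eta := Num.min k^-1 (e / Z).
have eta0 : 0 < eta by rewrite lt_min invr_gt0 k0 divr_gt0.
have etak : k * eta <= 1 by rewrite mulrC -ler_pdivlMr// div1r ge_min lexx.
have etaZ : eta * Z <= e by rewrite -ler_pdivlMr// ge_min lexx orbT.
have [d d0 Hd] := schroedinger_solution_continuous D E cD cE l0 X eta phi0 v0 s0 X0 eta0.
exists d => // l phi v s ld.
have sq (a b : R) (t : R) : 0 <= t -> t <= 1 -> `|b| <= B -> `|a - b| <= t ->
    `|a ^+ 2 - b ^+ 2| <= t * (2 * B + 1).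
  move=> t0 t1 bB ab; rewrite subr_sqr normrM ler_pM//.
  have -> : a + b = (a - b) + 2 * b by ring.
  apply: le_trans (ler_normD _ _) _; rewrite normrM ger0_norm//; lra.
pose c := (2 * B + 1) * (k + 1 + X) * eta.
have ptw x : 0 <= x <= X ->
    `|((v x - D x * phi x) ^+ 2 + (1 + x) * phi x ^+ 2) -
      ((v0 x - D x * phi0 x) ^+ 2 + (1 + x) * phi0 x ^+ 2)| <= c /\
    `|phi x ^+ 2 - phi0 x ^+ 2| <= c.
  move=> xX; have /andP[x0 x1] := xX; have [h1 h2] := Hd l phi v s ld x xX.
  have := HB1 x xX; have := HB2 x xX; rewrite max0_id// => hb2 hb1.
  have eta1 : eta <= 1.
    by apply: le_trans etak; rewrite ler_peMl ?(ltW eta0)// /k; lra.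
  have p1 : `|phi x ^+ 2 - phi0 x ^+ 2| <= eta * (2 * B + 1).
    by apply: sq => //; [exact: ltW|rewrite /B; lra].
  have p2 : `|(v x - D x * phi x) ^+ 2 - (v0 x - D x * phi0 x) ^+ 2| <= k * eta * (2 * B + 1).
    apply: sq => //; [by rewrite mulr_ge0// ltW|by rewrite /B; lra|].
    have -> : v x - D x * phi x - (v0 x - D x * phi0 x) = (v x - v0 x) - D x * (phi x - phi0 x) by ring.
    apply: le_trans (ler_normB _ _) _; rewrite normrM /k mulrDl mul1r lerD// ler_pM//.
    exact: DK.
  have eb : 0 <= eta * (2 * B + 1) by rewrite mulr_ge0 ?(ltW eta0)// /B; lra.
  have cE1 : c = k * eta * (2 * B + 1) + (1 + X) * (eta * (2 * B + 1)) by rewrite /c; ring.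
  split; last first.
    have : 0 <= (k + X) * (eta * (2 * B + 1)) by rewrite mulr_ge0//; lra.
    by move=> h; rewrite (_ : c = (k + X) * (eta * (2 * B + 1)) + eta * (2 * B + 1)); [lra|rewrite /c; ring].
  have -> : ((v x - D x * phi x) ^+ 2 + (1 + x) * phi x ^+ 2) -
      ((v0 x - D x * phi0 x) ^+ 2 + (1 + x) * phi0 x ^+ 2) =
      ((v x - D x * phi x) ^+ 2 - (v0 x - D x * phi0 x) ^+ 2) + (1 + x) * (phi x ^+ 2 - phi0 x ^+ 2) by ring.
  apply: le_trans (ler_normD _ _) _; rewrite cE1 lerD// normrM ger0_norm; last lra.
  by rewrite ler_pM//; lra.
have cXe : c * X <= e.
  apply: le_trans etaZ; rewrite /c /Z.
  have -> : eta * ((2 * B + 1) * (k + 1 + X) * (X + 1)) =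
    (2 * B + 1) * (k + 1 + X) * eta * X + (2 * B + 1) * (k + 1 + X) * eta by ring.
  by rewrite lerDl !mulr_ge0 ?(ltW eta0)// /B; lra.
have main (F F0 f f0 : R -> R) : F 0 = 0 -> F0 0 = 0 ->
    (forall x : R, 0 <= x -> is_derive x 1 F (f x)) ->
    (forall x : R, 0 <= x -> is_derive x 1 F0 (f0 x)) ->
    (forall x : R, 0 <= x <= X -> `|f x - f0 x| <= c) -> `|F X - F0 X| <= e.
  move=> F00 F000 dF dF0 ff0.
  have dd x : 0 <= x <= X -> is_derive x 1 (fun y => F y - F0 y) (f x - f0 x).
    by move=> /andP[x0 _]; apply: derB; [exact: dF|exact: dF0].
  have dl (t x : R) : 0 <= x <= X -> is_derive x 1 (fun y : R => t * y) t.
    by move=> _; apply: derE (derM _ _ _ _ _ (derC t x) (derI x)) _; ring.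
  have h1 := @le_increment R _ _ _ _ 0 X X0 dd (dl c).
  have h2 := @le_increment R _ _ _ _ 0 X X0 (dl (- c)) dd.
  move: h1 h2; rewrite F00 F000 !mulr0 !subr0 => h1 h2.
  apply: le_trans cXe; rewrite ler_norml -mulNr; apply/andP; split.
    by apply: h2 => x /ff0; rewrite ler_norml => /andP[].
  by apply: h1 => x /ff0; rewrite ler_norml => /andP[].
split.
  apply: (main (energy phi v) (energy phi0 v0) _ _ (primitive0 _) (primitive0 _)
    (derive_energy _ _ _ s) (derive_energy _ _ _ s0)) => x xX.
  by have [] := ptw x xX.
apply: (main (mass phi) (mass phi0) _ _ (primitive0 _) (primitive0 _)
    (derive_mass _ _ _ s) (derive_mass _ _ _ s0)) => x xX.
by have [] := ptw x xX.
Qed.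

(** Beyond [a] the confining weight [1 + x] is at least [t]; this prevents mass from escaping to
    infinity. *)
Lemma energy_ge_mass l phi v (a b t : R) : sol l phi v -> 0 <= a -> a <= b -> t <= 1 + a ->
  t * (mass phi b - mass phi a) <= energy phi v b - energy phi v a.
Proof.
move=> s a0 ab ta.
have d1 x : a <= x <= b -> is_derive x 1 (fun y => t * mass phi y) (t * phi x ^+ 2).
  move=> /andP[ax _]; apply: derE (derM _ _ _ _ _ (derC t x) (derive_mass _ _ _ s x (le_trans a0 ax))) _.
  by rewrite mul0r add0r.
have d2 x : a <= x <= b -> is_derive x 1 (energy phi v) ((v x - D x * phi x) ^+ 2 + (1 + x) * phi x ^+ 2).
  by move=> /andP[ax _]; exact: derive_energy s x (le_trans a0 ax).
have := @le_increment R _ _ _ _ a b ab d1 d2; rewrite -mulrBr; apply => x /andP[ax _].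
rewrite -[leLHS]add0r lerD ?sqr_ge0// ler_wpM2r ?sqr_ge0//; lra.
Qed.

Lemma nonpositive_zero l phi v (Y x : R) : sol l phi v -> 0 < Y ->
  (forall z : R, 0 < z <= Y -> 0 < phi z) -> 0 < x -> phi x <= 0 ->
  exists2 a : R, Y < a & phi a = 0.
Proof.
move=> s Y0 pos x0 px.
have Yx : Y < x.
  by rewrite ltNge; apply/negP => xY; have := pos x; rewrite x0 xY ltNge px => /(_ isT).
have pY : 0 < phi Y by apply: pos; rewrite Y0/=.
have [||a] := @IVT R phi Y x 0 (ltW Yx).
- apply/continuous_in_subspaceT => z; rewrite inE/= in_itv/= => /andP[zz _].
  by have [] := solution_cont _ _ _ s z (le_trans (ltW Y0) zz).
- by rewrite ge_min px orbT/= le_max ltW.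
rewrite in_itv/= => /andP[Ya _] pa; exists a => //.
rewrite lt_neqAle Ya andbT; apply/eqP => Ya'; move: pY.
by rewrite Ya' pa ltxx.
Qed.

Lemma ground_state_exists : exists (l : R) (phi v : R -> R) (M : R), [/\ sol l phi v,
  forall x : R, 0 < x -> 0 < phi x & forall X : R, 0 <= X -> energy phi v X <= M].
Proof.
have [C C0 coer] := form_density_coercive D E D_small E_small.
pose S : set R := [set l | exists phi v, sol l phi v /\ forall x : R, 0 < x -> 0 < phi x].
have zeroE l phi v a : sol l phi v -> 0 < a -> phi a = 0 ->
    energy phi v a / 2 <= (l + C) * mass phi a.
  by move=> s a0 pa; exact: zero_energy_le s a0 pa coer.
have mass0 phi : mass phi 0 = 0 by exact: primitive0.
have energy0 phi v : energy phi v 0 = 0 by exact: primitive0.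
have supS : has_sup S.
  split; last first.
    have [K HK] := positive_solution_bound.
    by exists K => l [phi [v [s pos]]]; exact: HK s pos.
  (* For this value a zero of [phi] would force the energy up to it to be negative. *)
  exists (- C - 1); have [phi [v s]] := schroedinger_solution_exists D E cD cE (- C - 1).
  exists phi, v; split => // x x0; rewrite ltNge; apply/negP => px.
  have [x1 [d [x10 d0 H]]] := solution_pos_near0 (- C - 1).
  have pos z : 0 < z <= x1 -> 0 < phi z.
    move=> /andP[z0 z1]; have zz : 0 <= z <= x1 by rewrite ltW.
    have := H _ _ _ s _ z zz; rewrite subrr normr0 => /(_ d0); lra.
  have [a x1a pa] := nonpositive_zero _ _ _ x1 x s x10 pos x0 px.
  have a0 : 0 < a by lra.
  have h1 := zeroE _ _ _ _ s a0 pa.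
  have h2 := mass_gt0 _ _ _ s a a0.
  have : 0 <= energy phi v a.
    by rewrite -(energy0 phi v); apply: (energy_mono _ _ _ s) => //; exact: ltW.
  by move: h1; rewrite (_ : - C - 1 + C = -1); [lra|ring].
pose L0 := sup S.
have [phi0 [v0 s0]] := schroedinger_solution_exists D E cD cE L0.
have pos0 : forall x : R, 0 < x -> 0 < phi0 x.
  apply: (solution_pos_limit L0 phi0 v0 s0) => d d0.
  have [l Sl Ll] := sup_adherent d0 supS.
  have lL : l <= L0 by apply: ub_le_sup => //; exact: supS.2.
  have [phi [v [s pos]]] := Sl.
  exists l, phi, v; split => //; rewrite distrC ger0_norm ?subr_ge0//.
  by rewrite -/L0 in Ll; lra.
pose M := `|L0| + 2 + C.
have M0 : 0 < M by rewrite /M; have := normr_ge0 L0; lra.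
(* Up to a zero [a] the energy is at most [2 * M] times the mass, while mass beyond [X0] costs at
   least [1 + 4 * M] per unit. Hence at least half of the mass on [[0, a]] lies in [[0, X0]]. *)
pose X0 := 4 * M; have X00 : 0 < X0 by rewrite /X0; lra.
(* The energy up to [a] is at most [2 * M] times the mass, hence at most [4 * M] times the mass on
   [[0, X0]]. The [1] pays for two errors of [1 / 2], in the energy and in the mass, on replacing
   [phi] by [phi0]. *)
exists L0, phi0, v0, (4 * M * mass phi0 X0 + 1); split => // X XX.
rewrite leNgt; apply/negP => big.
pose Y := Num.max X X0.
have Y0 : 0 < Y by rewrite lt_max X00 orbT.
have [d1 d10 H1] := solution_pos_stable L0 Y phi0 v0 s0 Y0 (fun x h => pos0 x (proj1 (andP h))).
have e2 : 0 < 2^-1 :> R by rewrite invr_gt0.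
have [d2 d20 H2] := energy_mass_continuous L0 X 2^-1 phi0 v0 s0 XX e2.
have e8 : 0 < (8 * M)^-1 by rewrite invr_gt0; lra.
have [d3 d30 H3] := energy_mass_continuous L0 X0 (8 * M)^-1 phi0 v0 s0 (ltW X00) e8.
pose d := Num.min 1 (Num.min d1 (Num.min d2 d3)).
have d0 : 0 < d by rewrite !lt_min ltr01 d10 d20.
(* Above the supremum the solution is not positive; by stability its zero lies beyond [Y]. *)
pose l := L0 + d / 2.
have ld : `|l - L0| < d by rewrite /l addrAC subrr add0r ger0_norm; lra.
have := ld; rewrite /d !lt_min => /and4P[ld0 ld1 ld2 ld3].
have [phi [v s]] := schroedinger_solution_exists D E cD cE l.
have [x x0 px] : exists2 x : R, 0 < x & phi x <= 0.
  apply: contrapT => h.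
  have : S l.
    exists phi, v; split => // x x0; rewrite ltNge; apply/negP => px.
    by apply: h; exists x.
  move=> /(ub_le_sup supS.2); rewrite -/L0 /l; lra.
have [a Ya pa] := nonpositive_zero _ _ _ Y x s Y0 (H1 _ _ _ s ld1) x0 px.
have Xa : X < a by apply: le_lt_trans Ya; rewrite le_max lexx.
have X0a : X0 < a by apply: le_lt_trans Ya; rewrite le_max lexx orbT.
have a0 : 0 < a by lra.
have h1 := zeroE _ _ _ _ s a0 pa.
have m0 := mass_gt0 _ _ _ s a a0.
have lM : l + C <= M.
  by move: ld0; rewrite ltr_norml => /andP[_]; rewrite /M; have := ler_norm L0; lra.
have h2 : energy phi v a / 2 <= M * mass phi a.
  by apply: le_trans h1 _; rewrite ler_pM2r.
have h3 := energy_ge_mass _ _ _ X0 a (1 + X0) s (ltW X00) (ltW X0a) (lexx _).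
have h4 : 0 <= energy phi v X0.
  by rewrite -(energy0 phi v); apply: (energy_mono _ _ _ s) => //; exact: ltW.
have h5 := energy_mono _ _ _ s X a XX (ltW Xa).
have mX0 := mass_gt0 _ _ _ s X0 X00.
have h6 : mass phi a <= 2 * mass phi X0.
  move: h2 h3 h4 mX0 M0.
  move: (energy phi v a) (energy phi v X0) (mass phi a) (mass phi X0) => ea eX ma mX.
  rewrite /X0; move: (M); clear => M h2 h3 h4 mX0 M0.
  have t1 : (1 + 4 * M) * (ma - mX) <= 2 * (M * ma) by lra.
  have t2 : (1 + 2 * M) * ma <= (1 + 2 * M) * (2 * mX) by lra.
  by move: t2; rewrite ler_pM2l//; lra.
have [h7 _] := H2 _ _ _ s ld2.
have [_ h8] := H3 _ _ _ s ld3.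
move: h7 h8; rewrite !ler_norml => /andP[h7 _] /andP[_ h8].
have h9 : 4 * M * mass phi X0 <= 4 * M * mass phi0 X0 + 2^-1.
  have : 4 * M * (mass phi X0 - mass phi0 X0) <= 4 * M * (8 * M)^-1.
    by rewrite ler_pM2l//; lra.
  have -> : 4 * M * (8 * M)^-1 = 2^-1 by field; rewrite ?mulf_neq0// gt_eqF.
  by rewrite mulrBr; lra.
have h10 : M * mass phi a <= M * (2 * mass phi X0) by rewrite ler_pM2l.
lra.
Qed.

End ground_state.

(** * The quadratic form on [L^*] *)

Lemma lipschitz_abs_continuous_on {R : realType} (a c K : R) (f : R -> R) :
  (forall x y, a <= x -> x <= y -> y <= c -> `|f y - f x| <= K * (y - x)) ->
  abs_continuous_on a c f.
Proof.
move=> fK e e0.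
have K1 : 0 < `|K| + 1 by rewrite ltr_wpDl.
exists (e / (`|K| + 1)); first exact: divr_gt0.
move=> n u v uv _; rewrite ltr_pdivlMr// => h; apply: le_lt_trans h.
rewrite mulrC mulr_sumr; apply: ler_sum => i _.
have [au uv' vc] := uv i.
apply: le_trans (fK _ _ au uv' vc) _; apply: ler_wpM2r; first by rewrite subr_ge0.
have := ler_norm K; lra.
Qed.

Lemma abs_continuous_on_mul {R : realType} (a c M : R) (f g : R -> R) :
  (forall x, a <= x <= c -> `|f x| <= M) -> (forall x, a <= x <= c -> `|g x| <= M) ->
  abs_continuous_on a c f -> abs_continuous_on a c g ->
  abs_continuous_on a c (fun x => f x * g x).
Proof.
move=> fM gM acf acg e e0.
have M1 : 0 < `|M| + 1 by rewrite ltr_wpDl.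
have e1 : 0 < e / (2 * (`|M| + 1)) by rewrite divr_gt0// mulr_gt0.
have [r r0 Hf] := acf _ e1; have [s s0 Hg] := acg _ e1.
exists (Num.min r s); first by rewrite lt_min r0.
move=> n u v uv tuv; rewrite lt_min => /andP[h1 h2].
have := Hg n u v uv tuv h2; have := Hf n u v uv tuv h1.
rewrite !ltr_pdivlMr ?mulr_gt0// => hf hg.
apply: (@le_lt_trans _ _ ((`|M| + 1) * (\sum_(i < n) `|f (v i) - f (u i)|) +
  (`|M| + 1) * (\sum_(i < n) `|g (v i) - g (u i)|))); last by lra.
rewrite !mulr_sumr -big_split; apply: ler_sum => i _ /=.
have [au uv' vc] := uv i.
rewrite (_ : f (v i) * g (v i) - f (u i) * g (u i) =
  g (v i) * (f (v i) - f (u i)) + f (u i) * (g (v i) - g (u i))); last by ring.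
have hM := ler_norm M.
apply: le_trans (ler_normD _ _) _; rewrite !normrM lerD// ler_wpM2r//.
  by have := gM (v i); rewrite vc (le_trans au)// => /(_ isT); lra.
by have := fM (u i); rewrite au (le_trans uv')// => /(_ isT); lra.
Qed.

Lemma derivable_lipschitz {R : realType} (a c K : R) (F f : R -> R) :
  (forall x, a <= x <= c -> is_derive x 1 F (f x)) ->
  (forall x, a <= x <= c -> `|f x| <= K) ->
  forall x y, a <= x -> x <= y -> y <= c -> `|F y - F x| <= K * (y - x).
Proof.
move=> dF fK x y ax xy yc.
have sub (z : R) : x <= z <= y -> a <= z <= c.
  by case/andP => h1 h2; rewrite (le_trans ax h1) (le_trans h2 yc).
have dK (k z : R) : is_derive z 1 (fun t => k * t) k.
  by apply: derE (derM (fun=> k) (fun t => t) z 0 1 _ _) _; ring.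
rewrite ler_norml; apply/andP; split.
  have := @le_increment R (fun t => - K * t) F (fun=> - K) f x y xy (fun z _ => dK _ z).
  have h (z : R) : x <= z <= y -> - K <= f z.
    by move=> /sub /fK; rewrite ler_norml => /andP[].
  by move=> /(_ (fun z zxy => dF z (sub z zxy)) h); lra.
have := @le_increment R F (fun t => K * t) f (fun=> K) x y xy (fun z zxy => dF z (sub z zxy)).
have h (z : R) : x <= z <= y -> f z <= K.
  by move=> /sub /fK; rewrite ler_norml => /andP[].
by move=> /(_ (fun z _ => dK _ z) h); lra.
Qed.

Lemma abs_continuous_on_increment_le {R : realType} (a c : R) (N : set R) (H q : R -> R) :
  a <= c -> abs_continuous_on a c H ->
  measurable N -> @lebesgue_measure R N = 0%E ->
  (forall x : R, a < x < c -> ~ N x -> exists2 l, is_derive x 1 H l & l <= q x) ->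
  (@lebesgue_measure R).-integrable `[a, c] (EFin \o q) ->
  H c - H a <= \int[lebesgue_measure]_(x in `[a, c]) q x.
Proof.
move=> ac acH mN N0 HN iq.
have [h [ih hE hae]] := abs_continuous_on_FTC a c H ac acH.
have [N2 [mN2 N20 N2P]] := hae.
pose N' := N `|` N2 `|` [set a] `|` [set c].
have mN' : measurable N' by do 3 apply: measurableU => //.
have N'0 : @lebesgue_measure R N' = 0%E.
  by rewrite /N' !measureU0//; try exact: lebesgue_measure_set1; do ?apply: measurableU.
have hq (x : R) : `[a, c]%classic x -> ~ N' x -> h x <= q x.
  rewrite /= in_itv/= => /andP[ax xc] Nx.
  have xac : a < x < c.
    rewrite !lt_neqAle ax xc !andbT; apply/andP; split; apply/eqP => xE; apply: Nx.
      by left; right; rewrite /= xE.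
    by right; rewrite /= xE.
  have [l Hl lq] : exists2 l, is_derive x 1 H l & l <= q x.
    by apply: HN => // Nx'; apply: Nx; left; left; left.
  have Hh : is_derive x 1 H (h x).
    apply: contrapT => nh; apply: Nx; left; left; right; apply: N2P => /= h3; exact/nh/h3.
  by have -> : h x = l by have [_ <-] := Hh; have [_ <-] := Hl.
have ihac : (@lebesgue_measure R).-integrable `[a, c] (EFin \o h) by exact: integrableS ih.
have eqm (x : R) : `[a, c]%classic x -> ~ N' x -> (h x)%:E = (Num.min (h x) (q x))%:E.
  by move=> xac Nx; rewrite min_l// hq.
(* Passing from [h] to [min h q], equal off a null set, turns an inequality almost everywhere into a
   pointwise one. *)
have -> : H c - H a = \int[lebesgue_measure]_(x in `[a, c]) Num.min (h x) (q x).
  rewrite /Rintegral -(integral_off_null (@lebesgue_measure R) N' _ (fun x => (h x)%:E) _ mN' N'0 eqm).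
  by rewrite (hE a c)//.
apply: le_Rintegral => //; last by move=> x _; rewrite ge_min lexx orbT.
have mhac := measurable_int _ ihac; have mqac := measurable_int _ iq.
apply: ae_eq_integrable ihac => //.
  by apply/measurable_EFinP; apply: measurable_minr; apply/measurable_EFinP.
exists N'; split => // x /= /not_implyP[xac hx]; apply: contrapT => Nx; apply: hx; exact: eqm.
Qed.

(** The integral of [|h|] is the supremum of its integrals over the intervals [[0, n + 1]], so its
    tail beyond some [n + 1] is below [e]. *)
Lemma integral_itv0y_tail {R : realType} (h : R -> R) : measurable_fun setT h ->
  (@lebesgue_measure R).-integrable `[0, +oo[ (EFin \o h) ->
  forall e, 0 < e -> exists2 M, 0 <= M & forall X, M <= X ->
    `|\int[lebesgue_measure]_(x in `[0, +oo[) h x - \int[lebesgue_measure]_(x in `[0, X]) h x| < e.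
Proof.
move=> mh ih e e0.
have ik : (@lebesgue_measure R).-integrable `[0, +oo[ (EFin \o (fun x => `|h x|)).
  exact: (integrable_norm ih).
have mk : measurable_fun setT (fun x : R => `|h x|) by exact: measurableT_comp.
have := @ge0_integral_ereal_sup R lebesgue_measure (fun x => `|h x|) (fun x => normr_ge0 _) mk.
set S := [set _ | _ in _] => SE.
have fS : ereal_sup S \is a fin_num by rewrite -SE; exact: integrable_fin_num.
have [_ [n _ <-]] := ub_ereal_sup_adherent e0 fS.
rewrite -SE => hn.
exists n.+1%:R => // X nX.
have ihX : (@lebesgue_measure R).-integrable `[0, X] (EFin \o h).
  by apply: integrableS ih => //; exact: subset_itvl.
have X0 : 0 <= X by apply: le_trans nX.
rewrite Rintegral_itvB//.
have ikn : (@lebesgue_measure R).-integrable `]X, +oo[ (EFin \o (fun x => `|h x|)).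
  by apply: integrableS ik => //; apply: subset_itvr; rewrite bnd_simp.
have ihn : (@lebesgue_measure R).-integrable `]X, +oo[ (EFin \o h).
  by apply: integrableS ih => //; apply: subset_itvr; rewrite bnd_simp.
apply: le_lt_trans (le_normr_Rintegral _ ihn) _ => //.
rewrite -(@Rintegral_itvB R (fun x => `|h x|) (BLeft 0) (BInfty _ false) X)//.
rewrite ltrBlDr -ltrBlDl.
apply: (@lt_le_trans _ _ (\int[lebesgue_measure]_(x in `[0, n.+1%:R]) `|h x|)).
  rewrite -lte_fin EFinB /Rintegral !fineK//.
    by apply: integrable_fin_num => //; apply: integrableS ik => //; exact: subset_itvl.
  exact: integrable_fin_num.
rewrite /Rintegral fine_le//.
- by apply: integrable_fin_num => //; apply: integrableS ik => //; exact: subset_itvl.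
- by apply: integrable_fin_num => //; apply: integrableS ik => //; exact: subset_itvl.
apply: ge0_subset_integral => //=.
- by apply/measurable_EFinP; exact: measurable_funTS.
- by apply: subset_itvl; rewrite bnd_simp.
Qed.

(** An integrable function need not tend to zero, but it cannot stay above [e] on a unit interval
    far out. Boundary terms at infinity are removed along such points [X]. *)
Lemma integrable_itv0y_small {R : realType} (k : R -> R) : measurable_fun setT k ->
  (@lebesgue_measure R).-integrable `[0, +oo[ (EFin \o k) ->
  forall e M, 0 < e -> 0 <= M -> exists2 X, M <= X & k X < e.
Proof.
move=> mk ik e M e0 M0.
have e20 : 0 < e / 2 by lra.
have [X X0 HX] := integral_itv0y_tail k mk ik _ e20.
pose Y := Num.max X M.
have [XY MY] : X <= Y /\ M <= Y by rewrite !le_max !lexx orbT.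
have Y0 := le_trans M0 MY.
apply: contrapT => nk.
have kge (x : R) : `]Y, Y + 1]%classic x -> e <= k x.
  rewrite /= in_itv/= => /andP[Yx _]; rewrite leNgt; apply/negP => kx; apply: nk.
  by exists x => //; apply: le_trans MY _; exact: ltW.
have ikY1 : (@lebesgue_measure R).-integrable `[0, Y + 1] (EFin \o k).
  by apply: integrableS ik => //; exact: subset_itvl.
have ikY : (@lebesgue_measure R).-integrable `]Y, Y + 1] (EFin \o k).
  by apply: integrableS ikY1 => //; apply: subset_itvr; rewrite bnd_simp.
have XY1 : X <= Y + 1 by lra.
have := HX _ XY; have := HX _ XY1.
rewrite !ltr_norml => /andP[h1 h2] /andP[h3 h4].
have := @Rintegral_itvB R k (BLeft 0) (BRight (Y + 1)) Y ikY1.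
rewrite !bnd_simp Y0 lerDl ler01 => /(_ isT isT) h5.
have : \int[lebesgue_measure]_(x in `]Y, Y + 1]) e <= \int[lebesgue_measure]_(x in `]Y, Y + 1]) k x.
  apply: le_Rintegral => //.
  have : (@lebesgue_measure R).-integrable `[Y, Y + 1] (EFin \o (fun=> e)).
    apply: continuous_compact_integrable; first exact: segment_compact.
    by apply: continuous_subspaceT => x; exact: cvg_cst.
  by apply: integrableS => //; apply: subset_itvr; rewrite bnd_simp.
have -> : \int[lebesgue_measure]_(x in `]Y, Y + 1]) e = e.
  rewrite (@Rintegral_cst _ _ R (@lebesgue_measure R) _ (measurable_itv _) e).
  have m1 : lebesgue_measure (`]Y, Y + 1]%classic : set R) = 1%:E.
    by rewrite lebesgue_measure_itv/= lte_fin ltrDl ltr01 -EFinB addrAC subrr add0r.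
  by apply: eq_trans (congr1 (fun t => e * fine t) m1) _; rewrite mulr1.
by rewrite -h5; lra.
Qed.

Lemma integrable_itv0y_bounded {R : realType} (k : R -> R) (M : R) :
  (forall x, 0 <= k x) -> measurable_fun setT k ->
  (forall X, 0 <= X -> (\int[lebesgue_measure]_(x in `[0%R, X]) (k x)%:E <= M%:E)%E) ->
  (@lebesgue_measure R).-integrable `[0, +oo[ (EFin \o k).
Proof.
move=> k0 mk kM; apply/integrableP; split.
  by apply/measurable_EFinP; exact: measurable_funTS.
under eq_integral do rewrite /= ger0_norm//.
rewrite ge0_integral_ereal_sup//; apply: (@le_lt_trans _ _ M%:E); last exact: ltry.
by apply: ge_ereal_sup => _ /= [n _ <-]; exact: kM.
Qed.

Lemma L2norm_eq1 {R : realType} (f : R -> R) :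
  L2norm f = 1%E <-> (\int[lebesgue_measure]_(x in `[0%R, +oo[) (f (Num.max 0 x) ^+ 2)%:E = 1)%E.
Proof.
have E : (\int[lebesgue_measure]_x (`| (EFin \o (f \_ `[0%R, +oo[)) x | `^ 2) =
    \int[lebesgue_measure]_(x in `[0%R, +oo[) (f (Num.max 0 x) ^+ 2)%:E)%E.
  rewrite [RHS]integral_mkcond; apply: eq_integral => x _.
  rewrite /= !patchE; case: ifPn => [|_].
    rewrite inE/= in_itv/= andbT => x0.
    by rewrite max_r// powR_mulrn// real_normK// num_real.
  by change ((`|0 : R| `^ 2)%:E = 0%E); rewrite normr0 powR0.
split=> [h|h].
  by rewrite -E -poweR_Lnorm// -/(L2norm f) h poweR1r.
by rewrite /L2norm unlock E h poweR1r.
Qed.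

(* Functions on [0, oo) are extended by [f (Num.max 0 x)] to be continuous on the whole line. *)
Record weak_derivative {R : realType} (f g : R -> R) (N : set R) : Prop := WeakDerivative {
  weak_ac : loc_abs_continuous f;
  weak_f0 : f 0 = 0;
  weak_meas : measurable_fun setT g;
  weak_mN : measurable N;
  weak_N0 : @lebesgue_measure R N = 0%E;
  weak_der : forall x : R, 0 < x -> ~ N x -> is_derive x 1 f (g x);
  weak_hderiv : forall x : R, 0 <= x -> ~ N x -> hderiv f x = g x;
  weak_int : forall x y : R, 0 <= x -> x <= y -> (@lebesgue_measure R).-integrable `[x, y] (EFin \o g);
  weak_ftc : forall x y : R, 0 <= x -> x <= y ->
    \int[lebesgue_measure]_(t in `[x, y]) g t = f y - f x;
  weak_energy : (@lebesgue_measure R).-integrable `[0, +oo[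
    (EFin \o (fun x => g x ^+ 2 + (1 + x) * f (Num.max 0 x) ^+ 2)) }.

Lemma Lstar_weak_derivative {R : realType} (f : R -> R) : Lstar f ->
  exists g N, weak_derivative f g N.
Proof.
move=> [acf f0 fin].
have [g [mg [N [mN N0 Ng]] gI]] := loc_abs_continuous_FTC f acf.
have cF := loc_abs_continuous_max0 f acf.
have mF : measurable_fun setT (fun x : R => f (Num.max 0 x)) by exact: continuous_measurable_fun.
(* At [0], [hderiv] is a one-sided limit, which is unrelated to [g 0]. *)
pose N' := N `|` [set 0].
have mN' : measurable N' by apply: measurableU.
have N'0 : @lebesgue_measure R N' = 0%E.
  by rewrite /N' measureU0//; exact: lebesgue_measure_set1.
have hg (x : R) : 0 <= x -> ~ N' x -> hderiv f x = g x.
  rewrite le_eqVlt => /predU1P[<-|x0] Nx; first by exfalso; apply: Nx; right.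
  rewrite /hderiv x0 derive1E.
  have [|_ ->//] := Ng x x0.
  by move=> Nx'; apply: Nx; left.
exists g, N'; split => //.
- by move=> x x0 Nx; apply: Ng => // Nx'; apply: Nx; left.
- by move=> x y x0 xy; have [] := gI x y x0 xy.
- by move=> x y x0 xy; have [_ h] := gI x y x0 xy; rewrite /Rintegral h.
apply/integrableP; split.
  apply/measurable_EFinP; apply: measurable_funTS; apply: measurable_funD.
    exact: measurable_funX.
  by apply: measurable_funM; [exact: measurable_funD|exact: measurable_funX].
apply: le_lt_trans fin; rewrite le_eqVlt; apply/orP; left; apply/eqP/esym.
apply: (integral_off_null (@lebesgue_measure R) N') => // x; rewrite /= in_itv/= andbT => x0 Nx.
rewrite hg// max_r// ger0_norm// addr_ge0 ?sqr_ge0// mulr_ge0 ?sqr_ge0//.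
by rewrite addr_ge0.
Qed.

Section quadratic_form.
Context {R : realType} (D E : R -> R) (cD : continuous D) (cE : continuous E)
  (D_small : forall e : R, 0 < e -> exists2 C : R, 0 <= C & forall x : R, 0 <= x -> D x ^+ 2 <= e * (1 + x) + C)
  (E_small : forall e : R, 0 < e -> exists2 C : R, 0 <= C & forall x : R, 0 <= x -> `|E x| <= e * (1 + x) + C).
Context (f g : R -> R) (N : set R) (wfg : weak_derivative f g N).

Notation F := (fun x : R => f (Num.max 0 x)).
Notation k := (fun x => g x ^+ 2 + (1 + x) * f (Num.max 0 x) ^+ 2).
Notation q := (fun x => form_density D E x (f (Num.max 0 x)) (g x)).

Lemma weak_measurable : measurable_fun setT F.
Proof. by apply: continuous_measurable_fun; apply: loc_abs_continuous_max0; exact: weak_ac wfg. Qed.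

Lemma energy_density_measurable : measurable_fun setT k.
Proof.
have mF := weak_measurable; have mg := weak_meas _ _ _ wfg.
apply: measurable_funD; first exact: measurable_funX.
by apply: measurable_funM; [exact: measurable_funD|exact: measurable_funX].
Qed.

Lemma integrable_le_energy (h : R -> R) (C : R) : measurable_fun setT h ->
  (forall x, 0 <= x -> `|h x| <= C * (g x ^+ 2 + (1 + x) * f x ^+ 2)) ->
  (@lebesgue_measure R).-integrable `[0, +oo[ (EFin \o h).
Proof.
move=> mh hC.
have ik : (@lebesgue_measure R).-integrable `[0, +oo[ (fun x => C%:E * (k x)%:E)%E.
  by apply: integrableZl => //; exact: weak_energy wfg.
apply: le_integrable ik => //.
  by apply/measurable_EFinP; exact: measurable_funTS.
move=> x; rewrite /= in_itv/= andbT => x0.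
rewrite lee_fin; apply: le_trans (hC x x0) _.
by rewrite max_r//; exact: ler_norm.
Qed.

Lemma form_density_measurable : measurable_fun setT q.
Proof.
have mF := weak_measurable; have mg := weak_meas _ _ _ wfg.
have mD : measurable_fun setT D by exact: continuous_measurable_fun.
have mE : measurable_fun setT E by exact: continuous_measurable_fun.
rewrite /form_density; apply: measurable_funD; first apply: measurable_funD.
- exact: measurable_funX.
- by apply: measurable_funM; [exact: measurable_funD|exact: measurable_funX].
- by apply: measurable_funM => //; do 2 apply: measurable_funM => //.
Qed.

Lemma coefficients_le_energy : exists2 C : R, 0 <= C & forall x : R, 0 <= x ->
  `|E x * f x ^+ 2| <= C * (g x ^+ 2 + (1 + x) * f x ^+ 2) /\
  `|g x * f x * D x| <= C * (g x ^+ 2 + (1 + x) * f x ^+ 2).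
Proof.
have [CD CD0 HD] := D_small 1 ltr01; have [CE CE0 HE] := E_small 1 ltr01.
exists (2 + CD + CE); first by lra.
move=> x x0.
have f2 := sqr_ge0 (f x); have g2 := sqr_ge0 (g x).
have xf : 0 <= x * f x ^+ 2 by rewrite mulr_ge0.
have Cf : 0 <= CD * f x ^+ 2 by rewrite mulr_ge0.
have Cf' : 0 <= CE * f x ^+ 2 by rewrite mulr_ge0.
have Cxf : 0 <= CD * (x * f x ^+ 2) by rewrite mulr_ge0.
have Cxf' : 0 <= CE * (x * f x ^+ 2) by rewrite mulr_ge0.
have Cg : 0 <= CD * g x ^+ 2 by rewrite mulr_ge0.
have Cg' : 0 <= CE * g x ^+ 2 by rewrite mulr_ge0.
split.
  rewrite normrM (ger0_norm f2).
  have : `|E x| * f x ^+ 2 <= (1 * (1 + x) + CE) * f x ^+ 2 by rewrite ler_wpM2r// HE.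
  by lra.
have fD : f x ^+ 2 * D x ^+ 2 <= f x ^+ 2 * (1 * (1 + x) + CD) by rewrite ler_wpM2l// HD.
have : `|g x * f x * D x| <= g x ^+ 2 + f x ^+ 2 * D x ^+ 2.
  rewrite ler_norml; apply/andP.
  have := sqr_ge0 (g x + f x * D x); have := sqr_ge0 (g x - f x * D x).
  rewrite !expr2; split; nra.
by lra.
Qed.

Lemma form_density_integrable : (@lebesgue_measure R).-integrable `[0, +oo[ (EFin \o q).
Proof.
have [C C0 H] := coefficients_le_energy.
apply: (integrable_le_energy _ (1 + 3 * C) form_density_measurable) => x x0.
have [] := H x x0.
have f2 := sqr_ge0 (f x); have g2 := sqr_ge0 (g x).
have xf : 0 <= x * f x ^+ 2 by rewrite mulr_ge0.
rewrite max_r// /form_density !ler_norml => /andP[h1 h2] /andP[h3 h4].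
by apply/andP; split; lra.
Qed.

Lemma mass_density_integrable :
  (@lebesgue_measure R).-integrable `[0, +oo[ (EFin \o (fun x => F x ^+ 2)).
Proof.
apply: (integrable_le_energy _ 1).
  by apply: measurable_funX; exact: weak_measurable.
move=> x x0; have f2 := sqr_ge0 (f x); have g2 := sqr_ge0 (g x).
have xf : 0 <= x * f x ^+ 2 by rewrite mulr_ge0.
by rewrite max_r// ger0_norm//; lra.
Qed.

(** Splitting the integral requires measurable integrands, which [hderiv f] does not provide by
    itself. So each integrand is first changed on the null set to one written with [g], integrable
    because it is dominated by the energy density. *)
Lemma airy_form_density (beta : R) (w : R -> R) : 0 < beta ->
  (forall x, 0 <= x -> D x = 2 / Num.sqrt beta * (bbar w x - w x)) ->
  (forall x, 0 <= x -> E x = 2 / Num.sqrt beta * bbar' w x) ->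
  airy_form beta w f = \int[lebesgue_measure]_(x in `[0, +oo[) q x.
Proof.
move=> beta0 DE EE.
have c0 : 0 < 2 / Num.sqrt beta by rewrite divr_gt0// sqrtr_gt0.
rewrite /airy_form.
have -> : 4 / Num.sqrt beta = 2 * (2 / Num.sqrt beta) by ring.
move: DE EE c0 => /=; set c := 2 / Num.sqrt beta => DE EE c0.
have mF := weak_measurable; have mg := weak_meas _ _ _ wfg.
have mD : measurable_fun setT D by exact: continuous_measurable_fun.
have mE : measurable_fun setT E by exact: continuous_measurable_fun.
have [C C0 H] := coefficients_le_energy.
have off (u v : R -> R) : (forall x, 0 <= x -> ~ N x -> u x = v x) ->
    \int[lebesgue_measure]_(x in `[0, +oo[) u x = \int[lebesgue_measure]_(x in `[0, +oo[) v x.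
  move=> uv; rewrite /Rintegral; congr fine.
  apply: (integral_off_null (@lebesgue_measure R) N) => //; [exact: weak_mN wfg|exact: weak_N0 wfg|].
  by move=> x; rewrite /= in_itv/= andbT => x0 Nx; rewrite uv.
have hg := weak_hderiv _ _ _ wfg.
rewrite (off _ (fun x => g x ^+ 2 + x * F x ^+ 2)); last first.
  by move=> x x0 Nx; rewrite hg// max_r.
rewrite (off (fun x => f x ^+ 2 * bbar' w x) (fun x => c^-1 * (E x * F x ^+ 2))); last first.
  by move=> x x0 Nx; rewrite EE// max_r//; field; rewrite gt_eqF.
rewrite (off (fun x => hderiv f x * f x * (bbar w x - w x)) (fun x => c^-1 * (g x * F x * D x))); last first.
  by move=> x x0 Nx; rewrite DE// hg// max_r//; field; rewrite gt_eqF.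
have i1 : (@lebesgue_measure R).-integrable `[0, +oo[ (EFin \o (fun x => g x ^+ 2 + x * F x ^+ 2)).
  apply: (integrable_le_energy _ 1).
    by apply: measurable_funD; [exact: measurable_funX|apply: measurable_funM => //; exact: measurable_funX].
  move=> x x0; have f2 := sqr_ge0 (f x); have g2 := sqr_ge0 (g x).
  have xf : 0 <= x * f x ^+ 2 by rewrite mulr_ge0.
  by rewrite max_r// ger0_norm; lra.
have i2 : (@lebesgue_measure R).-integrable `[0, +oo[ (EFin \o (fun x => E x * F x ^+ 2)).
  apply: (integrable_le_energy _ C).
    by apply: measurable_funM => //; exact: measurable_funX.
  by move=> x x0; rewrite max_r//; have [] := H x x0.
have i3 : (@lebesgue_measure R).-integrable `[0, +oo[ (EFin \o (fun x => g x * F x * D x)).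
  apply: (integrable_le_energy _ C); first by do 2 apply: measurable_funM => //.
  by move=> x x0; rewrite max_r//; have [] := H x x0.
rewrite !RintegralZl//.
rewrite (_ : \int[lebesgue_measure]_(x in `[0, +oo[) q x =
  \int[lebesgue_measure]_(x in `[0, +oo[) (g x ^+ 2 + x * F x ^+ 2) +
  \int[lebesgue_measure]_(x in `[0, +oo[) (E x * F x ^+ 2) +
  2 * \int[lebesgue_measure]_(x in `[0, +oo[) (g x * F x * D x)).
  by field; rewrite gt_eqF.
have i3' : (@lebesgue_measure R).-integrable `[0, +oo[ (EFin \o (fun x => 2 * (g x * F x * D x))).
  by apply: (@integrableZl _ _ R (@lebesgue_measure R) _ _ 2 (EFin \o (fun x => g x * F x * D x))).
have i12 : (@lebesgue_measure R).-integrable `[0, +oo[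
    (EFin \o (fun x => g x ^+ 2 + x * F x ^+ 2 + E x * F x ^+ 2)).
  by apply: (@integrableD _ _ R (@lebesgue_measure R) _ _
    (EFin \o (fun x => g x ^+ 2 + x * F x ^+ 2)) (EFin \o (fun x => E x * F x ^+ 2))).
rewrite -RintegralZl// -RintegralD// -RintegralD//.
by apply: eq_Rintegral => x _; rewrite /form_density; ring.
Qed.

End quadratic_form.

Lemma integral_near0 {R : realType} (h : R -> R) :
  (@lebesgue_measure R).-integrable `[0, 1] (EFin \o h) ->
  forall e, 0 < e -> exists2 r, 0 < r & forall x, 0 <= x -> x < r ->
    `|\int[lebesgue_measure]_(t in `[0, x]) h t| < e.
Proof.
move=> ih e e0.
have [r r0 rP] := parameterized_integral_near_left ltr01 e0 ih.
exists r => // x x0 xr; apply: rP => //=.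
by rewrite sub0r normrN ger0_norm.
Qed.

Lemma within_norm_bounded {R : realType} (a c : R) (F : R -> R) : a <= c ->
  {within `[a, c], continuous F} ->
  exists2 K, 0 <= K & forall x, a <= x <= c -> `|F x| <= K.
Proof.
move=> ac cF.
have [|z _ zP] := @EVT_max R (fun x => `|F x|) a c ac.
  by move=> x; apply: (@continuous_comp _ _ _ (F : subspace `[a, c] -> R) Num.norm);
    [exact: cF|exact: norm_continuous].
by exists `|F z| => // x xac; apply: zP; rewrite in_itv.
Qed.

(** * Lower bound of the form by the positive solution *)

Section ground_state_inequality.
Context {R : realType} (D E : R -> R) (cD : continuous D) (cE : continuous E)
  (D_small : forall e : R, 0 < e -> exists2 C : R, 0 <= C & forall x : R, 0 <= x -> D x ^+ 2 <= e * (1 + x) + C)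
  (E_small : forall e : R, 0 < e -> exists2 C : R, 0 <= C & forall x : R, 0 <= x -> `|E x| <= e * (1 + x) + C).
Context (f g : R -> R) (N : set R) (wfg : weak_derivative f g N).
Context (l : R) (phi v : R -> R) (s : schroedinger_solution D E l phi v)
  (phi_gt0 : forall x, 0 < x -> 0 < phi x).

Notation mu := (@lebesgue_measure R).
Notation F := (fun x : R => f (Num.max 0 x)).
Notation q := (fun x => form_density D E x (f (Num.max 0 x)) (g x)).
Notation h := (fun x => form_density D E x (f (Num.max 0 x)) (g x) - l * f (Num.max 0 x) ^+ 2).
Notation rho := (fun x => v x / phi x).

Lemma excess_integrable : mu.-integrable `[0, +oo[ (EFin \o h).
Proof.
apply: (@integrableB _ _ R mu _ _ (EFin \o q) (EFin \o (fun x => l * F x ^+ 2))) => //.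
  exact: (form_density_integrable D E cD cE D_small E_small f g N wfg).
apply: (@integrableZl _ _ R mu _ _ l (EFin \o (fun x => F x ^+ 2))) => //.
exact: (mass_density_integrable f g N wfg).
Qed.

Lemma excess_measurable : measurable_fun setT h.
Proof.
apply: measurable_funB.
  exact: (form_density_measurable D E cD cE f g N wfg).
apply: measurable_funM => //; apply: measurable_funX.
exact: weak_measurable f g N wfg.
Qed.

(* Jacobi's identity: the excess minus [(f^2 rho)'] is [(g - f (rho - D))^2]. *)
Lemma excess_increment (a c : R) : 0 < a -> a <= c ->
  f c ^+ 2 * rho c - f a ^+ 2 * rho a <= \int[lebesgue_measure]_(x in `[a, c]) h x.
Proof.
move=> a0 ac.
have pos (x : R) : a <= x <= c -> 0 < x by case/andP => + _; exact: lt_le_trans.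
have drho (x : R) : a <= x <= c -> is_derive x 1 rho (x - l + E x - (rho x - D x) ^+ 2).
  move=> /pos x0; apply: (derive_quotient D E l phi v s x) => //; [exact: ltW|exact: phi_gt0].
have [M1 M10 HM1] := within_norm_bounded a c rho ac (derive_within_continuous _ _ _ _ drho).
have [M2 M20 HM2] := continuous_norm_bounded E c cE.
have [M3 M30 HM3] := continuous_norm_bounded D c cD.
have [M4 M40 HM4] := continuous_norm_bounded F c (loc_abs_continuous_max0 f (weak_ac _ _ _ wfg)).
have sub (x : R) : a <= x <= c -> 0 <= x <= c by move=> h; rewrite ltW ?pos//; case/andP: h.
(* A bound for the right-hand side of the Riccati equation: away from [0], [rho] is Lipschitz, so
   that [f^2 rho] is absolutely continuous. *)
pose K := c + `|l| + M2 + (M1 + M3) ^+ 2.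
have dK (x : R) : a <= x <= c -> `|x - l + E x - (rho x - D x) ^+ 2| <= K.
  move=> xac; have := HM1 x xac; have := HM2 x (sub x xac); have := HM3 x (sub x xac).
  have := ler_norm l; have := ler_norm (- l); rewrite normrN.
  have /andP[x0 xc] := sub x xac.
  move=> h1 h2 h3; rewrite !ler_norml => /andP[h4 h5] /andP[h6 h7].
  have h8 : `|rho x - D x| <= M1 + M3.
    by move: h3; rewrite !ler_norml => /andP[? ?]; apply/andP; split; lra.
  have h9 : 0 <= (rho x - D x) ^+ 2 <= (M1 + M3) ^+ 2.
    rewrite sqr_ge0/= -(@real_normK _ (rho x - D x)) ?num_real// ler_sqr ?nnegrE//.
    by rewrite addr_ge0// (le_trans _ M30).
  by rewrite /K; apply/andP; split; lra.
pose M := Num.max M1 (M4 * M4).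
have fM4 (x : R) : a <= x <= c -> `|f x| <= M4.
  by move=> xac; have := HM4 x (sub x xac); rewrite max_r// ltW// pos.
have acf : abs_continuous_on a c f by apply: (weak_ac _ _ _ wfg) => //; exact: ltW.
have acH : abs_continuous_on a c (fun x => (f x * f x) * rho x).
  apply: (abs_continuous_on_mul a c M).
  - move=> x xac; rewrite normrM le_max; apply/orP; right.
    by apply: ler_pM => //; exact: fM4.
  - by move=> x xac; rewrite le_max HM1.
  - exact: (abs_continuous_on_mul a c M4).
  - apply: (lipschitz_abs_continuous_on a c K).
    exact: derivable_lipschitz drho dK.
rewrite !expr2.
apply: (abs_continuous_on_increment_le a c N (fun x => (f x * f x) * rho x) h ac acH).
- exact: weak_mN wfg.
- exact: weak_N0 wfg.
- move=> x /andP[ax xc] Nx.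
  have xac : a <= x <= c by rewrite !ltW.
  have x0 := pos x xac.
  have df := weak_der _ _ _ wfg x x0 Nx.
  eexists; first exact: (derM (fun y => f y * f y) rho x _ _ (derM f f x _ _ df df) (drho x xac)).
  rewrite max_r ?(ltW x0)// /form_density -subr_ge0.
  have := sqr_ge0 (g x - f x * (rho x - D x)).
  by rewrite !expr2; lra.
- apply: integrableS excess_integrable => //.
  by move=> x /=; rewrite !in_itv/= andbT => /pos/ltW.
Qed.

Lemma derivative_sqr_integrable : mu.-integrable `[0, +oo[ (EFin \o (fun t => g t ^+ 2)).
Proof.
apply: (integrable_le_energy f g N wfg _ 1).
  by apply: measurable_funX; exact: weak_meas wfg.
move=> t t0; have f2 := sqr_ge0 (f t); have g2 := sqr_ge0 (g t).
have tf : 0 <= t * f t ^+ 2 by rewrite mulr_ge0.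
by rewrite ger0_norm//; lra.
Qed.

(* Integrate [(g - f x / x)^2 >= 0] over [[0, x]]. *)
Lemma sqr_le_integral (x : R) : 0 < x ->
  f x ^+ 2 <= x * \int[lebesgue_measure]_(t in `[0, x]) g t ^+ 2.
Proof.
move=> x0.
have ig := weak_int _ _ _ wfg 0 x (lexx 0) (ltW x0).
have ik : mu.-integrable `[0, x] (EFin \o (fun t => g t ^+ 2)).
  by apply: integrableS derivative_sqr_integrable => //; exact: subset_itvl.
pose a := f x / x.
have ia : mu.-integrable `[0, x] (EFin \o (fun t => 2 * a * g t)).
  by apply: (@integrableZl _ _ R mu _ _ (2 * a) (EFin \o g)).
have ic : mu.-integrable `[0, x] (EFin \o (fun=> a ^+ 2)).
  apply: continuous_compact_integrable; first exact: segment_compact.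
  by apply: continuous_subspaceT => z; exact: cvg_cst.
have iac : mu.-integrable `[0, x] (EFin \o (fun t => 2 * a * g t - a ^+ 2)).
  by apply: (@integrableB _ _ R mu _ _ (EFin \o (fun t => 2 * a * g t)) (EFin \o (fun=> a ^+ 2))).
have : \int[lebesgue_measure]_(t in `[0, x]) (2 * a * g t - a ^+ 2) <=
    \int[lebesgue_measure]_(t in `[0, x]) (g t ^+ 2).
  apply: le_Rintegral => // t _.
  have := sqr_ge0 (g t - a); rewrite !expr2; lra.
rewrite RintegralB// RintegralZl// (weak_ftc _ _ _ wfg 0 x (lexx 0) (ltW x0)) (weak_f0 _ _ _ wfg).
have -> : \int[lebesgue_measure]_(t in `[0, x]) a ^+ 2 = a ^+ 2 * x.
  rewrite (@Rintegral_cst _ _ R (@lebesgue_measure R) _ (measurable_itv _) (a ^+ 2)).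
  have m1 : lebesgue_measure (`[0, x]%classic : set R) = x%:E.
    by rewrite lebesgue_measure_itv/= lte_fin x0 -EFinB subr0.
  exact: (congr1 (fun t => a ^+ 2 * fine t) m1).
have fa : f x = a * x by rewrite /a divfK// gt_eqF.
rewrite fa => hh.
have := ler_wpM2l (ltW x0) hh.
by rewrite subr0 !expr2; lra.
Qed.

(** The quotient [rho] has a pole of order [1 / x] at [0], but [f x ^ 2] is at most [x] times the
    integral of [g ^ 2] over [[0, x]], and this integral tends to zero. *)
Lemma excess_near0 (e : R) : 0 < e -> exists2 r, 0 < r & forall x, 0 < x -> x < r ->
  f x ^+ 2 * rho x <= e.
Proof.
move=> e0.
have ik : mu.-integrable `[0, 1] (EFin \o (fun t => g t ^+ 2)).
  by apply: integrableS derivative_sqr_integrable => //; exact: subset_itvl.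
have [x1 [d [x10 d0 near0]]] := solution_pos_near0 D E cD cE l.
have [_ cv] := solution_max0_cont D E l phi v s.
have [K K1 HK] := continuous_norm_bounded _ 1 cv.
have K0 : 0 < K by apply: lt_le_trans K1.
have [r r0 Hr] := integral_near0 _ ik _ (divr_gt0 e0 (mulr_gt0 (ltr0n R 2) K0)).
exists (Num.min r (Num.min x1 1)); first by rewrite !lt_min r0 x10 ltr01.
move=> x x0; rewrite !lt_min => /and3P[xr xx1 x1'].
have := Hr x (ltW x0) xr; rewrite ltr_norml => /andP[_]; rewrite ltr_pdivlMr ?mulr_gt0// => he.
have hphi : x / 2 <= phi x by apply: (near0 l phi v s); rewrite ?subrr ?normr0// !ltW.
have hv : v x <= K.
  by have := HK x; rewrite max_r ?(ltW x0)// (ltW x1') => /(_ isT); exact/le_trans/ler_norm.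
have pp := phi_gt0 x x0.
rewrite mulrA ler_pdivrMr//.
have hf := sqr_le_integral x x0.
set eta := \int[_]_(_ in _) _ in he hf *.
have f2 := sqr_ge0 (f x).
have h1 : f x ^+ 2 * v x <= f x ^+ 2 * K by rewrite ler_wpM2l.
have h2 : f x ^+ 2 * K <= (x * eta) * K by rewrite ler_wpM2r// ltW.
have h3 : x * (eta * (2 * K)) <= x * e by rewrite ler_wpM2l// ltW.
have h4 : e * (x / 2) <= e * phi x by rewrite ler_wpM2l// ltW.
by lra.
Qed.

Lemma excess_ge (X : R) : 0 < X -> f X ^+ 2 * rho X <= \int[lebesgue_measure]_(x in `[0, X]) h x.
Proof.
move=> X0; apply/ler_addgt0Pr => e e0.
have e20 : 0 < e / 2 by lra.
have [r1 r10 H1] := excess_near0 _ e20.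
have i1 : mu.-integrable `[0, 1] (EFin \o h).
  by apply: integrableS excess_integrable => //; exact: subset_itvl.
have [r2 r20 H2] := integral_near0 _ i1 _ e20.
pose a := Num.min (Num.min r1 r2) X / 2.
have m0 : 0 < Num.min (Num.min r1 r2) X by rewrite !lt_min r10 r20 X0.
have [ar1 [ar2 aX]] : a < r1 /\ a < r2 /\ a < X.
  have : a < Num.min (Num.min r1 r2) X by rewrite /a; lra.
  by rewrite !lt_min => /andP[/andP[-> ->] ->].
have a0 : 0 < a by rewrite /a; lra.
have := H1 a a0 ar1; have := H2 a (ltW a0) ar2.
rewrite ltr_norml => /andP[h1 _] h2.
have := excess_increment a X a0 (ltW aX).
have iX : mu.-integrable `[0, X] (EFin \o h).
  by apply: integrableS excess_integrable => //; exact: subset_itvl.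
have := @Rintegral_itvB R h (BLeft 0) (BRight X) a iX.
rewrite !bnd_simp (ltW a0) (ltW aX) => /(_ isT isT).
rewrite Rintegral_itv_obnd_cbnd; last first.
  by apply: integrableS iX => //; apply: subset_itvr; rewrite bnd_simp ltW.
by lra.
Qed.

Lemma ground_state_inequality :
  l * \int[lebesgue_measure]_(x in `[0, +oo[) F x ^+ 2 <= \int[lebesgue_measure]_(x in `[0, +oo[) q x.
Proof.
have i1 := form_density_integrable D E cD cE D_small E_small f g N wfg.
have i2 := mass_density_integrable f g N wfg.
have i2' : mu.-integrable `[0, +oo[ (EFin \o (fun x => l * F x ^+ 2)).
  by apply: (@integrableZl _ _ R mu _ _ l (EFin \o (fun x => F x ^+ 2))).
rewrite -subr_ge0 -RintegralZl// -RintegralB//.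
rewrite leNgt; apply/negP; set I := \int[_]_(_ in _) _ => I0.
have e0 : 0 < - I / 2 by lra.
have [M M0 HM] := integral_itv0y_tail h excess_measurable excess_integrable _ e0.
have [K K0 HK] := quotient_bound D E D_small E_small l.
(* Where the energy density is below this, [(1 + X) f^2] is too, and the boundary term [f^2 rho]
   stays above [I / 2]. Searching beyond [M + 1] rather than [M] ensures [X > 0]. *)
have e1 : 0 < - I / 2 / (K + 1) by rewrite divr_gt0// ltr_wpDl.
have M1 : 0 <= M + 1 by lra.
have [X MX] := integrable_itv0y_small _ (energy_density_measurable f g N wfg) (weak_energy _ _ _ wfg) _ _ e1 M1.
rewrite ltr_pdivlMr ?ltr_wpDl// => hX.
have X0 : 0 < X by lra.
have MX' : M <= X by lra.
have := HM X MX'; rewrite -/I ltr_norml => /andP[h1 h2].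
have h3 := excess_ge X X0.
have h4 := HK phi v s phi_gt0 X X0.
move: hX; rewrite max_r ?(ltW X0)// => hX.
have f2 := sqr_ge0 (f X); have g2 := sqr_ge0 (g X).
have h5 : f X ^+ 2 * - (K * (1 + X)) <= f X ^+ 2 * rho X by rewrite ler_wpM2l.
have h6 : 0 <= K * g X ^+ 2 by rewrite mulr_ge0.
have h7 : 0 <= (1 + X) * f X ^+ 2 by rewrite mulr_ge0//; lra.
by lra.
Qed.

End ground_state_inequality.

(** * The stochastic Airy operator *)

Section noise.
Context {R : realType} (c : R) (W : R -> R) (cW : continuous W).

(** On [[0, oo)] this is [c] times the unit average of [W]; written through [primitive], it has a
    two-sided derivative at [0] as well. *)
Definition noise_average (x : R) : R := c * (primitive W (x + 1) - primitive W x).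

Definition noise_drift (x : R) : R := noise_average (Num.max 0 x) - c * W x.

Definition noise_increment (x : R) : R := c * (W (x + 1) - W x).

Lemma derive_noise_average (x : R) : 0 <= x ->
  is_derive x 1 noise_average (noise_increment x).
Proof.
move=> x0.
have x10 : 0 <= x + 1 by lra.
have d1 : is_derive x 1 (fun y : R => y + 1) 1.
  by apply: derE (derD (fun y => y) (fun=> 1) x 1 0 _ _) _; rewrite addr0.
have d2 : is_derive x 1 (fun y : R => primitive W (y + 1)) (W (x + 1)).
  have dp := derive_primitive W cW (x + 1) x10.
  by apply: derE (@is_derive1_comp R (primitive W) (fun y => y + 1) x _ _ dp d1) _; rewrite mulr1.
have d3 := derB _ _ _ _ _ d2 (derive_primitive W cW x x0).
apply: derE (derM (fun=> c) _ x 0 _ (derC c x) d3) _.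
by rewrite mul0r add0r.
Qed.

Lemma noise_drift_continuous : continuous noise_drift.
Proof.
move=> x; apply: (@cvgB _ R^o); last by apply: cvgM; [exact: cvg_cst|exact: cW].
by apply: max0_continuous => y y0; apply: der_cont (derive_noise_average y y0).
Qed.

Lemma noise_increment_continuous : continuous noise_increment.
Proof.
move=> x; apply: cvgM; first exact: cvg_cst.
apply: (@cvgB _ R^o); last exact: cW.
apply: (@continuous_comp _ _ _ (fun y : R => y + 1) W); last exact: cW.
by apply: (@cvgD _ R^o); [exact: cvg_id|exact: cvg_cst].
Qed.

Hypothesis W_sub : subdiffusive W.

Lemma noise_small (e : R) : 0 < e -> exists2 C : R, 0 <= C &
  forall x y : R, 0 <= x -> 0 <= y -> y <= 1 -> (c * (W (x + y) - W x)) ^+ 2 <= e * (1 + x) + C.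
Proof.
(* The added [1] allows division when [c = 0]. *)
move=> e0; have c2 : 0 < c ^+ 2 + 1 by rewrite ltr_wpDl// sqr_ge0.
have [C C0 H] := W_sub _ (divr_gt0 e0 c2).
exists ((c ^+ 2 + 1) * C); first by rewrite mulr_ge0// ltW.
move=> x y x0 y0 y1; rewrite exprMn.
apply: (@le_trans _ _ ((c ^+ 2 + 1) * (W (x + y) - W x) ^+ 2)).
  by rewrite ler_wpM2r ?sqr_ge0//; lra.
have := ler_wpM2l (ltW c2) (H x y x0 y0 y1).
rewrite [X in _ <= X -> _](_ : _ = e * (1 + x) + (c ^+ 2 + 1) * C)//.
by field; rewrite gt_eqF.
Qed.

(** The drift at [x] is the average of [c * (W z - W x)] over [z] in [[x, x + 1]], and each of these
    is at most the root of the bound. *)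
Lemma noise_drift_small (e : R) : 0 < e ->
  exists2 C : R, 0 <= C & forall x : R, 0 <= x -> noise_drift x ^+ 2 <= e * (1 + x) + C.
Proof.
move=> e0; have [C C0 H] := noise_small e e0; exists C => // x x0.
have r0 : 0 <= e * (1 + x) + C by rewrite addr_ge0// mulr_ge0 ?ltW// ltr_wpDr.
set r := e * (1 + x) + C in r0 *.
pose del := Num.sqrt r.
have hb (z : R) : x <= z <= x + 1 -> c * W x - del <= c * W z <= c * W x + del.
  move=> /andP[h1 h2]; have z1 : z - x <= 1 by lra.
  have z0 : 0 <= z - x by lra.
  have := H x (z - x) x0 z0 z1; rewrite (addrC x) subrK -/r => h3.
  have : `|c * (W z - W x)| <= del by rewrite -sqrtr_sqr /del ler_wsqrtr.
  by rewrite ler_norml => /andP[h4 h5]; apply/andP; split; lra.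
have dcW (z : R) : x <= z <= x + 1 -> is_derive z 1 (fun t => c * primitive W t) (c * W z).
  move=> /andP[xz _]; have z0 := le_trans x0 xz.
  by apply: derE (derM (fun=> c) _ z 0 _ (derC c z) (derive_primitive W cW z z0)) _; rewrite mul0r add0r.
have dK (k z : R) : is_derive z 1 (fun t => k * t) k.
  by apply: derE (derM (fun=> k) (fun t => t) z 0 1 _ _) _; ring.
have xx1 : x <= x + 1 by lra.
have h1 := le_increment _ _ _ _ x (x + 1) xx1 dcW (fun z _ => dK (c * W x + del) z).
have h2 := le_increment _ _ _ _ x (x + 1) xx1 (fun z _ => dK (c * W x - del) z) dcW.
have := h1 (fun z zx => proj2 (andP (hb z zx))); have := h2 (fun z zx => proj1 (andP (hb z zx))).
move=> h3 h4.
rewrite -[leRHS](sqr_sqrtr r0) -/del -(@real_normK _ (noise_drift x)) ?num_real//.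
rewrite ler_sqr ?nnegrE ?sqrtr_ge0//.
rewrite /noise_drift /noise_average max_r// ler_norml; apply/andP; split; lra.
Qed.

(** By [|E| <= E^2 + 1]; hence the constant [C + 1]. *)
Lemma noise_increment_small (e : R) : 0 < e ->
  exists2 C : R, 0 <= C & forall x : R, 0 <= x -> `|noise_increment x| <= e * (1 + x) + C.
Proof.
move=> e0; have [C C0 H] := noise_small e e0; exists (C + 1); first by lra.
move=> x x0; have := H x 1 x0 ler01 (lexx 1); rewrite -/(noise_increment x) => h.
have h1 := sqr_ge0 (noise_increment x + 1); have h2 := sqr_ge0 (noise_increment x - 1).
have h3 := sqr_ge0 (noise_increment x).
move: h h1 h2 h3; rewrite !expr2 => h h1 h2 h3.
by rewrite ler_norml; apply/andP; split; lra.
Qed.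

End noise.

Lemma integral_primitive {R : realType} (k : R -> R) (x y : R) : continuous k ->
  0 <= x -> x <= y -> \int[lebesgue_measure]_(t in `[x, y]) k t = primitive k y - primitive k x.
Proof.
move=> ck x0 xy.
have dp (z : R) : x <= z <= y -> is_derive z 1 (primitive k) (k z).
  by move=> /andP[xz _]; apply: derive_primitive => //; exact: le_trans xz.
rewrite {1}/Rintegral; have -> // := integral_derive (primitive k) k x y xy dp.
exact: continuous_subspaceT.
Qed.

Lemma bbar_primitive {R : realType} (w : R -> R) (x : R) :
  continuous (fun t : R => w (Num.max 0 t)) -> 0 <= x ->
  bbar w x = primitive (fun t => w (Num.max 0 t)) (x + 1) - primitive (fun t => w (Num.max 0 t)) x.
Proof.
move=> cw x0; rewrite -integral_primitive ?lerDl//.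
apply: eq_Rintegral => t; rewrite inE/= in_itv/= => /andP[xt _].
by rewrite max_r// (le_trans x0).
Qed.

Lemma within_itvcy_max0 {R : realType} (w : R -> R) :
  {within `[0, +oo[, continuous w} -> continuous (fun x : R => w (Num.max 0 x)).
Proof. by move=> cw; apply: max0_continuous_eps; exact: within_itvcy_eps. Qed.

Lemma integral_max0_continuous {R : realType} (k : R -> R) :
  (forall X : R, 0 <= X -> (@lebesgue_measure R).-integrable `[0, X] (EFin \o k)) ->
  continuous (fun x : R => \int[lebesgue_measure]_(t in `[0, Num.max 0 x]) k t).
Proof.
move=> ik; apply: (@within_itvcy_max0 R (fun x => \int[lebesgue_measure]_(t in `[0, x]) k t)).
have cX (X : R) : 0 < X -> {within `[0, X], continuous (fun x => \int[lebesgue_measure]_(t in `[0, x]) k t)}.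
  by move=> X0; apply: (parameterized_integral_continuous (ltW X0)); apply: ik; exact: ltW.
apply/continuous_within_itvcyP; split.
  move=> x; rewrite in_itv/= andbT => x0.
  have x1 : 0 < x + 1 by lra.
  have /(continuous_within_itvP _ x1)[h _ _] := cX _ x1.
  by apply: h; rewrite in_itv/= x0 ltrDl ltr01.
by have /(continuous_within_itvP _ ltr01)[_ h _] := cX _ ltr01.
Qed.

Lemma hderivable_is_derive {R : realType} (f : R -> R) (x : R) : 0 < x -> hderivable f x ->
  is_derive x 1 f (hderiv f x).
Proof.
by move=> x0; rewrite /hderivable /hderiv x0 => h; apply: DeriveDef; rewrite -?derive1E.
Qed.

(** Differentiability at every positive point, with continuous derivative, empties the exceptional
    set. *)
Lemma weak_derivative_hderiv {R : realType} (f g U : R -> R) (N : set R) :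
  weak_derivative f g N -> continuous U -> (forall x, 0 <= x -> hderiv f x = U x) ->
  (forall x, 0 < x -> hderivable f x) -> weak_derivative f U set0.
Proof.
move=> wfg cU fU df.
have iU (x y : R) : (@lebesgue_measure R).-integrable `[x, y] (EFin \o U).
  by apply: continuous_compact_integrable; [exact: segment_compact|exact: continuous_subspaceT].
have mU : measurable_fun setT U by exact: continuous_measurable_fun.
have Ug (x : R) : 0 <= x -> ~ N x -> U x = g x.
  by move=> x0 Nx; rewrite -fU//; exact: (weak_hderiv _ _ _ wfg).
split => //.
- exact: weak_ac wfg.
- exact: weak_f0 wfg.
- by move=> x x0 _; rewrite -fU ?(ltW x0)//; apply: hderivable_is_derive => //; exact: df.
- by move=> x x0 _; exact: fU.
- move=> x y x0 xy; rewrite -(weak_ftc _ _ _ wfg x y x0 xy) /Rintegral; congr fine.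
  apply: (integral_off_null (@lebesgue_measure R) N) => //; [exact: weak_mN wfg|exact: weak_N0 wfg|].
  move=> t; rewrite /= in_itv/= => /andP[xt _] Nt.
  by rewrite Ug// (le_trans x0).
have ik := weak_energy _ _ _ wfg.
apply: ae_eq_integrable ik => //.
  apply/measurable_EFinP; apply: measurable_funTS; apply: measurable_funD; first exact: measurable_funX.
  apply: measurable_funM; first exact: measurable_funD.
  by apply: measurable_funX; exact: weak_measurable f g N wfg.
exists N; split; [exact: weak_mN wfg|exact: weak_N0 wfg|].
move=> x /= /not_implyP[]; rewrite in_itv/= andbT => x0 h.
by apply: contrapT => Nx; apply: h; rewrite Ug.
Qed.

(** * Eigenfunctions and the value of the form *)

Section eigenfunction.
Context {R : realType} (c l : R) (w : R -> R) (cW : continuous (fun x : R => w (Num.max 0 x))).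
Context (f g : R -> R) (N : set R) (wfg : weak_derivative f g N).
Hypothesis eigen : forall x : R, 0 <= x -> hderivable f x /\
  hderiv f x - hderiv f 0 = c * f x * w x
    - \int[lebesgue_measure]_(y in `[0, x]) (c * w y * hderiv f y)
    + \int[lebesgue_measure]_(y in `[0, x]) ((y - l) * f y).

Notation mu := (@lebesgue_measure R).
Notation F := (fun x : R => f (Num.max 0 x)).
Notation W := (fun x : R => w (Num.max 0 x)).

Let cF : continuous F.
Proof. exact/loc_abs_continuous_max0/(weak_ac _ _ _ wfg). Qed.

Let potential_continuous : continuous (fun y => (y - l) * F y).
Proof.
move=> x; apply: cvgM; last exact: cF.
by apply: (@cvgB _ R^o); [exact: cvg_id|exact: cvg_cst].
Qed.

(** In the right-hand side of the eigenvalue equation the derivative of [f] occurs only under an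
    integral, where it may be replaced by [g]; integrals of locally integrable functions are
    continuous in the endpoint. *)
Lemma eigenfunction_derivative_continuous :
  exists2 U : R -> R, continuous U & forall x, 0 <= x -> hderiv f x = U x.
Proof.
have ik1 (X : R) : 0 <= X -> mu.-integrable `[0, X] (EFin \o (fun y => c * W y * g y)).
  move=> X0; have [K K1 HK] := continuous_norm_bounded W X cW.
  have ig := weak_int _ _ _ wfg 0 X (lexx 0) X0.
  have ig' : mu.-integrable `[0, X] (fun y => (`|c| * K)%:E * (g y)%:E)%E.
    exact: (@integrableZl _ _ R mu _ _ (`|c| * K) (EFin \o g)).
  apply: le_integrable ig' => //.
    apply/measurable_EFinP; apply: measurable_funTS; apply: measurable_funM; last exact: weak_meas wfg.
    by apply: measurable_funM => //; exact: continuous_measurable_fun.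
  move=> y; rewrite /= in_itv/= => yX; rewrite lee_fin !normrM normr_id.
  have K0 : 0 <= K by apply: le_trans K1.
  by rewrite (ger0_norm K0) ler_wpM2r// ler_wpM2l// HK.
have ik2 (X : R) : 0 <= X -> mu.-integrable `[0, X] (EFin \o (fun y => (y - l) * F y)).
  by move=> _; apply: continuous_compact_integrable; [exact: segment_compact|exact: continuous_subspaceT].
exists (fun x => c * F x * W x + (hderiv f 0
  - \int[lebesgue_measure]_(y in `[0, Num.max 0 x]) (c * W y * g y)
  + \int[lebesgue_measure]_(y in `[0, Num.max 0 x]) ((y - l) * F y))).
  move=> x; apply: (@cvgD _ R^o).
    by apply: cvgM; [apply: cvgM; [exact: cvg_cst|exact: cF]|exact: cW].
  apply: (@cvgD _ R^o); last exact: (integral_max0_continuous _ ik2 x).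
  by apply: (@cvgB _ R^o); [exact: cvg_cst|exact: (integral_max0_continuous _ ik1 x)].
move=> x x0; have [_ h] := eigen x x0.
rewrite max_r//.
have <- : \int[lebesgue_measure]_(y in `[0, x]) (c * w y * hderiv f y) =
    \int[lebesgue_measure]_(y in `[0, x]) (c * W y * g y).
  rewrite /Rintegral; congr fine.
  apply: (integral_off_null (@lebesgue_measure R) N) => //; [exact: weak_mN wfg|exact: weak_N0 wfg|].
  move=> t; rewrite /= in_itv/= => /andP[t0 _] Nt.
  by rewrite max_r// (weak_hderiv _ _ _ wfg).
have <- : \int[lebesgue_measure]_(y in `[0, x]) ((y - l) * f y) =
    \int[lebesgue_measure]_(y in `[0, x]) ((y - l) * F y).
  by apply: eq_Rintegral => t; rewrite inE/= in_itv/= => /andP[t0 _]; rewrite max_r.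
by move: h; lra.
Qed.

Notation D := (noise_drift c W).
Notation E := (noise_increment c W).

(* The density is the derivative of [F (U + F D)], since [U - c F W] is continuously differentiable. *)
Lemma eigenfunction_form (U : R -> R) (X : R) : continuous U ->
  (forall x, 0 <= x -> hderiv f x = U x) -> 0 <= X ->
  \int[lebesgue_measure]_(x in `[0, X]) (form_density D E x (F x) (U x) - l * F x ^+ 2) =
    F X * (U X + F X * D X).
Proof.
move=> cU fU X0.
have wfU : weak_derivative f U set0.
  apply: weak_derivative_hderiv wfg cU fU _ => x x0.
  by have [] := eigen x (ltW x0).
(* Nothing is known of [f] at negative arguments; [Ft] agrees with it on [[0, oo)] and has a
   two-sided derivative at [0]. *)
pose Ft := primitive U.
have FtE (x : R) : 0 <= x -> Ft x = f x.
  move=> x0; have := weak_ftc _ _ _ wfU 0 x (lexx 0) x0.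
  by rewrite integral_primitive// primitive0 (weak_f0 _ _ _ wfU) !subr0.
have cWU : continuous (fun y => c * W y * U y).
  by move=> x; apply: cvgM; [apply: cvgM; [exact: cvg_cst|exact: cW]|exact: cU].
pose P x := hderiv f 0 - primitive (fun y => c * W y * U y) x + primitive (fun y => (y - l) * F y) x.
have PE (x : R) : 0 <= x -> P x = U x - c * f x * w x.
  move=> x0; have [_ h] := eigen x x0; move: h; rewrite (fU x x0).
  have -> : \int[lebesgue_measure]_(y in `[0, x]) (c * w y * hderiv f y) =
      primitive (fun y => c * W y * U y) x.
    rewrite -[RHS]subr0 -[X in _ = _ - X](primitive0 (fun y => c * W y * U y)) -integral_primitive//.
    by apply: eq_Rintegral => t; rewrite inE/= in_itv/= => /andP[t0 _]; rewrite max_r// fU.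
  have -> : \int[lebesgue_measure]_(y in `[0, x]) ((y - l) * f y) = primitive (fun y => (y - l) * F y) x.
    rewrite -[RHS]subr0 -[X in _ = _ - X](primitive0 (fun y => (y - l) * F y)) -integral_primitive//.
    by apply: eq_Rintegral => t; rewrite inE/= in_itv/= => /andP[t0 _]; rewrite max_r.
  by rewrite /P; lra.
pose H x := Ft x * (P x + Ft x * noise_average c W x).
have dH (x : R) : 0 <= x <= X -> is_derive x 1 H (form_density D E x (F x) (U x) - l * F x ^+ 2).
  move=> /andP[x0 _].
  have d1 := derive_primitive U cU x x0.
  have d2 : is_derive x 1 P (0 - c * W x * U x + (x - l) * F x).
    apply: derD; last exact: derive_primitive.
    exact: derB _ _ _ _ _ (derC _ x) (derive_primitive _ cWU x x0).
  have d3 := derive_noise_average c W cW x x0.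
  have d4 := derM _ _ _ _ _ d1 (derD _ _ _ _ _ d2 (derM _ _ _ _ _ d1 d3)).
  apply: derE d4 _.
  by rewrite -/Ft PE// FtE// /form_density /noise_drift !max_r//; ring.
have chh : continuous (fun x => form_density D E x (F x) (U x) - l * F x ^+ 2).
  have cD := noise_drift_continuous c W cW; have cE := noise_increment_continuous c W cW.
  move=> x; have h1 := cF x; have h2 := cU x; have h3 := cD x; have h4 := cE x.
  apply: (@cvgB _ R^o); last by apply: cvgM; [exact: cvg_cst|exact: cvgM].
  apply: (@cvgD _ R^o); first apply: (@cvgD _ R^o).
  - by apply: cvgM.
  - by apply: cvgM; [apply: (@cvgD _ R^o) => //; exact: cvg_id|exact: cvgM].
  - by apply: cvgM; [exact: cvg_cst|apply: cvgM => //; exact: cvgM].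
rewrite /Rintegral (integral_derive H _ 0 X X0 dH); last exact: continuous_subspaceT.
rewrite /= /H PE// !FtE// (weak_f0 _ _ _ wfg) mul0r subr0 /noise_drift !max_r//.
by ring.
Qed.

Hypothesis W_sub : subdiffusive W.

Lemma eigenvalue_form : exists U,
  weak_derivative f U set0 /\
  \int[lebesgue_measure]_(x in `[0, +oo[) form_density D E x (F x) (U x) =
    l * \int[lebesgue_measure]_(x in `[0, +oo[) F x ^+ 2.
Proof.
have [U cU fU] := eigenfunction_derivative_continuous.
have wfU : weak_derivative f U set0.
  apply: weak_derivative_hderiv wfg cU fU _ => x x0.
  by have [] := eigen x (ltW x0).
exists U; split => //.
have cD := noise_drift_continuous c W cW; have cE := noise_increment_continuous c W cW.
have D_small := noise_drift_small c W cW W_sub; have E_small := noise_increment_small c W W_sub.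
have ih := excess_integrable D E cD cE D_small E_small f U set0 wfU l.
have mh := excess_measurable D E cD cE f U set0 wfU l.
have i1 := form_density_integrable D E cD cE D_small E_small f U set0 wfU.
have i2 := mass_density_integrable f U set0 wfU.
have i2' : mu.-integrable `[0, +oo[ (EFin \o (fun x => l * F x ^+ 2)).
  by apply: (@integrableZl _ _ R mu _ _ l (EFin \o (fun x => F x ^+ 2))).
apply/eqP; rewrite -subr_eq0 -RintegralZl// -RintegralB//; apply/eqP.
set I := \int[_]_(_ in _) _.
apply/eqP; rewrite -normr_le0; apply/ler_addgt0Pr => e e0; rewrite add0r.
have e20 : 0 < e / 2 by lra.
have [M M0 HM] := integral_itv0y_tail _ mh ih _ e20.
have [C C0 HC] := D_small 1 ltr01.
(* The boundary term [f (f' + f D)] at [X] is at most [C + 2] times the energy density, because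
   [D^2 <= 1 + X + C]. *)
have e1 : 0 < e / 2 / (C + 2) by rewrite divr_gt0// ltr_wpDl.
have [X MX] := integrable_itv0y_small _ (energy_density_measurable f U set0 wfU) (weak_energy _ _ _ wfU) _ _ e1 M0.
rewrite ltr_pdivlMr ?ltr_wpDl// => hX.
have X0 := le_trans M0 MX.
have := HM X MX; rewrite eigenfunction_form// -/I.
move: hX; rewrite !max_r// => hX.
set x := f X in hX *; set u := U X in hX *; set d := D X.
have hd : x ^+ 2 * d ^+ 2 <= x ^+ 2 * (1 * (1 + X) + C) by rewrite ler_wpM2l ?sqr_ge0// HC.
have h1 := sqr_ge0 (x + u); have h2 := sqr_ge0 (x - u).
have h3 : 0 <= x ^+ 2 * (d + 1) ^+ 2 by rewrite mulr_ge0 ?sqr_ge0.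
have h4 : 0 <= x ^+ 2 * (d - 1) ^+ 2 by rewrite mulr_ge0 ?sqr_ge0.
have h5 : 0 <= X * x ^+ 2 by rewrite mulr_ge0 ?sqr_ge0.
have h6 : 0 <= C * u ^+ 2 by rewrite mulr_ge0 ?sqr_ge0.
have h7 : 0 <= C * (X * x ^+ 2) by rewrite mulr_ge0.
have h8 := sqr_ge0 u; have h9 := sqr_ge0 x; have h10 : 0 <= C * x ^+ 2 by rewrite mulr_ge0.
move: hX hd h1 h2 h3 h4 h5 h6 h7 h8 h9 h10; rewrite !expr2 => hX hd h1 h2 h3 h4 h5 h6 h7 h8 h9 h10.
rewrite ltr_norml => /andP[h11 h12].
by rewrite ler_norml; apply/andP; split; lra.
Qed.

End eigenfunction.

Lemma is_derive_hderiv {R : realType} (f : R -> R) (x a : R) : 0 <= x ->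
  is_derive x 1 f a -> hderivable f x /\ hderiv f x = a.
Proof.
move=> x0 fa; have [df fE] := fa; rewrite /hderivable /hderiv.
case: ifPn => [_|]; first by split => //; rewrite derive1E.
rewrite -leNgt => x0'; have {x0 x0'} xE : x = 0 by apply/eqP; rewrite eq_le x0'.
have h : (fun h : R => h^-1 * (f h - f 0)) @ (0 : R)^'+ --> a.
  have dl : h^-1 *: (f (h + x) - f x) @[h --> 0^'] --> a.
    by rewrite -fE; move: df; rewrite /derivable /derive => /cvgP; under eq_fun do rewrite scaler1.
  have := cvg_dnbhs_at_right dl.
  by apply: cvg_trans; apply: near_eq_cvg; apply: nearW => h /=; rewrite xE addr0.
by split; [apply/cvg_ex; exists a|exact: cvg_lim h].
Qed.

Section schroedinger_eigenfunction.
Context {R : realType} (c l : R) (w : R -> R) (cW : continuous (fun x : R => w (Num.max 0 x))).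

Notation mu := (@lebesgue_measure R).
Notation W := (fun x : R => w (Num.max 0 x)).
Notation D := (noise_drift c W).
Notation E := (noise_increment c W).

Context (phi v : R -> R) (s : schroedinger_solution D E l phi v).

Let cD : continuous D := noise_drift_continuous c W cW.
Let cphi : continuous (fun x : R => phi (Num.max 0 x)) := proj1 (solution_max0_cont D E l phi v s).
Let cv : continuous (fun x : R => v (Num.max 0 x)) := proj2 (solution_max0_cont D E l phi v s).

Let U (a x : R) := a * (v (Num.max 0 x) - D x * phi (Num.max 0 x)).

Let cU a : continuous (U a).
Proof.
move=> x; apply: cvgM; first exact: cvg_cst.
by apply: (@cvgB _ R^o); [exact: cv|apply: cvgM; [exact: cD|exact: cphi]].
Qed.

Let dphi a (x : R) : 0 <= x -> is_derive x 1 (fun y => a * phi y) (U a x).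
Proof.
move=> x0; have [_ _ H] := s; have [d1 _] := H x x0.
by apply: derE (derM (fun=> a) phi x 0 _ (derC a x) d1) _; rewrite /U !max_r// mul0r add0r.
Qed.

Lemma solution_Lstar (a M : R) : (forall X, 0 <= X -> energy D phi v X <= M) ->
  Lstar (fun x => a * phi x).
Proof.
move=> HM; have [p0 _ _] := s; split; last 2 first.
- by rewrite p0 mulr0.
- pose k (x : R) := U a x ^+ 2 + (1 + Num.max 0 x) * (a * phi (Num.max 0 x)) ^+ 2.
  have ck : continuous k.
    move=> x; apply: (@cvgD _ R^o); first by apply: cvgM; exact: cU.
    apply: cvgM.
      apply: (@cvgD _ R^o); first exact: cvg_cst.
      by apply: continuous_max; [exact: cvg_cst|exact: cvg_id].
    by apply: cvgM; (apply: cvgM; [exact: cvg_cst|exact: cphi]).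
  have k0 x : 0 <= k x.
    by rewrite addr_ge0 ?sqr_ge0// mulr_ge0 ?sqr_ge0// addr_ge0// le_max lexx.
  have ik : mu.-integrable `[0, +oo[ (EFin \o k).
    apply: (integrable_itv0y_bounded k (a ^+ 2 * M)) => //; first exact: continuous_measurable_fun.
    move=> X X0.
    have dk (x : R) : 0 <= x <= X -> is_derive x 1 (fun y => a ^+ 2 * energy D phi v y) (k x).
      move=> /andP[x0 _].
      apply: derE (derM (fun=> a ^+ 2) _ x 0 _ (derC _ x) (derive_energy D E cD l phi v s x x0)) _.
      by rewrite mul0r add0r /k /U !max_r//; ring.
    rewrite (integral_derive _ k 0 X X0 dk); last exact: continuous_subspaceT.
    rewrite lee_fin {2}/energy primitive0 mulr0 subr0.
    by rewrite ler_wpM2l ?sqr_ge0// HM.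
  have /integrableP[_] := ik; apply: le_lt_trans; rewrite le_eqVlt; apply/orP; left; apply/eqP.
  apply: eq_integral => x; rewrite inE/= in_itv/= andbT => x0.
  have [_ ->] := is_derive_hderiv _ x _ x0 (dphi a x x0).
  rewrite ger0_norm// /k max_r//.
move=> x y x0 xy.
have [K K1 HK] := continuous_norm_bounded (U a) y (cU a).
apply: (lipschitz_abs_continuous_on x y K).
apply: (derivable_lipschitz x y K _ (U a)) => z /andP[xz zy].
  by apply: dphi; exact: le_trans xz.
by apply: HK; rewrite zy (le_trans x0 xz).
Qed.

Lemma solution_eigen_equation (a x : R) : 0 <= x ->
  hderivable (fun y => a * phi y) x /\
  hderiv (fun y => a * phi y) x - hderiv (fun y => a * phi y) 0 = c * (a * phi x) * w x
    - \int[lebesgue_measure]_(y in `[0, x]) (c * w y * hderiv (fun y => a * phi y) y)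
    + \int[lebesgue_measure]_(y in `[0, x]) ((y - l) * (a * phi y)).
Proof.
move=> x0.
have hU (y : R) : 0 <= y -> hderiv (fun y => a * phi y) y = U a y.
  by move=> y0; have [] := is_derive_hderiv _ y _ y0 (dphi a y y0).
split; first by have [] := is_derive_hderiv _ x _ x0 (dphi a x x0).
pose k1 (y : R) := c * W y * U a y.
pose k2 (y : R) := (y - l) * (a * phi (Num.max 0 y)).
have ck1 : continuous k1.
  by move=> y; apply: cvgM; [apply: cvgM; [exact: cvg_cst|exact: cW]|exact: cU].
have ck2 : continuous k2.
  move=> y; apply: cvgM; last by apply: cvgM; [exact: cvg_cst|exact: cphi].
  by apply: (@cvgB _ R^o); [exact: cvg_id|exact: cvg_cst].
have -> : \int[lebesgue_measure]_(y in `[0, x]) (c * w y * hderiv (fun y => a * phi y) y) =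
    \int[lebesgue_measure]_(y in `[0, x]) k1 y.
  by apply: eq_Rintegral => t; rewrite inE/= in_itv/= => /andP[t0 _]; rewrite /k1 max_r// hU.
have -> : \int[lebesgue_measure]_(y in `[0, x]) ((y - l) * (a * phi y)) =
    \int[lebesgue_measure]_(y in `[0, x]) k2 y.
  by apply: eq_Rintegral => t; rewrite inE/= in_itv/= => /andP[t0 _]; rewrite /k2 max_r.
have [p0 v0 H] := s.
(* On [[0, oo)], [G] is [f' - c f w] for [f = a * phi]: the part of [f'] that is itself
   differentiable. *)
pose G (y : R) := a * (v y - noise_average c W y * phi y).
have dG (y : R) : 0 <= y <= x -> is_derive y 1 G (k2 y - k1 y).
  move=> /andP[y0 _]; have [d1 d2] := H y y0.
  have d3 := derive_noise_average c W cW y y0.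
  have d4 := derB _ _ _ _ _ d2 (derM _ _ _ _ _ d3 d1).
  apply: derE (derM (fun=> a) _ y 0 _ (derC a y) d4) _.
  by rewrite /k1 /k2 /U /noise_drift !max_r//; ring.
have ck21 : continuous (fun y => k2 y - k1 y).
  by move=> y; apply: (@cvgB _ R^o); [exact: ck2|exact: ck1].
have := integral_derive G _ 0 x x0 dG (continuous_subspaceT ck21).
have ic (k : R -> R) : continuous k -> mu.-integrable `[0, x] (EFin \o k).
  by move=> ck; apply: continuous_compact_integrable; [exact: segment_compact|exact: continuous_subspaceT].
move=> hG.
have : \int[lebesgue_measure]_(y in `[0, x]) (k2 y - k1 y) = G x - G 0 by rewrite /Rintegral hG.
rewrite RintegralB; [|by []|exact: ic|exact: ic].
rewrite !hU// /G /U /noise_drift !max_r// p0 v0.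
move: (\int[lebesgue_measure]_(y in `[0, x]) k1 y) (\int[lebesgue_measure]_(y in `[0, x]) k2 y) => A B h.
by rewrite -addrA (addrC _ B) h; ring.
Qed.

End schroedinger_eigenfunction.

Lemma stochastic_airy_ground_state {R : realType} (beta : R) (w : R -> R) : 0 < beta ->
  {within `[0, +oo[, continuous w} -> subdiffusive w ->
  exists (f0 : R -> R) (L0 : R),
    [/\ airy_admissible f0, (airy_form beta w f0)%:E = airy_inf beta w,
        airy_eigenpair beta w f0 L0 &
        forall f l, airy_eigenpair beta w f l -> L0 <= l].
Proof.
move=> beta0 /within_itvcy_max0 cW subw.
pose W (x : R) := w (Num.max 0 x).
have W_sub : subdiffusive W.
  move=> e e0; have [C C0 H] := subw e e0; exists C => // x y x0 y0 y1.
  by rewrite /W !max_r ?addr_ge0//; exact: H.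
pose c := 2 / Num.sqrt beta.
pose D := noise_drift c W; pose E := noise_increment c W.
have cD : continuous D := noise_drift_continuous c W cW.
have cE : continuous E := noise_increment_continuous c W cW.
have D_small := noise_drift_small c W cW W_sub; have E_small := noise_increment_small c W W_sub.
have DE (x : R) : 0 <= x -> D x = 2 / Num.sqrt beta * (bbar w x - w x).
  by move=> x0; rewrite (bbar_primitive w x cW x0) /D /noise_drift /noise_average /W !max_r// -/c; ring.
have EE (x : R) : 0 <= x -> E x = 2 / Num.sqrt beta * bbar' w x.
  by move=> x0; rewrite /E /noise_increment /bbar' /W !max_r// addr_ge0.
have [l [phi [v [M [s pos HM]]]]] := ground_state_exists D E cD cE D_small E_small.
have mass1 (f : R -> R) : L2norm f = 1%E -> \int[lebesgue_measure]_(x in `[0, +oo[) (f (Num.max 0 x) ^+ 2) = 1.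
  by move/L2norm_eq1; rewrite /Rintegral => ->.
have lower (f : R -> R) : Lstar f -> L2norm f = 1%E -> l <= airy_form beta w f.
  move=> /Lstar_weak_derivative[g [N wfg]] /mass1 f1.
  rewrite (airy_form_density D E cD cE D_small E_small f g N wfg beta w beta0 DE EE).
  have := ground_state_inequality D E cD cE D_small E_small f g N wfg l phi v s pos.
  by rewrite f1 mulr1.
have value (f : R -> R) (l' : R) : airy_eigenpair beta w f l' -> airy_form beta w f = l'.
  move=> [/Lstar_weak_derivative[g [N wfg]] /mass1 f1 eigen].
  have [U [wfU h]] := eigenvalue_form c l' w cW f g N wfg eigen W_sub.
  rewrite (airy_form_density D E cD cE D_small E_small f U set0 wfU beta w beta0 DE EE).
  by move: h; rewrite f1 mulr1.
have Lphi (a : R) : Lstar (fun x => a * phi x) := solution_Lstar c l w cW phi v s a M HM.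
(* The case [a = 1] gives the integrability of [phi ^ 2], from which the normalising factor is then
   defined. *)
have [g [N wphi]] := Lstar_weak_derivative _ (Lphi 1).
have := mass_density_integrable _ _ _ wphi.
under [X in _.-integrable _ (EFin \o X)]eq_fun do rewrite mul1r.
move=> iphi.
pose I := \int[lebesgue_measure]_(x in `[0, +oo[) (phi (Num.max 0 x) ^+ 2).
have I0 : 0 < I.
  have := mass_gt0 D E cD cE l phi v s 1 ltr01.
  rewrite -[mass phi 1]subr0 -(primitive0 (fun x => phi (Num.max 0 x) ^+ 2)) -integral_primitive//; last first.
    have [cphi _] := solution_max0_cont D E l phi v s.
    by move=> x; apply: cvgM; exact: cphi.
  move=> /lt_le_trans; apply; rewrite -subr_ge0 /I.
  rewrite Rintegral_itvB//; last by rewrite bnd_simp.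
  by apply: Rintegral_ge0 => x _; exact: sqr_ge0.
pose a := (Num.sqrt I)^-1.
have eig : airy_eigenpair beta w (fun x => a * phi x) l.
  split; [exact: Lphi| |by move=> x x0; exact: (solution_eigen_equation c l w cW phi v s a x x0)].
  apply/L2norm_eq1.
  have [g' [N' wa]] := Lstar_weak_derivative _ (Lphi a).
  rewrite -[LHS]fineK; last exact: (integrable_fin_num _ (mass_density_integrable _ _ _ wa)).
  congr EFin; rewrite -/(Rintegral _ _ _).
  under eq_Rintegral do rewrite exprMn.
  by rewrite RintegralZl// -/I /a exprVn sqr_sqrtr ?ltW// mulVf// gt_eqF.
exists (fun x => a * phi x), l; split => //.
- by case: eig => h1 h2 _; split => //; have [_ ->] := h1.
- rewrite (value _ _ eig); apply/eqP; rewrite eq_le; apply/andP; split.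
    apply: le_ereal_inf_tmp => _ [f [Lf _ f1] <-]; rewrite lee_fin; exact: lower.
  apply: ereal_inf_lbound; exists (fun x => a * phi x); last by rewrite (value _ _ eig).
  by case: eig => h1 h2 _; split => //; have [_ ->] := h1.
- move=> f l' h; rewrite -(value _ _ h); have [h1 h2 _] := h; exact: lower.
Qed.

Theorem corollary2p6 (R : realType) (d : measure_display)
    (T : measurableType d) (P : probability T R) (b : R -> {RV P >-> R})
    (hb : brownian_motion b) (beta : R) (hbeta : 0 < beta) :
  {ae P, forall w : T,
    exists (f0 : R -> R) (L0 : R),
      [/\ airy_admissible f0,
          (airy_form beta (fun t => b t w) f0)%:E =
            airy_inf beta (fun t => b t w),
          airy_eigenpair beta (fun t => b t w) f0 L0
        & forall (f : R -> R) (l : R),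
            airy_eigenpair beta (fun t => b t w) f l -> L0 <= l]}.
Proof.
have [_ cb _ _] := hb.
have db := brownian_dyadic_bound b hb.
apply: (@filterS2 _ _ (ae_filter_ringOfSetsType P) _ _ _ _ cb db) => w cw [S S0 dS].
exact: stochastic_airy_ground_state hbeta cw (dyadic_bound_subdiffusive S _ S0 cw dS).
Qed.
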